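(* Let $k,n_1,n_2\in\mathbb{N}$ and let $a=(a_1,\dots,a_k)\in\mathcal{M}_{n_1}^k$ and $b=(b_1,\dots,b_k)\in\mathcal{M}_{n_2}^k$ be $k$-tuples of self-adjoint matrices. Define $a'\in\mathcal{M}_{n_1}^k$ and $b'\in\mathcal{M}_{n_2+1}^k$ by $$a'=\tfrac1{n_1}a,\qquad b'=(b_1\oplus 0,\dots,b_k\oplus 0),$$ and let $\omega:\mathcal{M}_{n_2+1}\to\mathbb{C}$ be the state $$\omega([x_{ij}])=\frac1{n_1}\cdot\frac1{n_2}\sum_{i=1}^{n_2}x_{ii}+\frac{n_1-1}{n_1}\,x_{n_2+1,n_2+1}.$$ The following are equivalent: (1) $(\mathrm{id}_{\mathcal{M}_p}\otimes\mathrm{tr}_{n_1})(F(a'))\le(\mathrm{id}_{\mathcal{M}_p}\otimes\omega)(F(b'))$ for every $p\le\infty$ and every nc majorization function $F:K\to\mathcal{M}_p(\mathcal{M})$, where $K$ is any closed nc $k$-ball containing $a'$ and $b'$; (2) there is a trace-preserving completely positive map $\Phi:\mathcal{M}_{n_2}\to\mathcal{M}_{n_1}$ (meaning $\mathrm{tr}_{n_1}\circ\Phi=\mathrm{tr}_{n_2}$ for the normalized traces) such that $\Phi(b_i)=a_i$ for all $1\le i\le k$.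
   Context: Conventions. Indices $m,n,p\le\infty$ range over $\{1,2,\dots\}\cup\{\infty\}$. For each $n\le\infty$ fix a complex Hilbert space $H_n$ of dimension $n$ ($H_\infty$ of countably infinite dimension). $\mathcal{M}_{m,n}$ is the space of bounded operators $H_n\to H_m$ with the weak* topology (the norm topology if $m,n<\infty$); $\mathcal{M}_n=\mathcal{M}_{n,n}$ with identity $1_n$; $\mathcal{M}=\sqcup_{n\le\infty}\mathcal{M}_n$. $\mathcal{M}_p(\mathcal{M}_n)$ is identified with the bounded operators on $H_p\otimes H_n$, and $\mathcal{M}_p(\mathcal{M})=\sqcup_n\mathcal{M}_p(\mathcal{M}_n)$. The subscript sa denotes self-adjoint elements, the superscript $+$ positive elements, and $\alpha\ge\beta$ means $\alpha-\beta$ is positive. $\mathcal{M}_n^k$ has the product topology, and for $x=(x_1,\dots,x_k)\in\mathcal{M}_n^k$, $\alpha x\beta=(\alpha x_1\beta,\dots,\alpha x_k\beta)$. For $n<\infty$, $\mathrm{tr}_n:\mathcal{M}_n\to\mathbb{C}$ is the trace normalized so that $\mathrm{tr}_n(1_n)=1$. Closed nc $k$-ball. For $r>0$, the closed nc $k$-ball of radius $r$ is the graded set $K=\sqcup_{n\le\infty}K_n$ with $K_n=\{x=(x_1,\dots,x_k)\in\mathcal{M}_n^k:\sum_{i=1}^k x_ix_i^*\le r^2 1_n\}$. Multivalued nc functions. Let $K$ be a closed nc $k$-ball and $p\le\infty$. A multivalued nc function $F:K\to\mathcal{M}_p(\mathcal{M})$ assigns to every $n\le\infty$ and $x\in K_n$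 a nonempty set $F(x)\subseteq\mathcal{M}_p(\mathcal{M}_n)_{\mathrm{sa}}$ such that $F(\alpha^*x\alpha)=(1_p\otimes\alpha^* )F(x)(1_p\otimes\alpha)$ for every unitary $\alpha\in\mathcal{M}_n$, and $F(x)=F(x)+\mathcal{M}_p(\mathcal{M}_n)^+$. It is bounded if there is $\lambda>0$ such that for every $x\in K$ and $\beta\in F(x)$ there is $\alpha\in F(x)$ with $\alpha\le\beta$ and $\|\alpha\|\le\lambda$. Its graph is $\mathrm{Graph}(F)=\sqcup_n\mathrm{Graph}_n(F)$ with $\mathrm{Graph}_n(F)=\{(x,T):x\in K_n,\ T\in F(x)\}\subseteq K_n\times\mathcal{M}_p(\mathcal{M}_n)$. $F$ is convex if $\mathrm{Graph}(F)$ is an nc convex set, i.e. for every $n\le\infty$, every bounded sequence $(x_i,T_i)\in\mathrm{Graph}_{n_i}(F)$ and every sequence $\alpha_i\in\mathcal{M}_{n_i,n}$ with $\sum_i\alpha_i^*\alpha_i=1_n$, one has $\big(\sum_i\alpha_i^*x_i\alpha_i,\ \sum_i(1_p\otimes\alpha_i^* )T_i(1_p\otimes\alpha_i)\big)\in\mathrm{Graph}_n(F)$. $F$ is lower semicontinuous if each $\mathrm{Graph}_n(F)$ is closed in $\mathcal{M}_n^k\times\mathcal{M}_p(\mathcal{M}_n)$ (weak* topologies). An nc majorization function is a bounded lower semicontinuous convex multivalued nc function $F:K\to\mathcal{M}_p(\mathcal{M})$, for some $p\le\infty$. Set inequalities. For a unital completely positive map $\psi:\mathcal{M}_n\to\mathcal{M}_m$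 ($m,n<\infty$) and $x\in K_n$, $(\mathrm{id}_{\mathcal{M}_p}\otimes\psi)(F(x))=\{(\mathrm{id}_{\mathcal{M}_p}\otimes\psi)(\alpha):\alpha\in F(x)\}$. For two sets $S,T$ of self-adjoint elements, $S\le T$ means that for every $\beta\in T$ there is $\alpha\in S$ with $\alpha\le\beta$. *)

(* Defs.v *)
From HB Require Import structures.
From mathcomp Require Import all_boot all_order all_algebra.
From mathcomp Require Import sesquilinear complex.
From mathcomp Require Import ring lra.
From mathcomp Require Import all_classical all_reals ereal topology normedtype esum.

Set Implicit Arguments.
Unset Strict Implicit.
Unset Printing Implicit Defensive.

Import Order.TTheory GRing.Theory Num.Theory.
Import numFieldNormedType.Exports.

Local Open Scope classical_set_scope.
Local Open Scope ring_scope.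
Local Open Scope complex_scope.

Section SquareSummable.
Variable R : realType.
Local Notation C := R[i].

Definition sqmod (z : C) : R := complex.Re z ^+ 2 + complex.Im z ^+ 2.

Lemma sqmod_ge0 z : 0 <= sqmod z.
Proof. by rewrite addr_ge0 ?sqr_ge0. Qed.

Lemma sqmod0 : sqmod 0 = 0.
Proof. by rewrite /sqmod /= expr0n /= addr0. Qed.

Lemma sqmodM x y : sqmod (x * y) = sqmod x * sqmod y.
Proof. by case: x y => a b [c d]; rewrite /sqmod /=; ring. Qed.

Lemma sqmodD x y : sqmod (x + y) <= 2 * sqmod x + 2 * sqmod y.
Proof.
case: x y => a b [c d]; rewrite /sqmod /= -subr_ge0.
rewrite (_ : _ - _ = (a - c) ^+ 2 + (b - d) ^+ 2); last by ring.
by rewrite addr_ge0 ?sqr_ge0.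
Qed.


Lemma esum_le (I : choiceType) (A : set I) (f : I -> \bar R) (M : \bar R) :
  (forall X, fsets A X -> (\sum_(i \in X) f i <= M)%E) ->
  (\esum_(i in A) f i <= M)%E.
Proof. by move=> h; apply: ge_ereal_sup => _ [X AX <-]; exact: h. Qed.

Lemma esum_scale (I : choiceType) (A : set I) (f : I -> \bar R) (c : R) :
  0 <= c -> (forall i, 0 <= f i)%E ->
  (\esum_(i in A) (c%:E * f i) <= c%:E * \esum_(i in A) f i)%E.
Proof.
move=> c0 f0; apply: esum_le => X AX.
rewrite -ge0_mule_fsumr//; apply: lee_wpmul2l; first by rewrite lee_fin.
by apply: ereal_sup_ubound; exists X.
Qed.

Lemma esum_subset (I : choiceType) (A B : set I) (f : I -> \bar R) :
  A `<=` B -> (\esum_(i in A) f i <= \esum_(i in B) f i)%E.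
Proof.
move=> AB; apply: esum_le => X [fX XA].
by apply: ereal_sup_ubound; exists X => //; split=> // x /XA /AB.
Qed.

Variable I : choiceType.
Implicit Types f g : I -> C.

Definition sqsum f : \bar R := (\esum_(i in [set: I]) (sqmod (f i))%:E)%E.

Lemma sqsum_ge0 f : (0 <= sqsum f)%E.
Proof. by apply: esum_ge0 => i _; rewrite lee_fin sqmod_ge0. Qed.

Lemma sqsumD f g : (sqsum (f + g)%R <= 2%:E * sqsum f + 2%:E * sqsum g)%E.
Proof.
have h0 (h : I -> C) i : (0 <= (sqmod (h i))%:E)%E by rewrite lee_fin sqmod_ge0.
have h2 : (0 <= 2 :> R) by [].
apply: (le_trans _ (leeD (esum_scale _ h2 (h0 f)) (esum_scale _ h2 (h0 g)))).
rewrite -esumD => [|i _|i _]; last 2 first.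
- by rewrite mule_ge0 ?lee_fin ?sqmod_ge0.
- by rewrite mule_ge0 ?lee_fin ?sqmod_ge0.
by apply: le_esum => i _; rewrite -!EFinM -EFinD lee_fin; exact: sqmodD.
Qed.

Lemma sqsumZ a f : (sqsum (a *: f)%R <= (sqmod a)%:E * sqsum f)%E.
Proof.
apply: le_trans; last first.
  by apply: esum_scale; rewrite ?sqmod_ge0// => i; rewrite lee_fin sqmod_ge0.
by apply: le_esum => i _; rewrite -EFinM lee_fin sqmodM.
Qed.

Lemma sqsum0 : sqsum 0%R = 0%E.
Proof. by apply: esum1 => i _; rewrite sqmod0. Qed.

Lemma sqmod_le_sqsum f i : ((sqmod (f i))%:E <= sqsum f)%E.
Proof.
have /= <- := @esum_set1 R I i (fun i => (sqmod (f i))%:E) _; last first.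
  by rewrite lee_fin sqmod_ge0.
exact: esum_subset.
Qed.

Definition square_summable : {pred I -> C} := fun f => `[< (sqsum f < +oo)%E >].

Lemma square_summable_submod : submod_closed square_summable.
Proof.
split=> [|a f g /asboolP f2 /asboolP g2].
  by apply/asboolP; rewrite sqsum0.
apply/asboolP; apply: le_lt_trans (sqsumD _ _) _.
apply: lte_add_pinfty; apply: lte_mul_pinfty; rewrite ?lee_fin//.
apply: le_lt_trans (sqsumZ _ _) _.
by apply: lte_mul_pinfty; rewrite ?lee_fin ?sqmod_ge0.
Qed.

HB.instance Definition _ := GRing.isSubmodClosed.Build C (I -> C)
  square_summable square_summable_submod.

Record l2 := L2 { l2val :> I -> C; l2valP : l2val \in square_summable }.
HB.instance Definition _ := [isSub for l2val].
HB.instance Definition _ := [Choice of l2 by <:].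
HB.instance Definition _ := [SubChoice_isSubLmodule of l2 by <:].

Lemma l2_fin (f : l2) : (sqsum f < +oo)%E.
Proof. by have /asboolP := l2valP f. Qed.

Definition l2norm (f : l2) : R := Num.sqrt (fine (sqsum f)).

(* Meaningful for absolutely summable families only. *)
Definition rsum (f : I -> R) : R :=
  fine (\esum_(i in [set: I]) (Num.max (f i) 0)%:E)
  - fine (\esum_(i in [set: I]) (Num.max (- f i) 0)%:E).

Definition csum (f : I -> C) : C :=
  rsum (fun i => complex.Re (f i)) +i* rsum (fun i => complex.Im (f i)).

(* Linear in the first variable. *)
Definition inner (f g : l2) : C := csum (fun i => f i * (g i)^*).

End SquareSummable.

Section BoundedOperators.
Variable R : realType.
Local Notation C := R[i].
Local Notation l2 := (l2 R).

Lemma l2norm_sqr (J : choiceType) (u : l2 J) :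
  ((l2norm u ^+ 2)%:E = sqsum u)%E.
Proof.
rewrite sqr_sqrtr ?fine_ge0 ?sqsum_ge0// fineK//.
by rewrite ge0_fin_numE ?sqsum_ge0// l2_fin.
Qed.

Lemma l2norm_ge0 (J : choiceType) (u : l2 J) : 0 <= l2norm u.
Proof. exact: sqrtr_ge0. Qed.

Section Def.
Variables J I : choiceType.

Definition bounded_op : {pred l2 J -> l2 I} := fun T =>
  `[< linear T /\ exists c : R, forall u, l2norm (T u) <= c * l2norm u >].

Lemma bounded_op_sqsum (T : l2 J -> l2 I) :
  (exists2 c : R, 0 <= c & forall u, (sqsum (T u) <= c%:E * sqsum u)%E) <->
  (exists c : R, forall u, l2norm (T u) <= c * l2norm u).
Proof.
split=> [[c c0 h]|[c h]].
  exists (Num.sqrt c) => u.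
  rewrite -(@ler_pXn2r _ 2)// ?nnegrE ?mulr_ge0 ?sqrtr_ge0//.
  by rewrite exprMn (sqr_sqrtr c0) -lee_fin (EFinM c) !l2norm_sqr.
exists (c ^+ 2) => [|u]; first exact: sqr_ge0.
rewrite -!l2norm_sqr -EFinM lee_fin -exprMn ler_pXn2r ?nnegrE ?l2norm_ge0//.
exact: le_trans (l2norm_ge0 _) (h u).
Qed.

Lemma bounded_op_submod : submod_closed bounded_op.
Proof.
split=> [|a S T /asboolP[lS /bounded_op_sqsum[c c0 hS]]
              /asboolP[lT /bounded_op_sqsum[d d0 hT]]]; apply/asboolP; split.
- by move=> b u v /=; rewrite -[RHS]/(b *: 0 + 0) scaler0 addr0.
- exists 0 => u; rewrite mul0r -[X in l2norm X]/(0 : l2 I).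
  by rewrite /l2norm sqsum0 sqrtr0.
- move=> b u v; rewrite -[LHS]/(a *: S (b *: u + v) + T (b *: u + v)) lS lT.
  rewrite -[RHS]/(b *: (a *: S u + T u) + (a *: S v + T v)).
  by rewrite !scalerDr !scalerA mulrC addrACA.
- apply/bounded_op_sqsum; exists (2 * (sqmod a * c) + 2 * d) => [|u].
    by rewrite addr_ge0// ?mulr_ge0// sqmod_ge0.
  apply: le_trans (sqsumD _ _) _.
  rewrite (EFinD (2 * (sqmod a * c))) ge0_muleDl; last 2 first.
  - by rewrite lee_fin !mulr_ge0 ?sqmod_ge0.
  - by rewrite lee_fin mulr_ge0.
  rewrite (EFinM 2 d) (EFinM 2 (sqmod a * c)) (EFinM (sqmod a) c) -!muleA.
  apply: leeD; apply: lee_wpmul2l; rewrite ?lee_fin//; last exact: hT.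
  apply: le_trans (sqsumZ _ _) _.
  by apply: lee_wpmul2l; rewrite ?lee_fin ?sqmod_ge0//; exact: hS.
Qed.

HB.instance Definition _ := GRing.isSubmodClosed.Build C (l2 J -> l2 I)
  bounded_op bounded_op_submod.

Record bop := Bop { bopval :> l2 J -> l2 I; bopvalP : bopval \in bounded_op }.
HB.instance Definition _ := [isSub for bopval].
HB.instance Definition _ := [Choice of bop by <:].
HB.instance Definition _ := [SubChoice_isSubLmodule of bop by <:].

Lemma bop_linear (T : bop) : linear T.
Proof. by have /asboolP[] := bopvalP T. Qed.

HB.instance Definition _ (T : bop) :=
  GRing.isLinear.Build C (l2 J) (l2 I) _ T (bop_linear T).

Lemma bop_bounded (T : bop) :
  exists2 c : R, 0 <= c & forall u, (sqsum (T u) <= c%:E * sqsum u)%E.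
Proof. by have /asboolP[_ /bounded_op_sqsum] := bopvalP T. Qed.

Definition opnorm (T : bop) : R :=
  sup [set l2norm (T u) | u in [set u | l2norm u <= 1]].

End Def.

Lemma bop_id_subproof (J : choiceType) : (id : l2 J -> l2 J) \in @bounded_op J J.
Proof.
by apply/asboolP; split=> //; exists 1 => u; rewrite mul1r.
Qed.
Definition bop_id (J : choiceType) : bop J J := Bop (bop_id_subproof J).

Lemma bop_comp_subproof (J I L : choiceType) (S : bop I L) (T : bop J I) :
  S \o T \in @bounded_op J L.
Proof.
apply/asboolP; split=> [a u v|]; first by rewrite /= !linearP.
have [c c0 hS] := bop_bounded S; have [d d0 hT] := bop_bounded T.
apply/bounded_op_sqsum; exists (c * d) => [|u]; first exact: mulr_ge0.
apply: le_trans (hS _) _; rewrite EFinM -muleA.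
by apply: lee_wpmul2l; rewrite ?lee_fin.
Qed.
Definition bop_comp (J I L : choiceType) (S : bop I L) (T : bop J I) : bop J L :=
  Bop (bop_comp_subproof S T).

(* The adjoint exists and is unique (Riesz), so the default 0 is never taken. *)
Definition adj (J I : choiceType) (T : bop J I) : bop I J :=
  xget 0 [set S : bop I J | forall u v, inner (T u) v = inner u (S v)].

End BoundedOperators.
Infix "\cdot" := bop_comp (at level 40, left associativity) : ring_scope.
Notation "T ^\dag" := (adj T) (at level 2, format "T ^\dag") : ring_scope.

Section Tensor.
Variable R : realType.
Local Notation C := R[i].
Local Notation l2 := (l2 R).

(* l2 P (x) l2 J is realized as l2 (P * J). *)

Lemma sqsum_prod (P J : choiceType) (f : P * J -> C) :
  (sqsum f = \esum_(p in [set: P]) sqsum (fun j => f (p, j)))%E.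
Proof.
rewrite /sqsum (@esum_esum R P J [set: P] (fun=> [set: J])
  (fun p j => (sqmod (f (p, j)))%:E)); last first.
  by move=> *; rewrite lee_fin sqmod_ge0.
congr esum; last by apply/funext => -[p j].
by apply/seteqP; split => -[p j].
Qed.

Section Amplification.
Variables (P J I : choiceType).

Lemma l2_fiber_subproof (u : l2 (P * J)%type) (p : P) :
  (fun j => u (p, j)) \in @square_summable R J.
Proof.
apply/asboolP; apply: le_lt_trans (l2_fin u); rewrite sqsum_prod.
have /= <- := @esum_set1 R P p (fun p => sqsum (fun j => u (p, j))) _; last first.
  exact: sqsum_ge0.
exact: esum_subset.
Qed.
Definition l2_fiber u p : l2 J := L2 (l2_fiber_subproof u p).

Lemma sqsum_fiber (u : l2 (P * J)%type) :
  (sqsum u = \esum_(p in [set: P]) sqsum (l2_fiber u p))%E.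
Proof. exact: sqsum_prod. Qed.

Variable T : bop R J I.

Let amp_fun (u : l2 (P * J)%type) : P * I -> C :=
  fun pi => T (l2_fiber u pi.1) pi.2.

Lemma amp_sqsum (c : R) : 0 <= c ->
  (forall u, (sqsum (T u) <= c%:E * sqsum u)%E) ->
  forall u, (sqsum (amp_fun u) <= c%:E * sqsum u)%E.
Proof.
move=> c0 h u; rewrite sqsum_fiber sqsum_prod.
apply: le_trans; last by apply: esum_scale => // p; exact: sqsum_ge0.
by apply: le_esum => p _; exact: (h (l2_fiber u p)).
Qed.

Lemma amp_fun_subproof u : amp_fun u \in @square_summable R (P * I)%type.
Proof.
have [c c0 h] := bop_bounded T.
apply/asboolP; apply: le_lt_trans (amp_sqsum c0 h u) _.
by apply: lte_mul_pinfty; rewrite ?lee_fin// l2_fin.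
Qed.

Lemma amp_subproof :
  (fun u => L2 (amp_fun_subproof u)) \in @bounded_op R (P * J)%type (P * I)%type.
Proof.
apply/asboolP; split=> [a u v|].
  apply/val_inj/funext => -[p i].
  rewrite -[LHS]/(T (l2_fiber (a *: u + v) p) i).
  rewrite -[RHS]/((a *: T (l2_fiber u p) + T (l2_fiber v p)) i) -linearP.
  by congr ((T _ : l2 _) i); apply/val_inj.
have [c c0 h] := bop_bounded T.
by apply/bounded_op_sqsum; exists c => // u; exact: amp_sqsum.
Qed.

(* The operator 1 (x) T : l2 P (x) l2 J -> l2 P (x) l2 I. *)
Definition amp : bop R (P * J)%type (P * I)%type := Bop amp_subproof.

End Amplification.

Section Slice.
Variables (P J : choiceType).

Lemma slice_out_subproof1 (j : J) (u : l2 (P * J)%type) :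
  (sqsum (fun p => u (p, j)) <= sqsum u)%E.
Proof.
rewrite sqsum_prod; apply: le_esum => p _.
exact: (sqmod_le_sqsum (fun j => u (p, j)) j).
Qed.

Lemma slice_out_subproof2 j (u : l2 (P * J)%type) :
  (fun p => u (p, j)) \in @square_summable R P.
Proof. by apply/asboolP; apply: le_lt_trans (slice_out_subproof1 _ _) (l2_fin u). Qed.

Lemma slice_out_subproof j :
  (fun u => L2 (slice_out_subproof2 j u)) \in @bounded_op R (P * J)%type P.
Proof.
apply/asboolP; split=> [a u v|]; first exact/val_inj.
by apply/bounded_op_sqsum; exists 1 => // u; rewrite mul1e; exact: slice_out_subproof1.
Qed.

Let in_fun (j : J) (u : l2 P) : P * J -> C :=
  fun pj => if pj.2 == j then u pj.1 else 0.

Lemma slice_in_subproof1 j u : (sqsum (in_fun j u) <= sqsum u)%E.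
Proof.
rewrite sqsum_prod; apply: le_esum => p _.
rewrite /sqsum /in_fun /= (esumID [set j]) => [|i _]; last first.
  by rewrite lee_fin sqmod_ge0.
rewrite setTI esum_set1 ?lee_fin ?sqmod_ge0// eqxx [X in (_ + X)%E]esum1 ?adde0//.
by move=> i [_ /= /eqP/negbTE ->]; rewrite sqmod0.
Qed.

Lemma slice_in_subproof2 j u : in_fun j u \in @square_summable R (P * J)%type.
Proof. by apply/asboolP; apply: le_lt_trans (slice_in_subproof1 _ _) (l2_fin u). Qed.

Lemma slice_in_subproof j :
  (fun u => L2 (slice_in_subproof2 j u)) \in @bounded_op R P (P * J)%type.
Proof.
apply/asboolP; split=> [a u v|].
  apply/val_inj/funext => -[p i]; rewrite /= /in_fun /=.
  rewrite -[RHS]/(a *: (if i == j then u p else 0) + (if i == j then v p else 0)).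
  by case: eqP => //; rewrite scaler0 addr0.
by apply/bounded_op_sqsum; exists 1 => // u; rewrite mul1e; exact: slice_in_subproof1.
Qed.

(* u |-> u (x) e_j and its adjoint. *)
Definition slice_in j : bop R P (P * J)%type := Bop (slice_in_subproof j).
Definition slice_out j : bop R (P * J)%type P := Bop (slice_out_subproof j).

End Slice.

(* (id (x) phi)(T) for a linear functional phi on n x n matrices: writing
   T = \sum_(i, j) T_ij (x) E_ij with T_ij = slice_out i \cdot T \cdot slice_in j,
   this is \sum_(i, j) phi E_ij *: T_ij. *)
Definition id_tensor (P : choiceType) n (phi : 'M[C]_n -> C)
    (T : bop R (P * 'I_n)%type (P * 'I_n)%type) : bop R P P :=
  \sum_(i < n) \sum_(j < n)
    phi (delta_mx i j) *: (slice_out P i \cdot T \cdot slice_in P j).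

Section MatrixOperator.
Variable n : nat.
Implicit Types (A : 'M[C]_n).

Let mx_fun A (u : l2 'I_n) : 'I_n -> C := fun i => \sum_(j < n) A i j * u j.

Lemma sqsum_ord (f : 'I_n -> C) : (sqsum f = (\sum_(i < n) sqmod (f i))%:E)%E.
Proof.
rewrite /sqsum esum_fset//; last first.
  by move=> i _; rewrite lee_fin sqmod_ge0.
  exact: finite_finset.
rewrite (@fsbigE _ _ _ _ _ (index_enum 'I_n) _ (index_enum_uniq _))// => [|i _]; last first.
  by rewrite mem_index_enum.
by rewrite sumEFin; congr (_%:E); apply: eq_bigl => i; rewrite in_setT.
Qed.

Lemma sqmod_sum (r : seq 'I_n) (z : 'I_n -> C) :
  sqmod (\sum_(j <- r) z j) <= 2 ^+ size r * \sum_(j <- r) sqmod (z j).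
Proof.
elim: r => [|j r IH]; first by rewrite !big_nil sqmod0 mulr0.
rewrite !big_cons /=; apply: le_trans (sqmodD _ _) _.
rewrite [leRHS]mulrDr; apply: lerD.
  by rewrite ler_wpM2r ?sqmod_ge0// exprS ler_peMr// exprn_ege1// ler1n.
by rewrite exprS -mulrA ler_wpM2l.
Qed.

Lemma mx_op_sqsum A : exists2 c : R, 0 <= c &
  forall u, (sqsum (mx_fun A u) <= c%:E * sqsum u)%E.
Proof.
exists (\sum_i \sum_j 2 ^+ size (index_enum 'I_n) * sqmod (A i j)) => [|u].
  by do 2![apply: sumr_ge0 => ? _]; rewrite mulr_ge0 ?exprn_ge0 ?sqmod_ge0.
rewrite !sqsum_ord -EFinM lee_fin mulr_suml; apply: ler_sum => i _.
apply: le_trans (sqmod_sum _ _) _.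
rewrite mulr_suml mulr_sumr; apply: ler_sum => j _.
rewrite sqmodM -mulrA !ler_wpM2l ?exprn_ge0 ?sqmod_ge0//.
by rewrite (bigD1 j)//= lerDl sumr_ge0// => *; exact: sqmod_ge0.
Qed.

Lemma mx_op_subproof1 A u : mx_fun A u \in @square_summable R 'I_n.
Proof. by apply/asboolP; rewrite sqsum_ord ltry. Qed.

Lemma mx_op_subproof A :
  (fun u => L2 (mx_op_subproof1 A u)) \in @bounded_op R 'I_n 'I_n.
Proof.
apply/asboolP; split=> [a u v|].
  apply/val_inj/funext => i; rewrite /= /mx_fun.
  rewrite -[RHS]/(a * (\sum_j A i j * u j) + \sum_j A i j * v j).
  rewrite mulr_sumr -big_split/=; apply: eq_bigr => j _.
  by rewrite -[LHS]/(A i j * (a * u j + v j)) mulrDr mulrCA.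
by apply/bounded_op_sqsum; exact: mx_op_sqsum.
Qed.

(* The operator on column vectors u |-> A u. *)
Definition mx_op A : bop R 'I_n 'I_n := Bop (mx_op_subproof A).

End MatrixOperator.
End Tensor.

Section WeakStarTopology.
Variables (R : realType) (J I : choiceType).

(* For u in l2 (nat * J) and v in l2 (nat * I) with fibers u_m, v_m,
   <(1 (x) T) u, v> = \sum_m <T u_m, v_m>: these are exactly the weak*
   continuous (normal) functionals on the bounded operators. *)
Definition normal_functional (T : bop R J I)
    (uv : l2 R (nat * J)%type * l2 R (nat * I)%type) : R[i]^o :=
  inner (amp nat T uv.1) uv.2.

HB.instance Definition _ := Topological.copy (bop R J I)
  (initial_topology (normal_functional :
     bop R J I -> prod_topology
       (fun _ : (l2 R (nat * J)%type * l2 R (nat * I)%type)%type => R[i]^o))).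

End WeakStarTopology.

(* Extended dimensions 1, 2, ..., oo; H_d is l2 (idx d). *)
Variant edim := Fin n of (0 < n)%N | Inf.

Definition idx (d : edim) : choiceType :=
  match d with Fin n _ => 'I_n | Inf => nat end.

Section Operators.
Variables (R : realType).
Local Notation C := R[i].

(* Respectively M_{m,n}, M_n and M_p(M_n) = B(H_p (x) H_n). *)
Definition opMN (m n : edim) := bop R (idx n) (idx m).
Definition opM (n : edim) := bop R (idx n) (idx n).
Definition opMM (p n : edim) := bop R (idx p * idx n)%type (idx p * idx n)%type.

Definition selfadjoint (J : choiceType) : set (bop R J J) := [set T | T^\dag = T].

Definition positive (J : choiceType) : set (bop R J J) :=
  [set T | forall u, 0 <= inner (T u) u].

Definition op_le (J : choiceType) (S T : bop R J J) : Prop := positive (T - S).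

Definition set_le (J : choiceType) (A B : set (bop R J J)) : Prop :=
  forall T, B T -> exists2 S, A S & op_le S T.

Definition unitary (J : choiceType) (V : bop R J J) : Prop :=
  V^\dag \cdot V = bop_id R J /\ V \cdot V^\dag = bop_id R J.

Section NcFunctions.
Variables (k : nat) (r : R) (p : edim).

Definition in_nc_ball (n : edim) (x : 'I_k -> opM n) : Prop :=
  op_le (\sum_(i < k) x i \cdot (x i)^\dag) ((r ^+ 2)%:C *: bop_id R (idx n)).

(* Only the values at points of the ball are relevant. *)
Definition multifun := forall n : edim, ('I_k -> opM n) -> set (opMM p n).

Variable F : multifun.

Definition is_multivalued_nc : Prop := forall n (x : 'I_k -> opM n),
  in_nc_ball x ->
  [/\ F x !=set0,
      F x `<=` @selfadjoint _,
      forall V : opM n, unitary V ->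
        F (fun i => V^\dag \cdot x i \cdot V) =
        [set amp (idx p) V^\dag \cdot T \cdot amp (idx p) V | T in F x]
    & F x = [set S + T | S in F x & T in @positive _]].

Definition is_bounded : Prop := exists2 lambda : R, 0 < lambda &
  forall n (x : 'I_k -> opM n), in_nc_ball x -> forall T, F x T ->
    exists S, [/\ F x S, op_le S T & opnorm S <= lambda].

Definition graph (n : edim) :
    set (prod_topology (fun _ : 'I_k => opM n) * opMM p n)%type :=
  [set z | in_nc_ball z.1 /\ F z.1 z.2].

(* The series \sum_i alpha_i^* x_i alpha_i and \sum_i (1 (x) alpha_i^* ) T_i (1 (x)
   alpha_i) converge weak* when the data is bounded; y and S name their sums.
   Finite families are included by padding with alpha_i = 0. *)
Definition is_nc_convex : Prop :=
  forall (n : edim) (m : nat -> edim) (x : forall i, 'I_k -> opM (m i))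
    (T : forall i, opMM p (m i)) (alpha : forall i, opMN (m i) n),
  (forall i, @graph (m i) (x i, T i)) ->
  (exists c : R, forall i, (forall j, opnorm (x i j) <= c) /\ opnorm (T i) <= c) ->
  (fun N => \sum_(i < N) (alpha i)^\dag \cdot alpha i) @ \oo --> bop_id R (idx n) ->
  forall (y : 'I_k -> opM n) (S : opMM p n),
  (forall j, (fun N => \sum_(i < N) (alpha i)^\dag \cdot x i j \cdot alpha i)
     @ \oo --> y j) ->
  (fun N => \sum_(i < N) amp (idx p) (alpha i)^\dag \cdot T i
     \cdot amp (idx p) (alpha i)) @ \oo --> S ->
  @graph n (y, S).

Definition is_lsc : Prop := forall n, closed (@graph n).

Definition nc_majorization_function : Prop :=
  [/\ is_multivalued_nc, is_bounded, is_lsc & is_nc_convex].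

End NcFunctions.
End Operators.

Section Matrices.
Variable R : realType.
Local Notation C := R[i].

Definition psdmx n (A : 'M[C]_n) : Prop :=
  forall v : 'cV[C]_n, 0 <= ((map_mx conjc v)^T *m A *m v) 0 0.

(* An element of M_q(M_n) is an array of blocks, A : 'I_q -> 'I_q -> 'M_n. *)
Definition completely_positive m n (Phi : 'M[C]_m -> 'M[C]_n) : Prop :=
  forall q (A : 'I_q -> 'I_q -> 'M[C]_m),
    psdmx (\mxblock_(i < q, j < q) A i j) ->
    psdmx (\mxblock_(i < q, j < q) Phi (A i j)).

Definition ntr n (A : 'M[C]_n) : C := n%:R^-1 * \tr A.

Definition omega n1 n2 (X : 'M[C]_(n2 + 1)) : C :=
  n1%:R^-1 * (n2%:R^-1 * \sum_(i < n2) X (lshift 1 i) (lshift 1 i))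
  + (n1%:R - 1) / n1%:R * X (rshift n2 0) (rshift n2 0).

End Matrices.

Lemma addn1_gt0 n : (0 < n + 1)%N.
Proof. by rewrite addn1. Qed.

(* Main.v *)
From HB Require Import structures.
Require Import Defs.
From mathcomp Require Import all_boot all_order all_algebra.
From mathcomp Require Import sesquilinear spectral complex.
From mathcomp Require Import ring lra.
From mathcomp Require Import all_classical all_reals ereal topology normedtype esum.

(** Write m = n2 + 1, and tr for the normalized trace.  Both conditions amount to
the existence of a unital completely positive map Theta from m x m to n1 x n1
matrices such that Theta(b'_i) = a'_i for all i and tr o Theta = omega.  If Phi
is as in the second condition, then Phi(1) is positive and its eigenvalues sum
to n1, so Phi(1) <= n1, and Theta(X) = Phi(X_11) / n1 + X_22 (1 - Phi(1) / n1)
is such a map; in the other direction Phi(Y) = n1 Theta(Y (+) 0).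

Theta yields majorization ([majorize_of_cp]): if alpha_l is a Kraus family of
Theta, obtained from a Gram decomposition of its Choi matrix ([gram]), nc
convexity of the graph of F carries (b', T) to (a', S) with
S = \sum_l (1 (x) alpha_l^* ) T (1 (x) alpha_l), and
(id (x) tr)(S) = (id (x) omega)(T).

For the converse ([cp_of_majorize]) a single function is tested, [Fmaj], with
p = m.  By definition S is in F(x) when, for some unital completely positive
Theta with Choi matrix X = \sum_(p, q) E_pq (x) Theta(E_pq),
  S >= - X + 1 (x) \sum_j z_j^* z_j,   where z_j = x_j - Theta(b'_j).
The identity map puts - \sum_(p, q) E_pq (x) E_pq into F(b').  Majorization then
gives S in F(a'), with its Theta, such that the matrix
G_pq = tr(Theta(E_pq)) - omega(E_pq) satisfies G >= tr(\sum_j z_j^* z_j) 1 >= 0.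
Its trace is 1 - 1, so G = 0 and all the z_j vanish: tr o Theta = omega and
Theta(b') = a'.

What remains is that F is an nc majorization function ([Fmaj_majorization]).
Since |w|^2 is the supremum over v of 2 Re <v, w> - |v|^2, membership in the
graph of F and in the ball can be written as inequalities that are linear in
(1, x, S, X).  Replacing the operator 1 by a weight w gives the relation
[wgraph], which is stable under finite sums ([wgraph_sum]), under compressions
([wgraph_pull]), and under weak limits ([wgraph_lim]).  Nc convexity combines the
three, and lower semicontinuity is the third.  The existential quantifier on X
survives limits by compactness: a positive X is bounded in terms of its partial
trace w ([opbd_ptr1]), and a bounded family of operators converges along every
ultrafilter ([alaoglu]), its limit being obtained from Riesz representation of
bounded forms ([riesz]). *)

Set Implicit Arguments.
Unset Strict Implicit.
Unset Printing Implicit Defensive.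

Import Order.TTheory GRing.Theory Num.Theory.
Import numFieldNormedType.Exports.

Local Open Scope classical_set_scope.
Local Open Scope complex_scope.
Local Open Scope ring_scope.

#[local] Arguments inner : simpl never.
#[local] Arguments csum : simpl never.

Local Notation Re := complex.Re.
Local Notation Im := complex.Im.

(** * Sums of real families over an arbitrary index set *)

Section RealSums.
Variables (R : realType) (I : choiceType).
Implicit Types f g h : I -> R.

(** Absolute summability of a real family. *)
Definition rsummable f := (\esum_(i in [set: I]) `|f i|%:E < +oo)%E.

Lemma esum_lty_le f g : (forall i, 0 <= f i <= g i) ->
  (\esum_(i in [set: I]) (g i)%:E < +oo -> \esum_(i in [set: I]) (f i)%:E < +oo)%E.
Proof.
move=> fg; apply: le_lt_trans; apply: le_esum => i _.
by rewrite lee_fin; case/andP: (fg i).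
Qed.

Lemma rsummable_le f g : (forall i, `|f i| <= g i) ->
  (\esum_(i in [set: I]) (g i)%:E < +oo)%E -> rsummable f.
Proof. by move=> fg; apply: esum_lty_le => i; rewrite normr_ge0 fg. Qed.

Lemma rsummableD f g : rsummable f -> rsummable g -> rsummable (f \+ g).
Proof.
move=> sf sg; apply: (@rsummable_le _ (fun i => `|f i| + `|g i|)).
  by move=> i; exact: ler_normD.
under eq_esum do rewrite EFinD.
by rewrite esumD ?lte_add_pinfty// => i _; rewrite lee_fin.
Qed.

Lemma rsummableZ (c : R) f : rsummable f -> rsummable (fun i => c * f i).
Proof.
move=> sf; rewrite /rsummable; under eq_esum do rewrite normrM EFinM.
apply: le_lt_trans (esum_scale _ _ _) _ => //.
by apply: lte_mul_pinfty; rewrite ?lee_fin.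
Qed.

Lemma fine_esumD f g : (forall i, 0 <= f i) -> (forall i, 0 <= g i) ->
  (\esum_(i in [set: I]) (f i)%:E < +oo)%E ->
  (\esum_(i in [set: I]) (g i)%:E < +oo)%E ->
  fine (\esum_(i in [set: I]) (f i + g i)%:E) =
  fine (\esum_(i in [set: I]) (f i)%:E) + fine (\esum_(i in [set: I]) (g i)%:E).
Proof.
move=> f0 g0 sf sg; rewrite -fineD.
- by rewrite -esumD// => i _; rewrite lee_fin.
- by rewrite ge0_fin_numE ?esum_ge0// => i _; rewrite lee_fin.
- by rewrite ge0_fin_numE ?esum_ge0// => i _; rewrite lee_fin.
Qed.

(** A difference of two non-negative summable families has the expected sum,
whether or not it is the decomposition into positive and negative parts. *)
Lemma rsum_diff f g h : (forall i, 0 <= g i) -> (forall i, 0 <= h i) ->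
  (\esum_(i in [set: I]) (g i)%:E < +oo)%E ->
  (\esum_(i in [set: I]) (h i)%:E < +oo)%E ->
  (forall i, f i = g i - h i) ->
  rsum f = fine (\esum_(i in [set: I]) (g i)%:E) - fine (\esum_(i in [set: I]) (h i)%:E).
Proof.
move=> g0 h0 sg sh fE.
have p0 i : 0 <= Num.max (f i) 0 by rewrite le_max lexx orbT.
have n0 i : 0 <= Num.max (- f i) 0 by rewrite le_max lexx orbT.
have sp : (\esum_(i in [set: I]) (Num.max (f i) 0)%:E < +oo)%E.
  by apply: esum_lty_le sg => i; rewrite p0 ge_max g0 fE gerBl h0.
have sn : (\esum_(i in [set: I]) (Num.max (- f i) 0)%:E < +oo)%E.
  by apply: esum_lty_le sh => i; rewrite n0 ge_max h0 fE opprB gerBl g0.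
apply/eqP; rewrite /rsum subr_eq addrAC eq_sym subr_eq; apply/eqP.
rewrite -!fine_esumD//; congr fine; apply: eq_esum => i _.
congr (_%:E); rewrite fE /Num.max; case: ltP => ?; case: ltP => ?; lra.
Qed.

Let rsum_pn f : rsummable f -> [/\ forall i, 0 <= Num.max (f i) 0,
   forall i, 0 <= Num.max (- f i) 0,
  (\esum_(i in [set: I]) (Num.max (f i) 0)%:E < +oo)%E,
  (\esum_(i in [set: I]) (Num.max (- f i) 0)%:E < +oo)%E &
  forall i, f i = Num.max (f i) 0 - Num.max (- f i) 0].
Proof.
move=> sf.
have p0 i : 0 <= Num.max (f i) 0 by rewrite le_max lexx orbT.
have n0 i : 0 <= Num.max (- f i) 0 by rewrite le_max lexx orbT.
split => //.
- by apply: esum_lty_le sf => i; rewrite p0 ge_max normr_ge0 ler_norm.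
- by apply: esum_lty_le sf => i; rewrite n0 ge_max normr_ge0 -normrN ler_norm.
- by move=> i; rewrite /Num.max; case: ltP => ?; case: ltP => ?; lra.
Qed.

Lemma rsumD f g : rsummable f -> rsummable g -> rsum (f \+ g) = rsum f + rsum g.
Proof.
move=> /rsum_pn[f1 f2 f3 f4 f5] /rsum_pn[g1 g2 g3 g4 g5].
have D2 (a b : I -> R) : (forall i, 0 <= a i) -> (forall i, 0 <= b i) ->
    (\esum_(i in [set: I]) (a i)%:E < +oo)%E ->
    (\esum_(i in [set: I]) (b i)%:E < +oo)%E ->
    (\esum_(i in [set: I]) (a i + b i)%:E < +oo)%E.
  move=> a0 b0 sa sb; under eq_esum do rewrite EFinD.
  by rewrite esumD ?lte_add_pinfty// => i _; rewrite lee_fin.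
rewrite (@rsum_diff _ (fun i => Num.max (f i) 0 + Num.max (g i) 0)
                      (fun i => Num.max (- f i) 0 + Num.max (- g i) 0)).
- rewrite (fine_esumD f1 g1 f3 g3) (fine_esumD f2 g2 f4 g4) opprD addrACA.
  by rewrite /rsum.
- by move=> i; rewrite addr_ge0.
- by move=> i; rewrite addr_ge0.
- exact: D2.
- exact: D2.
- by move=> i /=; rewrite [f i in LHS]f5 [g i in LHS]g5 opprD addrACA.
Qed.

Lemma rsumN f : rsum (fun i => - f i) = - rsum f.
Proof.
rewrite /rsum opprB; congr (_ - _); congr fine; apply: eq_esum => i _.
by rewrite opprK.
Qed.

Lemma fine_esumZ (c : R) f : 0 <= c -> (forall i, 0 <= f i) ->
  fine (\esum_(i in [set: I]) (c * f i)%:E) =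
  c * fine (\esum_(i in [set: I]) (f i)%:E).
Proof.
move=> c0 f0; have [->|cn0] := eqVneq c 0.
  by rewrite mul0r esum1// => i _; rewrite mul0r.
suff -> : (\esum_(i in [set: I]) (c * f i)%:E =
          c%:E * \esum_(i in [set: I]) (f i)%:E)%E.
  have [|] := boolP (\esum_(i in [set: I]) (f i)%:E \is a fin_num)%E.
    by move=> ?; rewrite fineM.
  rewrite ge0_fin_numE ?esum_ge0//; last by move=> i _; rewrite lee_fin.
  rewrite ltey negbK => /eqP ->; rewrite gt0_muley ?mulr0//.
  by rewrite lte_fin lt_neqAle eq_sym cn0.
apply/eqP; rewrite eq_le; apply/andP; split.
  by under eq_esum do rewrite EFinM; apply: esum_scale => // i; rewrite lee_fin.
have -> : (\esum_(i in [set: I]) (f i)%:E =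
          \esum_(i in [set: I]) ((c^-1)%:E * (c * f i)%:E))%E.
  by apply: eq_esum => i _; rewrite -EFinM mulKf.
have := @esum_scale R I setT (fun i => (c * f i)%:E) (c^-1).
rewrite invr_ge0 => /(_ c0) h.
apply: le_trans (lee_wpmul2l _ (h _)) _; rewrite ?lee_fin//.
  by move=> i; rewrite lee_fin mulr_ge0.
by rewrite muleA -EFinM divff// mul1e.
Qed.

Lemma rsumZ (c : R) f : rsummable f -> rsum (fun i => c * f i) = c * rsum f.
Proof.
move=> sf; wlog c0 : c / 0 <= c => [hw|].
  have [/hw//|/ltW c0] := leP 0 c.
  transitivity (rsum (fun i => - (- c * f i))).
    by congr rsum; apply/funext => i; rewrite mulNr opprK.
  by rewrite rsumN hw ?oppr_ge0// mulNr opprK.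
have [f1 f2 f3 f4 f5] := rsum_pn sf.
have sZ (a : I -> R) : (forall i, 0 <= a i) ->
    (\esum_(i in [set: I]) (a i)%:E < +oo)%E ->
    (\esum_(i in [set: I]) (c * a i)%:E < +oo)%E.
  move=> a0 sa; under eq_esum do rewrite EFinM.
  apply: le_lt_trans (esum_scale _ _ _) _ => //.
  by apply: lte_mul_pinfty; rewrite ?lee_fin.
rewrite (@rsum_diff _ (fun i => c * Num.max (f i) 0)
                      (fun i => c * Num.max (- f i) 0)).
- by rewrite (fine_esumZ c0 f1) (fine_esumZ c0 f2) -mulrBr /rsum.
- by move=> i; rewrite mulr_ge0.
- by move=> i; rewrite mulr_ge0.
- exact: sZ.
- exact: sZ.
- by move=> i; rewrite -mulrBr -f5.
Qed.

Lemma rsum_ge0E f : (forall i, 0 <= f i) ->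
  rsum f = fine (\esum_(i in [set: I]) (f i)%:E).
Proof.
move=> f0; rewrite /rsum [X in _ - fine X]esum1 ?subr0.
  by congr fine; apply: eq_esum => i _; rewrite (max_idPl _).
by move=> i _; rewrite (max_idPr _)// oppr_le0.
Qed.

Lemma esum_point (i : I) (f : I -> \bar R) : (0 <= f i)%E ->
  (forall j, j != i -> f j = 0)%E -> (\esum_(j in [set: I]) f j = f i)%E.
Proof.
move=> fi0 f0.
have -> : f = fun j => (if j \in [set i] then f j else 0)%E.
  apply/funext => j; case: ifPn => // /negP; rewrite inE /= => /eqP; exact: f0.
by rewrite -esum_mkcond esum_set1 ?mem_set.
Qed.

Lemma rsum_point (i : I) f : (forall j, j != i -> f j = 0) -> rsum f = f i.
Proof.
move=> f0; rewrite /rsum !(@esum_point i) /=.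
- by rewrite /Num.max; case: ltP => ?; case: ltP => ?; lra.
- by rewrite lee_fin le_max lexx orbT.
- by move=> j /f0 ->; rewrite oppr0 /Num.max ltxx.
- by rewrite lee_fin le_max lexx orbT.
- by move=> j /f0 ->; rewrite /Num.max ltxx.
Qed.

End RealSums.

(** A family on a product supported on one fibre has the sum of that fibre. *)
Lemma esum_fiber (R : realType) (P J : choiceType) (p : P) (f : P * J -> \bar R) :
  (forall x, 0 <= f x)%E -> (forall q j, q != p -> f (q, j) = 0)%E ->
  (\esum_(x in [set: P * J]) f x = \esum_(j in [set: J]) f (p, j))%E.
Proof.
move=> f0 fp.
rewrite -(@esum_point _ _ p (fun p => \esum_(j in [set: J]) f (p, j))%E).
- rewrite (@esum_esum R P J [set: P] (fun=> [set: J]) (fun p j => f (p, j)))//.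
  congr esum; last by apply/funext => -[].
  by apply/seteqP; split => -[].
- by apply: esum_ge0.
- by move=> q qp; apply: esum1 => j _; exact: fp.
Qed.

Lemma rsum_fiber (R : realType) (P J : choiceType) (p : P) (f : P * J -> R) :
  (forall q j, q != p -> f (q, j) = 0) ->
  rsum f = rsum (fun j => f (p, j)).
Proof.
move=> f0; rewrite /rsum !(@esum_fiber _ _ _ p)//.
- by move=> x; rewrite lee_fin le_max lexx orbT.
- by move=> q j /f0 ->; rewrite oppr0 /Num.max ltxx.
- by move=> x; rewrite lee_fin le_max lexx orbT.
- by move=> q j /f0 ->; rewrite /Num.max ltxx.
Qed.

(** * The inner product of l2 *)

Section ComplexSums.
Variables (R : realType).
Local Notation C := R[i].

Lemma complex_ReM (x y : C) : Re (x * y) = Re x * Re y - Im x * Im y.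
Proof. by case: x y => ? ? []. Qed.
Lemma complex_ImM (x y : C) : Im (x * y) = Re x * Im y + Im x * Re y.
Proof. by case: x y => ? ? []. Qed.
Lemma ReD (x y : C) : Re (x + y) = Re x + Re y.
Proof. by case: x y => ? ? []. Qed.
Lemma ImD (x y : C) : Im (x + y) = Im x + Im y.
Proof. by case: x y => ? ? []. Qed.
Lemma ReN (x : C) : Re (- x) = - Re x.
Proof. by case: x. Qed.
Lemma ImN (x : C) : Im (- x) = - Im x.
Proof. by case: x. Qed.
Lemma ReJ (x : C) : Re (x^*) = Re x.
Proof. by case: x. Qed.
Lemma ImJ (x : C) : Im (x^*) = - Im x.
Proof. by case: x. Qed.
Lemma Re_sum I (s : seq I) (P : pred I) (f : I -> C) :
  Re (\sum_(i <- s | P i) f i) = \sum_(i <- s | P i) Re (f i).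
Proof. exact: (big_morph _ ReD). Qed.
Lemma complex_ext (x y : C) : Re x = Re y -> Im x = Im y -> x = y.
Proof. by case: x y => ? ? [? ?] /= -> ->. Qed.

Lemma ge0C (x : C) : (0 <= x) = (Im x == 0) && (0 <= Re x).
Proof. by case: x => a b; rewrite lecE /=. Qed.

Lemma ge0c (a : R) : (0 <= a%:C) = (0 <= a).
Proof. exact: (@lecR _ 0 a). Qed.

Lemma mulJ_sqmod (x : C) : x * x^* = (sqmod x)%:C.
Proof. by case: x => a b; apply: complex_ext; rewrite /sqmod /=; ring. Qed.

Lemma normC_sqmod (x : C) : `|x| ^+ 2 = (sqmod x)%:C.
Proof. by rewrite -mulJ_sqmod; exact: normCK. Qed.

Lemma Re_le_norm (z : C) (a : R) : `|z| <= a%:C -> `|Re z| <= a.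
Proof. by move=> za; rewrite -lecR; apply: le_trans (normc_ge_Re _) za. Qed.

Lemma Im_le_norm (z : C) (a : R) : `|z| <= a%:C -> `|Im z| <= a.
Proof.
move=> za; have a0 : 0 <= a by rewrite -lecR; exact: le_trans (normr_ge0 z) za.
rewrite -(@ler_pXn2r _ 2)// ?nnegrE// -normrX ger0_norm ?sqr_ge0//.
have : (sqmod z)%:C <= (a ^+ 2)%:C.
  by rewrite -normC_sqmod rmorphXn/= ler_pXn2r ?nnegrE ?normr_ge0 ?ge0c.
by rewrite lecR; apply: le_trans; rewrite /sqmod lerDr sqr_ge0.
Qed.

Lemma norm_ge_Im (z : C) : `|Im z|%:C <= `|z|.
Proof.
have zE : `|z| = (Re `|z|)%:C.
  have := normr_ge0 z; rewrite ge0C => /andP[/eqP z0 _].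
  by apply: complex_ext; rewrite ?z0.
by rewrite zE lecR Im_le_norm// -zE.
Qed.

Variable I : choiceType.
Implicit Types f g : I -> C.

(** Absolute summability, on real and imaginary parts. *)
Definition csummable f :=
  rsummable (fun i => Re (f i)) /\ rsummable (fun i => Im (f i)).

Lemma csumD f g : csummable f -> csummable g -> csum (f \+ g) = csum f + csum g.
Proof.
move=> [f1 f2] [g1 g2]; apply: complex_ext; rewrite /csum /= -rsumD//; congr rsum;
  by apply/funext => i /=; rewrite (ReD, ImD).
Qed.

Lemma csumZ (c : C) f : csummable f -> csum (fun i => c * f i) = c * csum f.
Proof.
move=> [f1 f2]; apply: complex_ext; rewrite /csum (complex_ReM, complex_ImM) /= -!rsumZ//.
  rewrite -rsumN -rsumD; [congr rsum|exact: rsummableZ|].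
    by apply/funext => i /=; rewrite complex_ReM.
  have := rsummableZ (- Im c) f2; congr rsummable.
  by apply/funext => i; rewrite mulNr.
rewrite -rsumD; [congr rsum|exact: rsummableZ|exact: rsummableZ].
by apply/funext => i /=; rewrite complex_ImM.
Qed.

Lemma csumJ f : csum (fun i => (f i)^*) = (csum f)^*.
Proof.
apply: complex_ext; rewrite /csum ?(ReJ, ImJ) /=.
  by congr rsum; apply/funext => i; rewrite ReJ.
by rewrite -rsumN; congr rsum; apply/funext => i; rewrite ImJ.
Qed.

Lemma inner_summable (u v : l2 R I) : csummable (fun i => u i * (v i)^*).
Proof.
have s : (\esum_(i in [set: I]) (sqmod (u i) + sqmod (v i))%:E < +oo)%E.
  under eq_esum do rewrite EFinD.
  by rewrite esumD ?lte_add_pinfty ?l2_fin// => i _; rewrite lee_fin sqmod_ge0.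
by split; apply: rsummable_le s => i; rewrite (complex_ReM, complex_ImM) /sqmod ?(ReJ, ImJ);
  case: (u i) (v i) => a b [c d] /=; rewrite ler_norml; apply/andP;
  have := sqr_ge0 (a + c); have := sqr_ge0 (a - c); have := sqr_ge0 (b + d);
  have := sqr_ge0 (b - d); have := sqr_ge0 (a + d); have := sqr_ge0 (a - d);
  have := sqr_ge0 (b + c); have := sqr_ge0 (b - c);
  have := sqr_ge0 a; have := sqr_ge0 b; have := sqr_ge0 c; have := sqr_ge0 d;
  rewrite !sqrrD !sqrrN !mulrN; split; lra.
Qed.

End ComplexSums.

Section InnerProduct.
Variables (R : realType) (I : choiceType).
Local Notation C := R[i].
Implicit Types (u v w : l2 R I) (c : C).

Lemma innerPl c u v w : inner (c *: u + v) w = c * inner u w + inner v w.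
Proof.
rewrite /inner -csumZ; last exact: inner_summable.
rewrite -csumD; last exact: inner_summable.
  congr csum; apply/funext => i /=.
  by rewrite -[LHS]/((c * u i + v i) * (w i)^*); ring.
have [s1 s2] := inner_summable u w; split.
  under [X in rsummable X]eq_fun do rewrite complex_ReM.
  apply: rsummableD; first exact: rsummableZ.
  by under [X in rsummable X]eq_fun do rewrite -mulNr; exact: rsummableZ.
under [X in rsummable X]eq_fun do rewrite complex_ImM.
by apply: rsummableD; exact: rsummableZ.
Qed.

Lemma innerJ u v : inner v u = (inner u v)^*.
Proof.
rewrite /inner -csumJ; congr csum; apply/funext => i /=.
by rewrite rmorphM /= conjCK mulrC.
Qed.

Lemma inner0l w : inner (0 : l2 R I) w = 0.
Proof.
have := innerPl 0 0 0 w; rewrite scaler0 addr0 mul0r add0r.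
by move: (innerPl 1 0 0 w); rewrite scaler0 addr0 mul1r => /eqP;
  rewrite -subr_eq subrr eq_sym => /eqP.
Qed.

Lemma innerZl c u w : inner (c *: u) w = c * inner u w.
Proof. by rewrite -[c *: u]addr0 innerPl inner0l addr0. Qed.

Lemma innerDl u v w : inner (u + v) w = inner u w + inner v w.
Proof. by rewrite -{1}[u]scale1r innerPl mul1r. Qed.

Lemma innerNl u w : inner (- u) w = - inner u w.
Proof. by rewrite -scaleN1r innerZl mulN1r. Qed.

Lemma innerBl u v w : inner (u - v) w = inner u w - inner v w.
Proof. by rewrite innerDl innerNl. Qed.

Lemma inner_suml K (s : seq K) (P : pred K) (f : K -> l2 R I) w :
  inner (\sum_(i <- s | P i) f i) w = \sum_(i <- s | P i) inner (f i) w.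
Proof. by apply: (big_morph (fun u => inner u w)) => [? ?|]; rewrite ?innerDl ?inner0l. Qed.

Lemma inner0r w : inner w (0 : l2 R I) = 0.
Proof. by rewrite innerJ inner0l conjC0. Qed.

Lemma innerZr c u w : inner u (c *: w) = c^* * inner u w.
Proof. by rewrite innerJ innerZl rmorphM/= -innerJ. Qed.

Lemma innerDr u v w : inner u (v + w) = inner u v + inner u w.
Proof. by rewrite innerJ innerDl rmorphD/= -!innerJ. Qed.

Lemma innerNr u w : inner u (- w) = - inner u w.
Proof. by rewrite innerJ innerNl rmorphN/= -innerJ. Qed.

Lemma innerBr u v w : inner u (v - w) = inner u v - inner u w.
Proof. by rewrite innerDr innerNr. Qed.

Lemma inner_sumr K (s : seq K) (P : pred K) (f : K -> l2 R I) w :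
  inner w (\sum_(i <- s | P i) f i) = \sum_(i <- s | P i) inner w (f i).
Proof. by apply: (big_morph (fun u => inner w u)) => [? ?|]; rewrite ?innerDr ?inner0r. Qed.

Lemma inner_self u : inner u u = (l2norm u ^+ 2)%:C.
Proof.
have uE i : u i * (u i)^* = (sqmod (u i))%:C by rewrite mulJ_sqmod.
apply: complex_ext; rewrite /inner /csum /=.
  under [X in rsum X]eq_fun do rewrite uE /=.
  rewrite rsum_ge0E; last by move=> i; exact: sqmod_ge0.
  by apply: EFin_inj; rewrite l2norm_sqr fineK// ge0_fin_numE ?sqsum_ge0// l2_fin.
under [X in rsum X]eq_fun do rewrite uE /=.
by rewrite rsum_ge0E// esum1.
Qed.

Lemma inner_ge0 u : 0 <= inner u u.
Proof. by rewrite inner_self ge0c sqr_ge0. Qed.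

Lemma l2norm_eq0 u : l2norm u = 0 -> u = 0.
Proof.
move=> u0; apply/val_inj/funext => i /=; rewrite -[RHS]/0.
have := sqmod_le_sqsum u i; rewrite -l2norm_sqr u0 expr0n lee_fin /= /sqmod.
case: (u i) => a b /= ab; have := sqr_ge0 a; have := sqr_ge0 b => b2 a2.
by apply: complex_ext => /=; apply/eqP; rewrite -sqrf_eq0; apply/eqP; lra.
Qed.

Lemma inner_eq u v : (forall w, inner u w = inner v w) -> u = v.
Proof.
move=> uv; apply/eqP; rewrite -subr_eq0; apply/eqP/l2norm_eq0.
apply/eqP; rewrite -sqrf_eq0; apply/eqP.
by have := inner_self (u - v); rewrite {1}innerBl uv subrr => -[].
Qed.

Lemma ebasis_subproof (i : I) : (fun j => (j == i)%:R : C) \in @square_summable R I.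
Proof.
apply/asboolP; rewrite /sqsum (@esum_point _ _ i) ?ltry//.
  by rewrite lee_fin sqmod_ge0.
by move=> j /negbTE ->; rewrite sqmod0.
Qed.

(** The standard orthonormal basis. *)
Definition ebasis (i : I) : l2 R I := L2 (ebasis_subproof i).

Lemma inner_ebasis u i : inner u (ebasis i) = u i.
Proof.
rewrite /inner /csum !(@rsum_point _ _ i) /= ?eqxx ?conjC1 ?mulr1.
- by case: (u i).
- by move=> j /negbTE ->; rewrite conjC0 mulr0.
- by move=> j /negbTE ->; rewrite conjC0 mulr0.
Qed.

End InnerProduct.

Section CauchySchwarz.
Variables (R : realType).
Local Notation C := R[i].

(** The Cauchy-Schwarz inequality for a positive, possibly degenerate, form. *)
Lemma form_CS (V : lmodType C) (B : V -> V -> C) :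
  (forall c u v w, B (c *: u + v) w = c * B u w + B v w) ->
  (forall u v, B v u = (B u v)^*) -> (forall u, 0 <= B u u) ->
  forall u v, `|B u v| ^+ 2 <= B u u * B v v.
Proof.
move=> BP BJ B0 u v.
have Bl w : B 0 w = 0.
  have := BP 0 0 0 w; have := BP 1 0 0 w; rewrite scaler0 addr0 mul1r.
  by move=> /eqP; rewrite -subr_eq subrr eq_sym => /eqP.
have BZl c x w : B (c *: x) w = c * B x w by rewrite -[c *: x]addr0 BP Bl addr0.
have BDr x y w : B w (x + y) = B w x + B w y.
  by rewrite BJ -{1}[x]scale1r BP mul1r rmorphD/= -!BJ.
have BZr c x w : B w (c *: x) = c^* * B w x.
  by rewrite BJ BZl rmorphM/= -BJ.
have key s t : 0 <= s * s^* * B u u + s * t^* * B u v + t * s^* * (B u v)^*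
               + t * t^* * B v v.
  have := B0 (s *: u + t *: v); rewrite BP !BDr !BZl !BZr (BJ u v).
  by congr (0 <= _); ring.
rewrite normC_sqmod -mulJ_sqmod.
set q := B u u in key *; set p := B v v in key *; set z := B u v in key *.
have p0 : 0 <= p by exact: B0.
have pJ : p^* = p by rewrite -BJ.
have [p_eq0|p_neq0] := eqVneq p 0.
  have [->|z_neq0] := eqVneq z 0; first by rewrite mul0r mulr_ge0 ?B0.
  have zJ_neq0 : z^* != 0 by rewrite conjC_eq0.
  have qJ : q^* = q by rewrite -BJ.
  (* This t makes B(u + t v, u + t v) equal to - q - 2. *)
  pose t := - (q + 1) / z^*.
  have tJ : t^* = - (q + 1) / z.
    by rewrite /t rmorphM rmorphN rmorphD fmorphV /= conjCK qJ conjC1.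
  have := key 1 t; rewrite p_eq0 tJ conjC1 mulr0 addr0 !mul1r.
  have -> : q + - (q + 1) / z * z + t * 1 * z^* = - (q + 2).
    by rewrite /t; field; rewrite z_neq0 zJ_neq0.
  rewrite oppr_ge0 => h; suff : (0 : C) < 0 by rewrite ltxx.
  by apply: lt_le_trans h; rewrite ltr_wpDl// B0.
have p_gt0 : 0 < p by rewrite lt_neqAle eq_sym p_neq0.
have := key p (- z); rewrite pJ rmorphN/=.
have -> : p * p * q + p * - z^* * z + - z * p * z^* + - z * - z^* * p =
   p * (q * p - z * z^*) by ring.
by rewrite pmulr_rge0// subr_ge0.
Qed.

Lemma form_CS_norm (V : lmodType C) (B : V -> V -> C) :
  (forall c u v w, B (c *: u + v) w = c * B u w + B v w) ->
  (forall u v, B v u = (B u v)^*) -> (forall u, 0 <= B u u) ->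
  forall (a b : R) u v, 0 <= a -> 0 <= b ->
    B u u <= (a ^+ 2)%:C -> B v v <= (b ^+ 2)%:C -> `|B u v| <= (a * b)%:C.
Proof.
move=> BP BJ B0 a b u v a0 b0 ua vb.
rewrite -(@ler_pXn2r _ 2)// ?nnegrE ?normr_ge0 ?ge0c ?mulr_ge0//.
apply: le_trans (form_CS BP BJ B0 u v) _; rewrite -rmorphXn exprMn rmorphM.
by apply: ler_pM.
Qed.

Lemma inner_CS (I : choiceType) (u v : l2 R I) :
  `|inner u v| <= (l2norm u * l2norm v)%:C.
Proof.
apply: (form_CS_norm (@innerPl R I) (@innerJ R I) (@inner_ge0 R I));
  by rewrite ?l2norm_ge0// inner_self.
Qed.

End CauchySchwarz.

Section FormBounds.
Variable R : realType.
Local Notation C := R[i].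

(** The form [B] is bounded by [c]: |B u v| <= c |u| |v|. *)
Definition formbd (J I : choiceType) (c : R) (B : l2 R J -> l2 R I -> C) :=
  forall u v, `|B u v| <= (c * l2norm u * l2norm v)%:C.

Variables J I : choiceType.
Implicit Types (B : l2 R J -> l2 R I -> C).

(** The norm of [T] is at most [c], stated on the form (u, v) |-> <T u, v>. *)
Definition opbd (c : R) (T : bop R J I) := formbd c (fun u v => inner (T u) v).

Lemma opbd_norm c (T : bop R J I) : 0 <= c -> opbd c T -> forall u, l2norm (T u) <= c * l2norm u.
Proof.
move=> c0 h u; have := h u (T u); rewrite inner_self ger0_norm ?ge0c ?lecR ?sqr_ge0//.
have [-> _|Tu0] := eqVneq (l2norm (T u)) 0; first by rewrite mulr_ge0 ?l2norm_ge0.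
by rewrite expr2 ler_pM2r// lt_neqAle eq_sym Tu0 l2norm_ge0.
Qed.

Lemma norm_opbd c (T : bop R J I) : (forall u, l2norm (T u) <= c * l2norm u) -> opbd c T.
Proof.
move=> h u v; apply: le_trans (inner_CS _ _) _.
by rewrite lecR ler_wpM2r ?l2norm_ge0.
Qed.

Lemma opbd_exists (T : bop R J I) : exists2 c : R, 0 <= c & opbd c T.
Proof.
have /asboolP[_ [c h]] := bopvalP T; exists `|c|; first exact: normr_ge0.
apply: norm_opbd => u; apply: le_trans (h u) _.
by rewrite ler_wpM2r ?l2norm_ge0// ler_norm.
Qed.

Lemma opbd_opnorm c (T : bop R J I) : 0 <= c -> opbd c T -> opnorm T <= c.
Proof.
move=> c0 /(opbd_norm c0) h; apply: ge_sup.
  exists (l2norm (T 0)), 0 => //=.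
  by rewrite /l2norm sqsum0 sqrtr0.
by move=> _ [u /= u1 <-]; apply: le_trans (h u) _; rewrite ler_piMr.
Qed.

End FormBounds.

(** * Riesz representation and adjoints *)

Section Riesz.
Variables (R : realType).
Local Notation C := R[i].

Section Span.
Variable I : choiceType.
Implicit Types (u v : l2 R I) (s : seq I).

Lemma seq_esum_le (f : I -> \bar R) (M : \bar R) :
  (forall s, uniq s -> \sum_(i <- s) f i <= M)%E ->
  (\esum_(i in [set: I]) f i <= M)%E.
Proof.
move=> h; apply: esum_le => X [/finite_seqP[s ->] _].
have <- : [set` undup s] = [set` s] :> set I.
  by apply/seteqP; split => i /=; rewrite mem_undup.
by rewrite -fsbig_seq ?undup_uniq// h ?undup_uniq.
Qed.

Lemma norm_seq_approx u (e : R) : 0 < e ->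
  exists2 s, uniq s & l2norm u ^+ 2 - e < \sum_(i <- s) sqmod (u i).
Proof.
move=> e0; apply: contrapT => h.
suff : (sqsum u <= (l2norm u ^+ 2 - e)%:E)%E.
  by rewrite -l2norm_sqr lee_fin lerDl oppr_ge0 leNgt e0.
apply: seq_esum_le => s us; rewrite sumEFin lee_fin leNgt; apply/negP => hs.
by apply: h; exists s.
Qed.

(** The finite combination of basis vectors with coefficients [f] on [s]. *)
Definition lin s (f : I -> C) : l2 R I := \sum_(i <- s) f i *: ebasis R i.

Lemma inner_lin s f u : inner (lin s f) u = \sum_(i <- s) f i * (u i)^*.
Proof.
rewrite inner_suml; apply: eq_bigr => i _.
by rewrite innerZl innerJ inner_ebasis.
Qed.

Lemma linE s f i : uniq s -> i \in s -> lin s f i = f i.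
Proof.
move=> us si; rewrite -inner_ebasis inner_lin (bigD1_seq i)//= eqxx conjC1 mulr1.
rewrite big1 ?addr0// => j /negbTE ji.
by rewrite ji conjC0 mulr0.
Qed.

Lemma inner_lin_self s f u : uniq s -> (forall i, i \in s -> u i = f i) ->
  inner (lin s f) u = (\sum_(i <- s) sqmod (f i))%:C.
Proof.
move=> us uf; rewrite inner_lin rmorph_sum/= [LHS]big_seq [RHS]big_seq.
by apply: eq_bigr => i si; rewrite uf// mulJ_sqmod.
Qed.

Lemma l2norm_lin s f : uniq s -> l2norm (lin s f) ^+ 2 = \sum_(i <- s) sqmod (f i).
Proof.
move=> us; have := inner_lin_self us (fun i => @linE s f i us).
by rewrite inner_self => -[].
Qed.

Lemma l2norm_sub_lin s u : uniq s ->
  l2norm (u - lin s u) ^+ 2 = l2norm u ^+ 2 - \sum_(i <- s) sqmod (u i).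
Proof.
move=> us; have h := inner_lin_self us (fun i (_ : i \in s) => erefl (u i)).
have := inner_self (u - lin s u).
rewrite innerBl !innerBr !inner_self h [inner u _]innerJ h l2norm_lin//.
have -> : ((\sum_(i <- s) sqmod (u i))%:C)^* = (\sum_(i <- s) sqmod (u i))%:C :> C.
  exact: conjc_real.
by rewrite subrr subr0 -rmorphB => -[].
Qed.

Lemma l2_dense u (e : R) : 0 < e ->
  exists2 s, uniq s & l2norm (u - lin s u) ^+ 2 < e.
Proof.
move=> /(norm_seq_approx u)[s us h]; exists s => //.
by rewrite l2norm_sub_lin// ltrBlDr addrC -ltrBlDr.
Qed.

End Span.

Variables J I : choiceType.
Variables (B : l2 R J -> l2 R I -> C) (c : R).
Hypothesis Bl : forall a u v w, B (a *: u + v) w = a * B u w + B v w.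
Hypothesis Br : forall a u v w, B w (a *: u + v) = a^* * B w u + B w v.
Hypothesis c0 : 0 <= c.
Hypothesis Bc : formbd c B.

Let Br0 u : B u 0 = 0.
Proof.
have := Br 1 0 0 u; rewrite scaler0 addr0 conjC1 mul1r => /eqP.
by rewrite -subr_eq subrr eq_sym => /eqP.
Qed.

Let B_lin u s f : B u (lin s f) = \sum_(i <- s) (f i)^* * B u (ebasis R i).
Proof.
rewrite /lin; elim: s => [|i s IH]; first by rewrite !big_nil Br0.
by rewrite !big_cons Br IH.
Qed.

(* The coordinates of the vector T u to be constructed. *)
Let coef u (i : I) : C := B u (ebasis R i).

Let coef_sum u s : uniq s -> \sum_(i <- s) sqmod (coef u i) <= (c * l2norm u) ^+ 2.
Proof.
(* The bound on B at the vector with coordinates [coef u] on s. *)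
move=> us; have := Bc u (lin s (coef u)); rewrite B_lin.
have -> : \sum_(i <- s) (coef u i)^* * B u (ebasis R i) =
    (\sum_(i <- s) sqmod (coef u i))%:C.
  by rewrite rmorph_sum/=; apply: eq_bigr => i _; rewrite mulrC mulJ_sqmod.
rewrite -(l2norm_lin _ us) ger0_norm ?ge0c ?sqr_ge0// lecR.
set N := l2norm (lin _ _).
have : 0 <= N := l2norm_ge0 _.
rewrite le_eqVlt => /orP[/eqP <- _|N0]; first by rewrite expr0n sqr_ge0.
move=> NN; have h : N <= c * l2norm u by move: NN; rewrite expr2 ler_pM2r.
by rewrite ler_pXn2r ?nnegrE ?mulr_ge0 ?l2norm_ge0// ltW.
Qed.

Let coef_sqsum u : (sqsum (coef u) <= ((c * l2norm u) ^+ 2)%:E)%E.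
Proof. by apply: seq_esum_le => s us; rewrite sumEFin lee_fin coef_sum. Qed.

Let coef_l2 u : coef u \in @square_summable R I.
Proof. by apply/asboolP; apply: le_lt_trans (coef_sqsum u) _; rewrite ltry. Qed.

Let op_bounded : (fun u => L2 (coef_l2 u)) \in @bounded_op R J I.
Proof.
apply/asboolP; split=> [a u v|].
  by apply/val_inj/funext => i; rewrite /= /coef Bl.
apply/bounded_op_sqsum; exists (c ^+ 2) => [|u]; first exact: sqr_ge0.
by rewrite -(l2norm_sqr u) -EFinM -exprMn; exact: coef_sqsum.
Qed.

(** Riesz: a bounded sesquilinear form comes from a bounded operator. *)
Lemma riesz : exists T : bop R J I, forall u v, inner (T u) v = B u v.
Proof.
pose T := Bop op_bounded; exists T => u v.
have Te i : inner (T u) (ebasis R i) = B u (ebasis R i) by rewrite inner_ebasis.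
(* G vanishes on basis vectors and is bounded, hence zero by density. *)
pose G w := inner (T u) w - B u w.
have GB w s : G w = G (w - lin s w).
  rewrite /G innerBr.
  have -> : B u (w - lin s w) = B u w - B u (lin s w).
    have := Br (-1) (lin s w) w u.
    by rewrite scaleN1r addrC => ->; rewrite rmorphN rmorph1 mulN1r addrC.
  suff -> : inner (T u) (lin s w) = B u (lin s w) by ring.
  rewrite B_lin inner_sumr; apply: eq_bigr => i _.
  by rewrite innerZr Te.
pose K := l2norm (T u) + c * l2norm u.
have K0 : 0 <= K by rewrite addr_ge0 ?mulr_ge0 ?l2norm_ge0.
have GK w : sqmod (G w) <= K ^+ 2 * l2norm w ^+ 2.
  rewrite -lecR -normC_sqmod -exprMn rmorphXn/=.
  rewrite ler_pXn2r ?nnegrE ?normr_ge0 ?ge0c ?mulr_ge0 ?l2norm_ge0//.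
  rewrite mulrDl rmorphD; apply: le_trans (ler_normB _ _) _.
  by apply: lerD; [exact: inner_CS|exact: Bc].
suff G0 : sqmod (G v) <= 0.
  have : `|G v| ^+ 2 <= 0 by rewrite normC_sqmod lecR.
  move=> h; apply/eqP; rewrite -subr_eq0 -normr_eq0 -sqrf_eq0 eq_le.
  by rewrite exprn_ge0 ?normr_ge0// andbT; exact: h.
rewrite leNgt; apply/negP => g0.
have D0 : 0 < K ^+ 2 + 1 by rewrite ltr_wpDl// sqr_ge0.
have e0 := divr_gt0 g0 D0.
have [s us] := l2_dense v e0.
rewrite (ltr_pdivlMr _ _ D0).
have := GK (v - lin s v); rewrite -GB => h; rewrite mulrDr mulr1 mulrC => h'.
have n0 := sqr_ge0 (l2norm (v - lin s v)).
lra.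
Qed.

End Riesz.

Section Adjoint.
Variables (R : realType).
Local Notation C := R[i].

Section Ext.
Variables J I : choiceType.
Implicit Types S T : bop R J I.

Lemma bop_ext S T : (forall u, S u = T u) -> S = T.
Proof. by move=> h; apply/val_inj/funext. Qed.

Lemma bop_inner_ext S T : (forall u v, inner (S u) v = inner (T u) v) -> S = T.
Proof. by move=> h; apply: bop_ext => u; apply: inner_eq. Qed.

Lemma bop_sumE K (s : seq K) (P : pred K) (f : K -> bop R J I) u :
  (\sum_(k <- s | P k) f k) u = \sum_(k <- s | P k) f k u.
Proof. by apply: (big_morph (fun T : bop R J I => T u)). Qed.

(** The operator [T^\dag] is the adjoint of [T]. *)
Lemma adjP T u v : inner (T u) v = inner u (T^\dag v).
Proof.
suff : exists S : bop R I J, forall u v, inner (T u) v = inner u (S v).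
  by move=> [S hS]; have /(_ u v) := @xgetPex _ 0 [set S : bop R I J |
    forall u v, inner (T u) v = inner u (S v)] (ex_intro _ S hS).
have [c c0 Tc] := opbd_exists T.
have [||||S hS] := @riesz R I J (fun v u => (inner (T u) v)^*) c.
- by move=> a x y w; rewrite innerDr innerZr rmorphD rmorphM/= conjCK.
- by move=> a x y w; rewrite linearP/= innerPl rmorphD rmorphM.
- exact: c0.
- by move=> x y; rewrite norm_conjC mulrAC; exact: Tc.
by exists S => x y; rewrite [RHS]innerJ hS conjCK.
Qed.

Lemma adjPr T u v : inner u (T v) = inner (T^\dag u) v.
Proof. by rewrite innerJ adjP -innerJ. Qed.

End Ext.

Lemma adj_uniq (J I : choiceType) (T : bop R J I) (S : bop R I J) :
  (forall u v, inner (T u) v = inner u (S v)) -> T^\dag = S.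
Proof. by move=> h; apply: bop_inner_ext => u v; rewrite -adjPr innerJ h -innerJ. Qed.

Lemma adjK (J I : choiceType) (T : bop R J I) : (T^\dag)^\dag = T.
Proof. by apply: adj_uniq => u v; rewrite -adjPr. Qed.

Lemma adj_comp (J I L : choiceType) (S : bop R I L) (T : bop R J I) :
  (S \cdot T)^\dag = T^\dag \cdot S^\dag.
Proof. by apply: adj_uniq => u v /=; rewrite !adjP. Qed.

Lemma adj_sa (J : choiceType) (T : bop R J J) :
  (forall u v, inner (T u) v = inner u (T v)) <-> T^\dag = T.
Proof. by split=> [/adj_uniq//|h u v]; rewrite adjP h. Qed.

Lemma polarization (J : choiceType) (T : bop R J J) u v :
  4 * inner (T u) v = inner (T (u + v)) (u + v) - inner (T (u - v)) (u - v)
   + 'i * inner (T (u + 'i *: v)) (u + 'i *: v)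
   - 'i * inner (T (u - 'i *: v)) (u - 'i *: v).
Proof.
rewrite !linearD !linearN !linearZ /= !(innerDl, innerDr, innerNl, innerNr, innerZl, innerZr).
rewrite conjCi.
have ii : 'i * 'i = -1 :> C by rewrite -expr2 sqrCi.
set a := inner (T u) u; set b := inner (T u) v; set c := inner (T v) u.
set d := inner (T v) v.
transitivity (2 * b + 2 * c - 2 * ('i * 'i) * b + 2 * ('i * 'i) * c).
  by rewrite ii; ring.
by ring.
Qed.

End Adjoint.

(** * Fibres, amplifications and positive operators *)

Section Fibers.
Variables (R : realType).
Local Notation C := R[i].

Section Gen.
Variables (P J : choiceType).
Implicit Types (u v : l2 R J) (x y : l2 R (P * J)%type) (p q : P).

Let fin_fun p u : P * J -> C := fun t => if t.1 == p then u t.2 else 0.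

Let fin_sqsum p u : sqsum (fin_fun p u) = sqsum u.
Proof.
rewrite /sqsum (@esum_fiber _ _ _ p).
- by apply: eq_esum => j _; rewrite /fin_fun /= eqxx.
- by move=> x; rewrite lee_fin sqmod_ge0.
- by move=> q j /negbTE qp; rewrite /fin_fun /= qp sqmod0.
Qed.

Let fin_l2 p u : fin_fun p u \in @square_summable R (P * J)%type.
Proof. by apply/asboolP; rewrite fin_sqsum l2_fin. Qed.

Let fin_bounded p : (fun u => L2 (fin_l2 p u)) \in @bounded_op R J (P * J)%type.
Proof.
apply/asboolP; split=> [a u v|].
  apply/val_inj/funext => -[q j]; rewrite /= /fin_fun /=.
  rewrite -[RHS]/(a *: (if q == p then u j else 0) + (if q == p then v j else 0)).
  by case: eqP => //; rewrite scaler0 addr0.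
by apply/bounded_op_sqsum; exists 1 => // u; rewrite mul1e fin_sqsum.
Qed.

(** The isometry u |-> e_p (x) u; its adjoint maps a vector to its p-th fibre. *)
Definition fiber_in p : bop R J (P * J)%type := Bop (fin_bounded p).

Lemma sqsum_l2_fiber x p : (sqsum (l2_fiber x p) <= sqsum x)%E.
Proof.
rewrite sqsum_fiber.
have /= <- := @esum_set1 R P p (fun p => sqsum (l2_fiber x p)) _; last first.
  exact: sqsum_ge0.
exact: esum_subset.
Qed.

Let fout_bounded p : (fun x => l2_fiber x p) \in @bounded_op R (P * J)%type J.
Proof.
apply/asboolP; split=> [a u v|]; first exact/val_inj.
by apply/bounded_op_sqsum; exists 1 => // u; rewrite mul1e; exact: sqsum_l2_fiber.
Qed.

Definition fiber_out p : bop R (P * J)%type J := Bop (fout_bounded p).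

Lemma inner_fiber_in p u x : inner (fiber_in p u) x = inner u (l2_fiber x p).
Proof.
rewrite /inner /csum !(@rsum_fiber _ _ _ p) /=.
- by congr (_ +i* _); congr rsum; apply/funext => j; rewrite /fin_fun /= eqxx.
- by move=> q j /negbTE qp; rewrite /fin_fun /= qp mul0r.
- by move=> q j /negbTE qp; rewrite /fin_fun /= qp mul0r.
Qed.

Lemma l2_fiber_in p q u : l2_fiber (fiber_in p u) q = if q == p then u else 0.
Proof. by apply/val_inj/funext => j; rewrite /= /fin_fun /=; case: eqP. Qed.

Lemma l2norm_fiber x p : l2norm (l2_fiber x p) <= l2norm x.
Proof.
rewrite -(@ler_pXn2r _ 2)// ?nnegrE ?l2norm_ge0//.
by rewrite -lee_fin !l2norm_sqr sqsum_l2_fiber.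
Qed.

End Gen.

Section Amp.
Variables (P J I : choiceType).
Implicit Types (T S : bop R J I).

Lemma l2_fiber_amp T (x : l2 R (P * J)%type) p :
  l2_fiber (amp P T x) p = T (l2_fiber x p).
Proof. exact/val_inj. Qed.

Lemma amp_fiber_in T p u : amp P T (fiber_in J p u) = fiber_in I p (T u).
Proof.
apply/val_inj/funext => -[q i].
rewrite -[LHS]/(T (l2_fiber (fiber_in J p u) q) i) l2_fiber_in /=.
by case: eqP => //; rewrite linear0.
Qed.

Lemma ampP a T S : amp P (a *: T + S) = a *: amp P T + amp P S.
Proof. by apply: bop_ext => u; apply/val_inj/funext => -[p i]. Qed.

Lemma amp0 : amp P (0 : bop R J I) = 0.
Proof. by apply: bop_ext => u; apply/val_inj/funext => -[p i]. Qed.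

Lemma ampD T S : amp P (T + S) = amp P T + amp P S.
Proof. by rewrite -{1}[T]scale1r ampP scale1r. Qed.

End Amp.

Lemma amp_comp (P J I L : choiceType) (S : bop R I L) (T : bop R J I) :
  amp P (S \cdot T) = amp P S \cdot amp P T.
Proof.
apply: bop_ext => u; apply/val_inj/funext => -[p i] /=.
by congr ((S _ : l2 R L) i); apply/val_inj.
Qed.

Lemma amp_id (P J : choiceType) : amp P (bop_id R J) = bop_id R (P * J)%type.
Proof. by apply: bop_ext => u; apply/val_inj/funext => -[p i]. Qed.

Section Fin.
Variable m : nat.
Local Notation P := 'I_m.
Variable J : choiceType.
Implicit Types (x y : l2 R (P * J)%type).

Lemma fiber_decomp x : x = \sum_p fiber_in J p (l2_fiber x p).
Proof.
have xE : forall q, l2_fiber (\sum_p fiber_in J p (l2_fiber x p)) q = l2_fiber x q.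
  move=> q; have fD (s t : l2 R (P * J)%type) :
      l2_fiber (s + t) q = l2_fiber s q + l2_fiber t q by exact/val_inj.
  have f0 : l2_fiber (0 : l2 R (P * J)%type) q = 0 by exact/val_inj.
  rewrite (big_morph (fun z => l2_fiber z q) fD f0).
  rewrite (bigD1 q isT) l2_fiber_in eqxx.
  rewrite big1 ?addr0// => [|p /negbTE pq]; first exact: addr0.
  by rewrite l2_fiber_in eq_sym pq.
apply/val_inj/funext => -[p j].
exact: esym (congr1 (fun z : l2 R J => z j) (xE p)).
Qed.

Lemma inner_fibers x y : inner x y = \sum_p inner (l2_fiber x p) (l2_fiber y p).
Proof.
transitivity (inner (\sum_p fiber_in J p (l2_fiber x p)) y).
  by rewrite -fiber_decomp.
by rewrite inner_suml; apply: eq_bigr => p _; rewrite inner_fiber_in.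
Qed.

End Fin.

Lemma adj_amp (m : nat) (J I : choiceType) (T : bop R J I) :
  (amp 'I_m T)^\dag = amp 'I_m T^\dag.
Proof.
apply: adj_uniq => u v; rewrite !inner_fibers; apply: eq_bigr => p _.
by rewrite !l2_fiber_amp adjP.
Qed.

End Fibers.
Arguments fiber_in {R P} J p.
Arguments fiber_out {R P} J p.

Lemma inner_opP (R : realType) (J I : choiceType) a (S T : bop R J I) u v :
  inner ((a *: S + T) u) v = a * inner (S u) v + inner (T u) v.
Proof. exact: innerPl. Qed.

Lemma inner_opD (R : realType) (J I : choiceType) (S T : bop R J I) u v :
  inner ((S + T) u) v = inner (S u) v + inner (T u) v.
Proof. exact: innerDl. Qed.

Lemma inner_opN (R : realType) (J I : choiceType) (T : bop R J I) u v :
  inner ((- T) u) v = - inner (T u) v.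
Proof. exact: innerNl. Qed.

Lemma inner_opB (R : realType) (J I : choiceType) (S T : bop R J I) u v :
  inner ((S - T) u) v = inner (S u) v - inner (T u) v.
Proof. exact: innerBl. Qed.

Section Positivity.
Variables (R : realType).
Local Notation C := R[i].
Variable J : choiceType.
Implicit Types (S T : bop R J J).

(** The real part of the quadratic form of an operator. *)
Definition qf T u : R := Re (inner (T u) u).

Lemma qfD S T u : qf (S + T) u = qf S u + qf T u.
Proof. by rewrite /qf innerDl ReD. Qed.
Lemma qfN T u : qf (- T) u = - qf T u.
Proof. by rewrite /qf innerNl ReN. Qed.
Lemma qf0 u : qf 0 u = 0.
Proof. by rewrite /qf inner0l. Qed.
Lemma qf_sum K (s : seq K) (Q : pred K) (f : K -> bop R J J) u :
  qf (\sum_(k <- s | Q k) f k) u = \sum_(k <- s | Q k) qf (f k) u.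
Proof. by rewrite /qf bop_sumE inner_suml Re_sum. Qed.
Lemma qf_id u : qf (bop_id R J) u = l2norm u ^+ 2.
Proof. by rewrite /qf inner_self. Qed.

Lemma qf_dag (I : choiceType) (z : bop R J I) u : qf (z^\dag \cdot z) u = l2norm (z u) ^+ 2.
Proof. by rewrite /qf -[inner _ u]/(inner (z^\dag (z u)) u) -adjPr inner_self. Qed.

Lemma sa_real T u : T^\dag = T -> inner (T u) u = (qf T u)%:C.
Proof.
move=> h; apply: complex_ext => //=; have := adjP T u u; rewrite h => /(congr1 (@complex.Im R)).
rewrite [inner u _]innerJ ImJ => /eqP; rewrite -addr_eq0 -mulr2n mulrn_eq0 /=.
by move/eqP.
Qed.

(** Over the complex numbers a positive operator is self-adjoint, by
polarization. *)
Lemma positive_sa T : positive T -> T^\dag = T.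
Proof.
move=> pT; have Tr u : (inner (T u) u)^* = inner (T u) u.
  by have := pT u; rewrite ge0C => /andP[/eqP h _]; apply: complex_ext; rewrite ?ReJ ?ImJ ?h ?oppr0.
apply/adj_sa => u v; rewrite [RHS]innerJ.
have n4 : (4 : C) != 0 by rewrite pnatr_eq0.
apply: (mulfI n4); rewrite (polarization T u v).
have -> : 4 * (inner (T v) u)^* = (4 * inner (T v) u)^*.
  by rewrite rmorphM /= conjC_nat.
rewrite (polarization T v u) !(rmorphB, rmorphD, rmorphM) /= !conjCi !Tr.
have -> : inner (T (v - u)) (v - u) = inner (T (u - v)) (u - v).
  by rewrite -[v - u]opprB linearN innerNl innerNr opprK.
have E c w : c * c^* = 1 -> inner (T (c *: w)) (c *: w) = inner (T w) w.
  by move=> cc; rewrite linearZ innerZl innerZr mulrA cc mul1r.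
have ii : 'i * 'i = -1 :> C by rewrite -expr2 sqrCi.
have iJ : ('i : C) * 'i^* = 1 by rewrite conjCi mulrN ii opprK.
have -> : inner (T (v + 'i *: u)) (v + 'i *: u) = inner (T (u - 'i *: v)) (u - 'i *: v).
  rewrite -(E 'i (u - 'i *: v))// scalerBr scalerA ii scaleN1r opprK addrC //.
have -> : inner (T (v - 'i *: u)) (v - 'i *: u) = inner (T (u + 'i *: v)) (u + 'i *: v).
  rewrite -(E (- 'i) (u + 'i *: v)); last by rewrite rmorphN mulrNN.
  by rewrite scalerDr scalerA mulNr ii opprK scale1r scaleNr addrC.
by rewrite [v + u]addrC; ring.
Qed.

Lemma positiveP T : positive T <-> T^\dag = T /\ forall u, 0 <= qf T u.
Proof.
split=> [pT|[sT h] u]; last by rewrite sa_real// ge0c.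
by split=> [|u]; [exact: positive_sa|have := pT u; rewrite ge0C => /andP[]].
Qed.

Lemma adjP' a S T : (a *: S + T)^\dag = a^* *: S^\dag + T^\dag.
Proof.
apply: adj_uniq => u v; rewrite innerPl !adjP -[in LHS](conjCK a) -innerZr -innerDr.
by [].
Qed.

Lemma adjD S T : (S + T)^\dag = S^\dag + T^\dag.
Proof. by rewrite -{1}[S]scale1r adjP' rmorph1 scale1r. Qed.

Lemma adj0 : (0 : bop R J J)^\dag = 0.
Proof. by apply: adj_uniq => u v; rewrite inner0l inner0r. Qed.

Lemma adjN T : (- T)^\dag = - T^\dag.
Proof.
by rewrite -scaleN1r -[_ *: T]addr0 adjP' adj0 addr0 rmorphN rmorph1 scaleN1r.
Qed.

Lemma adj_sum K (s : seq K) (Q : pred K) (f : K -> bop R J J) :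
  (\sum_(k <- s | Q k) f k)^\dag = \sum_(k <- s | Q k) (f k)^\dag.
Proof. by apply: (big_morph (fun T : bop R J J => T^\dag)); [exact: adjD|exact: adj0]. Qed.

End Positivity.

(** * Compressions, partial traces and the weighted graph *)

#[local] Arguments complex.Re : simpl never.
#[local] Arguments complex.Im : simpl never.
#[local] Arguments bopval : simpl never.
#[local] Arguments amp : simpl never.
#[local] Arguments bop_comp : simpl never.

Section Pull.
Variables (R : realType).
Local Notation C := R[i].

(** Compression X |-> alpha^* X alpha. *)
Definition pull (J I : choiceType) (al : bop R J I) (X : bop R I I) : bop R J J :=
  al^\dag \cdot X \cdot al.

Lemma inner_pull (J I : choiceType) (al : bop R J I) X u v :
  inner (pull al X u) v = inner (X (al u)) (al v).
Proof. by rewrite -[inner _ v]/(inner (al^\dag (X (al u))) v) -adjPr. Qed.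

Lemma qf_pull (J I : choiceType) (al : bop R J I) X u : qf (pull al X) u = qf X (al u).
Proof. by rewrite /qf inner_pull. Qed.

Lemma positive_pull (J I : choiceType) (al : bop R J I) X :
  positive X -> positive (pull al X).
Proof. by move=> pX u; rewrite inner_pull. Qed.

Lemma pull_sa (J I : choiceType) (al : bop R J I) X :
  X^\dag = X -> (pull al X)^\dag = pull al X.
Proof.
move=> /adj_sa h; apply/adj_sa => u v.
by rewrite inner_pull h innerJ -inner_pull -innerJ.
Qed.

Lemma amp_pull (m : nat) (J I : choiceType) (al : bop R J I) X :
  amp 'I_m (pull al X) = pull (amp 'I_m al) (amp 'I_m X).
Proof. by rewrite /pull !amp_comp adj_amp. Qed.

Lemma pullB (J I : choiceType) (al : bop R J I) X Y :
  pull al (X - Y) = pull al X - pull al Y.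
Proof. by apply: bop_inner_ext => u v; rewrite innerBl !inner_pull innerBl. Qed.

End Pull.

Section PartialTrace.
Variables (R : realType) (m : nat).
Local Notation C := R[i].
Local Notation P := 'I_m.

(** [ptr b X] is \sum_(p, q) b_pq X_pq, where X_pq are the blocks of X.  When X
is the Choi matrix of a completely positive map Theta, this is Theta(b). *)
Definition ptr (J : choiceType) (b : 'M[C]_m) (X : bop R (P * J)%type (P * J)%type) :
    bop R J J :=
  \sum_p \sum_q b p q *: (fiber_out J p \cdot X \cdot fiber_in J q).

Lemma inner_ptr (J : choiceType) b X (u v : l2 R J) :
  inner (ptr b X u) v =
  \sum_p \sum_q b p q * inner (X (fiber_in J q u)) (fiber_in J p v).
Proof.
rewrite /ptr bop_sumE inner_suml; apply: eq_bigr => p _.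
rewrite bop_sumE inner_suml; apply: eq_bigr => q _.
rewrite -[inner _ v]/(inner (b p q *: l2_fiber (X (fiber_in J q u)) p) v).
by rewrite innerZl [inner _ v]innerJ -inner_fiber_in -innerJ.
Qed.

Lemma ptrP (J : choiceType) b a (X Y : bop R (P * J)%type (P * J)%type) :
  ptr b (a *: X + Y) = a *: ptr b X + ptr b Y.
Proof.
apply: bop_inner_ext => u v; rewrite inner_ptr.
rewrite -[RHS]/(inner (a *: ptr b X u + ptr b Y u) v) innerPl !inner_ptr mulr_sumr -big_split.
apply: eq_bigr => p _; rewrite mulr_sumr -big_split; apply: eq_bigr => q _ /=.
by rewrite -[inner _ _]/(inner (a *: X (fiber_in J q u) + Y (fiber_in J q u)) _) innerPl; ring.
Qed.

Lemma ptrD (J : choiceType) b (X Y : bop R (P * J)%type (P * J)%type) :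
  ptr b (X + Y) = ptr b X + ptr b Y.
Proof. by rewrite -{1}[X]scale1r ptrP scale1r. Qed.

Lemma ptr0 (J : choiceType) b : ptr b (0 : bop R (P * J)%type (P * J)%type) = 0.
Proof.
have := ptrD b (0 : bop R (P * J)%type (P * J)%type) 0.
by rewrite addr0 => /eqP; rewrite -subr_eq subrr eq_sym => /eqP.
Qed.

Lemma ptr_pull (J I : choiceType) b (al : bop R J I) (X : bop R (P * I)%type (P * I)%type) :
  ptr b (pull (amp P al) X) = pull al (ptr b X).
Proof.
apply: bop_inner_ext => u v; rewrite inner_pull !inner_ptr.
apply: eq_bigr => p _; apply: eq_bigr => q _.
by rewrite inner_pull !amp_fiber_in.
Qed.

Lemma inner_ptr1 (J : choiceType) X (u v : l2 R J) :
  inner (ptr 1%:M X u) v = \sum_p inner (X (fiber_in J p u)) (fiber_in J p v).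
Proof.
rewrite inner_ptr; apply: eq_bigr => p _; rewrite (bigD1 p)//= mxE eqxx mul1r.
by rewrite big1 ?addr0// => q /negbTE qp; rewrite mxE eq_sym qp mul0r.
Qed.

Section Bound.
Variable J : choiceType.
Variable X : bop R (P * J)%type (P * J)%type.
Hypothesis pX : positive X.
Hypothesis X1 : forall u, qf (ptr 1%:M X) u <= l2norm u ^+ 2.

(* A diagonal block is at most the sum of all of them, hence at most 1. *)
Let diag_le p (u : l2 R J) :
  inner (X (fiber_in J p u)) (fiber_in J p u) <= (l2norm u ^+ 2)%:C.
Proof.
have pX' v : 0 <= qf X v by have /positiveP[] := pX.
rewrite (sa_real _ (positive_sa pX)) lecR; apply: le_trans (X1 u).
rewrite /qf inner_ptr1 Re_sum (bigD1 p)//= lerDl sumr_ge0// => q _.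
exact: pX'.
Qed.

Let block_le p q : formbd 1 (fun u v => inner (X (fiber_in J q u)) (fiber_in J p v)).
Proof.
move=> u v; rewrite mul1r.
apply: (@form_CS_norm R (l2 R (P * J)%type) (fun u v => inner (X u) v)).
- by move=> c x y z; rewrite linearP innerPl.
- move=> x y; rewrite -innerJ.
  exact: (proj2 (adj_sa X) (positive_sa pX) y x).
- by move=> x; exact: pX.
- exact: l2norm_ge0.
- exact: l2norm_ge0.
- exact: diag_le.
- exact: diag_le.
Qed.

(** A positive block operator is bounded in terms of its partial trace. *)
Lemma opbd_ptr1 : opbd (m%:R ^+ 2) X.
Proof.
move=> u v.
have -> : inner (X u) v =
    \sum_p \sum_q inner (X (fiber_in J q (l2_fiber u q))) (fiber_in J p (l2_fiber v p)).
  transitivity (inner (X (\sum_q fiber_in J q (l2_fiber u q)))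
                      (\sum_p fiber_in J p (l2_fiber v p))).
    by rewrite -!fiber_decomp.
  rewrite inner_sumr; apply: eq_bigr => p _.
  by rewrite linear_sum inner_suml.
apply: le_trans (ler_norm_sum _ _ _) _.
have -> : (m%:R ^+ 2 * l2norm u * l2norm v)%:C = \sum_(p < m) \sum_(q < m) (l2norm u * l2norm v)%:C.
  rewrite !sumr_const !card_ord -mulrnA -rmorphMn/=; congr (_%:C).
  by rewrite -[RHS]mulr_natl natrM expr2 -!mulrA.
apply: ler_sum => p _; apply: le_trans (ler_norm_sum _ _ _) _.
apply: ler_sum => q _; apply: le_trans (block_le _ _ _ _) _.
by rewrite mul1r lecR ler_pM ?l2norm_ge0 ?l2norm_fiber.
Qed.

Lemma opbd_ptr (b : 'M[C]_m) (c : R) : (forall p q, `|b p q| <= c%:C) ->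
  opbd (m%:R ^+ 2 * c) (ptr b X).
Proof.
move=> bc u v; rewrite inner_ptr.
apply: le_trans (ler_norm_sum _ _ _) _.
have -> : (m%:R ^+ 2 * c * l2norm u * l2norm v)%:C =
    \sum_(p < m) \sum_(q < m) (c * l2norm u * l2norm v)%:C.
  rewrite !sumr_const !card_ord -mulrnA -rmorphMn/=; congr (_%:C).
  by rewrite -[RHS]mulr_natl natrM expr2 -!mulrA.
apply: ler_sum => p _; apply: le_trans (ler_norm_sum _ _ _) _.
apply: ler_sum => q _; rewrite normrM -[c * _ * _]mulrA rmorphM.
by apply: ler_pM => //; apply: le_trans (block_le _ _ _ _) _; rewrite mul1r.
Qed.

End Bound.

End PartialTrace.

Section Graph.
Variables (R : realType) (m k : nat) (b : 'I_k -> 'M[R[i]]_m) (r : R).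
Local Notation C := R[i].
Local Notation P := 'I_m.

Section Def.
Variable J : choiceType.

(** The ball of radius r relative to a weight w.  For w = 1 this says that
\sum_j x_j x_j^* <= r^2, the square |x_j^* u|^2 being the supremum over v of
2 Re <x_j v, u> - |v|^2 ; the condition is linear in (w, x). *)
Definition wball (w : bop R J J) (x : 'I_k -> bop R J J) : Prop :=
  forall (u : l2 R J) (v : 'I_k -> l2 R J),
  \sum_j (2 * Re (inner (x j (v j)) u) - qf w (v j)) <= r ^+ 2 * qf w u.

(** The graph of the nc majorization function attached to b, relative to a
weight w and with an explicit Choi matrix X.  For w = 1 the last condition says
that S >= - X + 1 (x) \sum_j z_j^* z_j with z_j = x_j - Theta(b_j). *)
Definition wgraph (w : bop R J J) (x : 'I_k -> bop R J J)
    (S X : bop R (P * J)%type (P * J)%type) : Prop :=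
  [/\ wball w x, S^\dag = S, positive X, ptr 1%:M X = w &
   forall (u : l2 R (P * J)%type) (v : 'I_k -> l2 R (P * J)%type),
   \sum_j (2 * Re (inner (amp P (x j - ptr (b j) X) u) (v j)) - qf (amp P w) (v j))
   <= qf S u + qf X u].

Lemma wgraph0 : wgraph 0 (fun=> 0) 0 0.
Proof.
split.
- move=> u v; rewrite (qf0 u) mulr0 big1// => j _.
  by rewrite qf0 inner0l mulr0 subr0.
- exact: adj0.
- by move=> u; rewrite inner0l.
- exact: ptr0.
- move=> u v; rewrite !(qf0 u) addr0 big1// => j _.
  by rewrite ptr0 subr0 !amp0 qf0 inner0l mulr0 subr0.
Qed.

Lemma wgraphD w w' x x' S S' X X' : wgraph w x S X -> wgraph w' x' S' X' ->
  wgraph (w + w') (fun j => x j + x' j) (S + S') (X + X').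
Proof.
move=> [h1 h2 h3 h4 h5] [g1 g2 g3 g4 g5]; split.
- move=> u v; rewrite qfD mulrDr; apply: le_trans (lerD (h1 u v) (g1 u v)).
  rewrite -big_split; apply: ler_sum => j _ /=.
  by rewrite qfD inner_opD ReD; lra.
- by rewrite adjD h2 g2.
- by move=> u; rewrite inner_opD addr_ge0 ?(h3 u) ?(g3 u).
- by rewrite ptrD h4 g4.
- move=> u v; rewrite !qfD addrACA; apply: le_trans (lerD (h5 u v) (g5 u v)).
  rewrite -big_split; apply: ler_sum => j _ /=.
  rewrite ptrD opprD addrACA !ampD !qfD.
  by rewrite inner_opD ReD; lra.
Qed.

Lemma wgraph_sum (w : nat -> bop R J J) (x : nat -> 'I_k -> bop R J J) S X N :
  (forall i, wgraph (w i) (x i) (S i) (X i)) ->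
  wgraph (\sum_(i < N) w i) (fun j => \sum_(i < N) x i j)
         (\sum_(i < N) S i) (\sum_(i < N) X i).
Proof.
move=> h; elim: N => [|N IH].
  rewrite !big_ord0 (_ : (fun _ => _) = (fun=> 0)); first exact: wgraph0.
  by apply/funext => j; rewrite big_ord0.
rewrite !big_ord_recr/= (_ : (fun _ => _) = (fun j => \sum_(i < N) x i j + x N j)).
  exact: wgraphD.
by apply/funext => j; rewrite big_ord_recr.
Qed.

End Def.

Lemma wgraph_pull (J I : choiceType) (al : bop R J I) w x S X : wgraph w x S X ->
  wgraph (pull al w) (fun j => pull al (x j)) (pull (amp P al) S) (pull (amp P al) X).
Proof.
move=> [h1 h2 h3 h4 h5]; split.
- move=> u v; rewrite qf_pull; apply: le_trans (h1 (al u) (fun j => al (v j))).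
  by apply: ler_sum => j _; rewrite qf_pull inner_pull.
- exact: pull_sa.
- exact: positive_pull.
- by rewrite ptr_pull h4.
- move=> u v; rewrite !qf_pull.
  apply: le_trans (h5 (amp P al u) (fun j => amp P al (v j))).
  by apply: ler_sum => j _; rewrite ptr_pull -pullB !amp_pull qf_pull inner_pull.
Qed.

End Graph.

(** * Limits along ultrafilters *)

Section ComplexLimits.
Variables (R : realType) (T : Type) (U : set_system T).
Context {FU : ProperFilter U}.
Local Notation C := R[i].
Implicit Types (f g : T -> C) (a b : C).

(** Convergence of complex-valued functions, expressed on real and imaginary
parts. *)
Definition ccvg f a :=
  ((fun t => Re (f t)) @ U --> Re a) /\ ((fun t => Im (f t)) @ U --> Im a).

Lemma ccvg_cst a : ccvg (fun=> a) a.
Proof. by split; apply: cvg_cst. Qed.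

Lemma ccvgD f g a b : ccvg f a -> ccvg g b -> ccvg (fun t => f t + g t) (a + b).
Proof.
move=> [f1 f2] [g1 g2]; split; rewrite (ReD, ImD).
  by under eq_fun do rewrite ReD; apply: cvgD.
by under eq_fun do rewrite ImD; apply: cvgD.
Qed.

Lemma ccvgZ c f a : ccvg f a -> ccvg (fun t => c * f t) (c * a).
Proof.
move=> [f1 f2]; split; rewrite (complex_ReM, complex_ImM).
  under eq_fun do rewrite complex_ReM.
  by apply: cvgB; apply: cvgM => //; apply: cvg_cst.
under eq_fun do rewrite complex_ImM.
by apply: cvgD; apply: cvgM => //; apply: cvg_cst.
Qed.

Lemma ccvgJ f a : ccvg f a -> ccvg (fun t => (f t)^*) (a^*).
Proof.
move=> [f1 f2]; split; rewrite (ReJ, ImJ).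
  by under eq_fun do rewrite ReJ.
by under eq_fun do rewrite ImJ; apply: cvgN.
Qed.

Lemma ccvg_sum (K : Type) (s : seq K) (P : pred K) (f : K -> T -> C) (a : K -> C) :
  (forall k, ccvg (f k) (a k)) ->
  ccvg (fun t => \sum_(k <- s | P k) f k t) (\sum_(k <- s | P k) a k).
Proof.
move=> fa; elim: s => [|k s IH].
  by under eq_fun do rewrite big_nil; rewrite big_nil; exact: ccvg_cst.
under eq_fun do rewrite big_cons; rewrite big_cons; case: (P k) => //.
exact: ccvgD.
Qed.

Lemma cvgr_sum (K : Type) (s : seq K) (P : pred K) (f : K -> T -> R) (a : K -> R) :
  (forall k, f k @ U --> a k) ->
  (fun t => \sum_(k <- s | P k) f k t) @ U --> \sum_(k <- s | P k) a k.
Proof.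
move=> fa; elim: s => [|k s IH].
  by under eq_fun do rewrite big_nil; rewrite big_nil; exact: cvg_cst.
under eq_fun do rewrite big_cons; rewrite big_cons; case: (P k) => //.
by apply: cvgD IH; exact: fa.
Qed.

Lemma ccvg_uniq f a b : ccvg f a -> ccvg f b -> a = b.
Proof.
move=> [f1 f2] [g1 g2]; apply: complex_ext.
  exact: cvg_unique f1 g1.
exact: cvg_unique f2 g2.
Qed.

Lemma ccvg_near_eq f g a : (\forall t \near U, f t = g t) -> ccvg f a -> ccvg g a.
Proof.
move=> fg [f1 f2]; split.
  by apply: cvg_trans f1; apply: near_eq_cvg; near=> t; rewrite (near fg t).
by apply: cvg_trans f2; apply: near_eq_cvg; near=> t; rewrite (near fg t).
Unshelve. all: by end_near. Qed.

Lemma cvgr_le_near (f g : T -> R) (a b : R) :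
  f @ U --> a -> g @ U --> b -> (\forall t \near U, f t <= g t) -> a <= b.
Proof.
move=> fa gb fg; rewrite -subr_ge0; set h := fun t => g t - f t.
have hba : h @ U --> b - a by exact: cvgB.
apply: (@ler_cvg_to R (h @ U) _ R (fun=> 0) id 0 (b - a)).
- exact: cvg_cst.
- exact: hba.
- by rewrite near_simpl; apply: filterS fg => t; rewrite /h subr_ge0.
Qed.

Lemma ccvg_ge0 f a : (\forall t \near U, 0 <= f t) -> ccvg f a -> 0 <= a.
Proof.
move=> f0 [f1 f2]; rewrite ge0C; apply/andP; split.
  apply/eqP; apply: cvg_unique f2 _ => //.
  apply: cvg_near_cst; apply: filterS f0 => t.
  by rewrite ge0C => /andP[/eqP].
apply: (cvgr_le_near (cvg_cst 0) f1); apply: filterS f0 => t.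
by rewrite ge0C => /andP[].
Qed.

End ComplexLimits.

Section Ultra.
Variables (R : realType) (T : Type) (U : set_system T).
Context {UU : UltraFilter U}.
Local Notation C := R[i].

Lemma ultra_fmap (V : Type) (f : T -> V) : UltraFilter (f @ U).
Proof.
split=> [|G GF fG]; first exact: fmap_proper_filter.
rewrite predeqE => A; split; last exact: fG.
move=> GA; have [//|UA] := in_ultra_setVsetC (f @^-1` A) UU.
have GnA : G (~` A) by apply: fG.
by have /filter_ex [? []] : G (A `&` ~` A) by exact: filterI.
Qed.

(** A bounded real function converges along an ultrafilter. *)
Lemma ultra_bounded_cvg (f : T -> R) (M : R) : (forall t, `|f t| <= M) ->
  exists l : R, f @ U --> l.
Proof.
move=> fM; have := @segment_compact R (- M) M; rewrite compact_ultra.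
move=> /(_ (f @ U) (ultra_fmap f)) [|l [_ fl]]; last by exists l.
suff h : U (f @^-1` [set` `[- M, M]]) by exact: h.
by apply: filterE => t; rewrite /= in_itv /= -ler_norml fM.
Qed.

Lemma ultra_bounded_ccvg (f : T -> C) (M : R) : (forall t, `|f t| <= M%:C) ->
  exists l : C, ccvg U f l.
Proof.
move=> fM.
have [|a fa] := @ultra_bounded_cvg (fun t => Re (f t)) M.
  by move=> t; exact: Re_le_norm.
have [|b fb] := @ultra_bounded_cvg (fun t => Im (f t)) M.
  by move=> t; exact: Im_le_norm.
by exists (a +i* b).
Qed.

Lemma ccvg_norm_le (f : T -> C) (M : R) (l : C) : 0 <= M ->
  (forall t, `|f t| <= M%:C) -> ccvg U f l -> `|l| <= M%:C.
Proof.
move=> M0 fM [f1 f2].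
have sqM (z : C) : (`|z| <= M%:C) = (Re z * Re z + Im z * Im z <= M * M).
  rewrite -(@ler_pXn2r _ 2)// ?nnegrE ?normr_ge0 ?ge0c// normC_sqmod -rmorphXn lecR.
  by rewrite /sqmod !expr2.
rewrite sqM; apply: (cvgr_le_near (cvgD (cvgM f1 f1) (cvgM f2 f2)) (cvg_cst (M * M))).
by apply: filterE => t; rewrite -[X in X <= _]/(Re (f t) * Re (f t) + Im (f t) * Im (f t)) -sqM fM.
Qed.

End Ultra.

Section WeakLimits.
Variables (R : realType) (T : Type) (U : set_system T).
Local Notation C := R[i].

(** Convergence of operators in the weak operator topology. *)
Definition wcvg (J I : choiceType) (X : T -> bop R J I) (X0 : bop R J I) :=
  forall u v, ccvg U (fun t => inner (X t u) v) (inner (X0 u) v).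

Context {FU : ProperFilter U}.

Lemma wcvgD (J I : choiceType) (X Y : T -> bop R J I) X0 Y0 :
  wcvg X X0 -> wcvg Y Y0 -> wcvg (fun t => X t + Y t) (X0 + Y0).
Proof.
move=> hX hY u v; rewrite inner_opD; under eq_fun do rewrite inner_opD.
exact: ccvgD.
Qed.

Lemma wcvgN (J I : choiceType) (X : T -> bop R J I) X0 :
  wcvg X X0 -> wcvg (fun t => - X t) (- X0).
Proof.
move=> hX u v; rewrite inner_opN -mulN1r.
by under eq_fun do rewrite inner_opN -mulN1r; exact: ccvgZ.
Qed.

Lemma wcvg_amp (m : nat) (J I : choiceType) (X : T -> bop R J I) X0 :
  wcvg X X0 -> wcvg (fun t => amp 'I_m (X t)) (amp 'I_m X0).
Proof.
move=> hX u v.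
have E (Y : bop R J I) : inner (amp 'I_m Y u) v =
    \sum_p inner (Y (l2_fiber u p)) (l2_fiber v p).
  by rewrite inner_fibers; apply: eq_bigr => p _; rewrite l2_fiber_amp.
rewrite E; under eq_fun do rewrite E.
by apply: ccvg_sum => p; exact: hX.
Qed.

Lemma wcvg_ptr (m : nat) (J : choiceType) (b : 'M[C]_m)
    (X : T -> bop R ('I_m * J)%type ('I_m * J)%type) X0 :
  wcvg X X0 -> wcvg (fun t => ptr b (X t)) (ptr b X0).
Proof.
move=> hX u v; rewrite inner_ptr; under eq_fun do rewrite inner_ptr.
by apply: ccvg_sum => p; apply: ccvg_sum => q; apply: ccvgZ; exact: hX.
Qed.

Lemma wcvg_qf (J : choiceType) (X : T -> bop R J J) X0 u :
  wcvg X X0 -> (fun t => qf (X t) u) @ U --> qf X0 u.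
Proof. by move=> /(_ u u)[]. Qed.

End WeakLimits.

(** Weak* convergence implies convergence in the weak operator topology. *)
Lemma weakstar_wcvg (R : realType) (T : Type) (U : set_system T) {FU : ProperFilter U}
    (J I : choiceType) (X : T -> bop R J I) (X0 : bop R J I) :
  X @ U --> X0 -> wcvg U X X0.
Proof.
move=> XX0 u v.
(* The functional T |-> <T u, v>, with both vectors placed in fibre 0. *)
pose uv : l2 R (nat * J)%type * l2 R (nat * I)%type := (fiber_in J 0%N u, fiber_in I 0%N v).
have nfE (Y : bop R J I) : normal_functional Y uv = inner (Y u) v.
  by rewrite /normal_functional /uv [LHS]/= amp_fiber_in inner_fiber_in l2_fiber_in eqxx.
have h : (fun t => normal_functional (X t) uv) @ U --> normal_functional X0 uv.
  have c1 : (fun t => (normal_functional (X t) :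
      prod_topology (fun _ : (l2 R (nat * J)%type * l2 R (nat * I)%type)%type => R[i]^o)))
      @ U --> (normal_functional X0 : prod_topology _).
    apply: (cvg_comp _ _ XX0); exact: initial_continuous.
  exact: (cvg_comp _ _ c1 (@proj_continuous _ (fun=> R[i]^o) uv _)).
rewrite nfE in h; have {}h : (fun t => inner (X t u) v : R[i]^o) @ U --> (inner (X0 u) v : R[i]^o).
  by under eq_fun do rewrite -nfE.
have ltE (e : R) : 0 < e -> (0 : R[i]) < e%:C by move=> e0; rewrite ltcR.
split; apply/cvgrPdist_lt => e e0; move/cvgrPdist_lt : h => /(_ _ (ltE _ e0)); apply: filterS => t.
  by move=> h; rewrite -ReN -ReD -ltcR; apply: le_lt_trans h; exact: normc_ge_Re.
move=> h; rewrite -ImN -ImD -ltcR; apply: le_lt_trans h.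
exact: norm_ge_Im.
Qed.

Section Alaoglu.
Variables (R : realType) (T : Type) (U : set_system T).
Context {UU : UltraFilter U}.
Local Notation C := R[i].

(** Banach-Alaoglu: along an ultrafilter, a uniformly bounded family of operators
converges in the weak operator topology. *)
Lemma alaoglu (J I : choiceType) (X : T -> bop R J I) (c : R) : 0 <= c ->
  (forall t, opbd c (X t)) -> exists X0, wcvg U X X0.
Proof.
move=> c0 Xc.
have /choice[B BE] : forall uv : l2 R J * l2 R I, exists l : C,
    ccvg U (fun t => inner (X t uv.1) uv.2) l.
  move=> [u v]; apply: ultra_bounded_ccvg => t; exact: Xc.
have BE' u v : ccvg U (fun t => inner (X t u) v) (B (u, v)) := BE (u, v).
have [||||X0 hX0] := @riesz R J I (fun u v => B (u, v)) c.
- move=> a x y w; apply: ccvg_uniq (BE' _ _) _.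
  under eq_fun do rewrite linearP innerPl.
  exact: (ccvgD (ccvgZ a (BE' x w)) (BE' y w)).
- move=> a x y w; apply: ccvg_uniq (BE' _ _) _.
  under eq_fun do rewrite innerDr innerZr.
  exact: (ccvgD (ccvgZ a^* (BE' w x)) (BE' w y)).
- exact: c0.
- move=> u v; apply: (ccvg_norm_le _ (fun t => Xc t u v) (BE' u v)).
  by rewrite !mulr_ge0 ?l2norm_ge0.
by exists X0 => u v; rewrite hX0.
Qed.

Variables (m k : nat) (b : 'I_k -> 'M[C]_m) (r : R).
Local Notation P := 'I_m.

(** The triples (w, x, S) with w <= 1 that admit some X form a weakly closed
set. *)
Lemma wgraph_lim (J : choiceType) (w : T -> bop R J J) (x : T -> 'I_k -> bop R J J)
    (S : T -> bop R (P * J)%type (P * J)%type) w0 x0 S0 :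
  (\forall t \near U, (exists X, wgraph b r (w t) (x t) (S t) X) /\
      forall u, qf (w t) u <= l2norm u ^+ 2) ->
  wcvg U w w0 -> (forall j, wcvg U (fun t => x t j) (x0 j)) -> wcvg U S S0 ->
  exists X0, wgraph b r w0 x0 S0 X0.
Proof.
move=> hw ww0 xx0 SS0.
(* Outside the graph any bounded X will do; 0 is taken. *)
have /choice[X hX] : forall t, exists X : bop R (P * J)%type (P * J)%type,
    ((exists X, wgraph b r (w t) (x t) (S t) X) /\
      (forall u, qf (w t) u <= l2norm u ^+ 2) -> wgraph b r (w t) (x t) (S t) X)
    /\ opbd (m%:R ^+ 2) X.
  move=> t; have [[[X hX] hwt]|no] := pselect ((exists X, wgraph b r (w t) (x t) (S t) X) /\
      (forall u, qf (w t) u <= l2norm u ^+ 2)).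
    exists X; split => //; have [_ _ pX X1 _] := hX.
    by apply: opbd_ptr1 => // u; rewrite X1.
  exists 0; split => // u v; rewrite inner0l normr0 ge0c.
  by rewrite !mulr_ge0 ?l2norm_ge0 ?sqr_ge0.
have [X0 XX0] := alaoglu (sqr_ge0 _) (fun t => (hX t).2).
have {}hw : \forall t \near U, wgraph b r (w t) (x t) (S t) (X t).
  by apply: filterS hw => t; exact: (hX t).1.
exists X0; split.
- move=> u v.
  have h1 : (fun t => \sum_j (2 * Re (inner (x t j (v j)) u) - qf (w t) (v j))) @ U -->
      \sum_j (2 * Re (inner (x0 j (v j)) u) - qf w0 (v j)).
    apply: cvgr_sum => j; apply: cvgB; last exact: wcvg_qf.
    by apply: cvgM; [exact: cvg_cst|have [] := xx0 j (v j) u].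
  have h2 : (fun t => r ^+ 2 * qf (w t) u) @ U --> r ^+ 2 * qf w0 u.
    by apply: cvgM; [exact: cvg_cst|exact: wcvg_qf].
  apply: (cvgr_le_near h1 h2); apply: filterS hw => t [h _ _ _ _]; exact: h.
- apply/adj_sa => u v; rewrite [RHS]innerJ.
  apply: (ccvg_uniq (SS0 u v)); apply: ccvg_near_eq (ccvgJ (SS0 v u)).
  by apply: filterS hw => t [_ /adj_sa h _ _ _]; rewrite -innerJ -h.
- move=> u; apply: ccvg_ge0 (XX0 u u).
  by apply: filterS hw => t [_ _ h _ _]; exact: h.
- apply: bop_inner_ext => u v.
  apply: (ccvg_uniq (wcvg_ptr _ XX0 u v)); apply: ccvg_near_eq (ww0 u v).
  by apply: filterS hw => t [_ _ _ <- _].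
- move=> u v.
  have h1 : (fun t => \sum_j (2 * Re (inner (amp P (x t j - ptr (b j) (X t)) u) (v j))
        - qf (amp P (w t)) (v j))) @ U -->
      \sum_j (2 * Re (inner (amp P (x0 j - ptr (b j) X0) u) (v j)) - qf (amp P w0) (v j)).
    apply: cvgr_sum => j; apply: cvgB; last by apply: wcvg_qf; exact: wcvg_amp.
    apply: cvgM; first exact: cvg_cst.
    have /(_ u (v j))[] // : wcvg U (fun t => amp P (x t j - ptr (b j) (X t)))
      (amp P (x0 j - ptr (b j) X0)).
    by apply: wcvg_amp; apply: wcvgD => //; apply: wcvgN; exact: wcvg_ptr.
  have h2 : (fun t => qf (S t) u + qf (X t) u) @ U --> qf S0 u + qf X0 u.
    by apply: cvgD; exact: wcvg_qf.
  apply: (cvgr_le_near h1 h2); apply: filterS hw => t [_ _ _ _ h]; exact: h.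
Qed.

End Alaoglu.

(** * The nc majorization function attached to a tuple *)

Section Squares.
Variables (R : realType).
Local Notation C := R[i].

(** The supremum over v of 2 Re <v, w> - |v|^2 is |w|^2, and it is attained at
v = w. *)
Lemma square_bound (J : choiceType) (v w : l2 R J) :
  2 * Re (inner v w) - l2norm v ^+ 2 <= l2norm w ^+ 2.
Proof.
have := sqr_ge0 (l2norm (w - v)).
have -> : l2norm (w - v) ^+ 2 = l2norm w ^+ 2 + l2norm v ^+ 2 - 2 * Re (inner v w).
  have h (u : l2 R J) : l2norm u ^+ 2 = Re (inner u u) by rewrite inner_self.
  rewrite [LHS]h innerBl (innerBr w) (innerBr v) (innerJ v w) !(ReD, ReN) ReJ -(h w) -(h v).
  by move: (Re _) (l2norm w ^+ 2) (l2norm v ^+ 2) => a c d; ring.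
by move: (Re _) (l2norm w ^+ 2) (l2norm v ^+ 2) => a c d; lra.
Qed.

Lemma square_bound_eq (J : choiceType) (v : l2 R J) :
  2 * Re (inner v v) - l2norm v ^+ 2 = l2norm v ^+ 2.
Proof.
have -> : Re (inner v v) = l2norm v ^+ 2 by rewrite inner_self.
by move: (l2norm v ^+ 2) => a; ring.
Qed.

End Squares.

Section Majorization.
Variables (R : realType) (m k : nat) (hm : (0 < m)%N) (b : 'I_k -> 'M[R[i]]_m) (r : R).
Hypothesis r0 : 0 < r.
Local Notation C := R[i].
Local Notation P := 'I_m.

Section Ball.
Variables (n : edim) (x : 'I_k -> opM R n).

Lemma in_nc_ballE : in_nc_ball r x <->
  forall u, \sum_j l2norm ((x j)^\dag u) ^+ 2 <= r ^+ 2 * l2norm u ^+ 2.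
Proof.
have E u : inner (((r ^+ 2)%:C *: bop_id R (idx n) - \sum_(i < k) x i \cdot (x i)^\dag) u) u
    = (r ^+ 2 * l2norm u ^+ 2 - \sum_j l2norm ((x j)^\dag u) ^+ 2)%:C.
  rewrite inner_opP inner_opN inner_self.
  transitivity ((r ^+ 2)%:C * (l2norm u ^+ 2)%:C - (\sum_j l2norm ((x j)^\dag u) ^+ 2)%:C);
    last by rewrite -rmorphM -rmorphB.
  congr (_ - _).
  rewrite bop_sumE inner_suml rmorph_sum; apply: eq_bigr => j _ /=.
  by rewrite -[inner _ u]/(inner (x j ((x j)^\dag u)) u) adjP inner_self.
split=> h u.
  by have := h u; rewrite E ge0c subr_ge0.
by rewrite E ge0c subr_ge0.
Qed.

Lemma in_nc_ball_wball : in_nc_ball r x <-> wball r (bop_id R (idx n)) x.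
Proof.
rewrite in_nc_ballE; split=> [h u v|h u].
  rewrite qf_id; apply: le_trans (h u); apply: ler_sum => j _.
  by rewrite qf_id adjP square_bound.
(* The supremum defining |x_j^* u|^2 is attained at v_j = x_j^* u. *)
have := h u (fun j => (x j)^\dag u); rewrite qf_id; congr (_ <= _).
by apply: eq_bigr => j _; rewrite qf_id adjP square_bound_eq.
Qed.

End Ball.

Section Minimal.
Variable J : choiceType.
Variable x : 'I_k -> bop R J J.
Variable X : bop R (P * J)%type (P * J)%type.
Hypothesis pX : positive X.
Hypothesis X1 : ptr 1%:M X = bop_id R J.

Let z j := x j - ptr (b j) X.

(** The smallest operator S that the choice of X allows above x. *)
Definition Smin : bop R (P * J)%type (P * J)%type :=
  - X + \sum_j (amp P (z j))^\dag \cdot amp P (z j).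

Lemma qf_Smin u : qf Smin u + qf X u = \sum_j l2norm (amp P (z j) u) ^+ 2.
Proof.
rewrite /Smin qfD qfN qf_sum addrAC addNr add0r.
by apply: eq_bigr => j _; rewrite qf_dag.
Qed.

Lemma Smin_sa : Smin^\dag = Smin.
Proof.
rewrite /Smin adjD adjN (positive_sa pX) adj_sum; congr (_ + _).
by apply: eq_bigr => j _; rewrite adj_comp adjK.
Qed.

Lemma wgraph_Smin : wball r (bop_id R J) x -> wgraph b r (bop_id R J) x Smin X.
Proof.
move=> hx; split => //; first exact: Smin_sa.
move=> u v; rewrite qf_Smin; apply: ler_sum => j _.
rewrite amp_id qf_id innerJ ReJ; exact: square_bound.
Qed.

Lemma Smin_le S : wgraph b r (bop_id R J) x S X -> op_le Smin S.
Proof.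
move=> [_ sS _ _ h]; apply/positiveP; split=> [|u].
  by rewrite adjD adjN sS Smin_sa.
(* The supremum defining |z_j u|^2 is attained at v_j = z_j u. *)
have := h u (fun j => amp P (z j) u).
have -> : \sum_j (2 * Re (inner (amp P (x j - ptr (b j) X) u) (amp P (z j) u)) -
    qf (amp P (bop_id R J)) (amp P (z j) u)) = \sum_j l2norm (amp P (z j) u) ^+ 2.
  by apply: eq_bigr => j _; rewrite amp_id qf_id square_bound_eq.
by rewrite -qf_Smin qfD qfN; lra.
Qed.

Lemma amp_norm_le c (T : bop R J J) : 0 <= c -> opbd c T ->
  forall u, l2norm (amp P T u) <= c * l2norm u.
Proof.
move=> c0 Tc u.
rewrite -(@ler_pXn2r _ 2)// ?nnegrE ?mulr_ge0 ?l2norm_ge0//.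
have nE (I : choiceType) (y : l2 R I) : l2norm y ^+ 2 = Re (inner y y).
  by rewrite inner_self.
rewrite exprMn nE (nE _ u) !inner_fibers !Re_sum mulr_sumr; apply: ler_sum => p _.
rewrite -!nE l2_fiber_amp -exprMn ler_pXn2r ?nnegrE ?mulr_ge0 ?l2norm_ge0//.
exact: opbd_norm.
Qed.

Lemma opbd_Smin (beta : R) : 0 <= beta -> (forall j p q, `|b j p q| <= beta%:C) ->
  (forall j, opbd r (x j)) ->
  opbd (m%:R ^+ 2 + \sum_(j < k) (r + m%:R ^+ 2 * beta) ^+ 2) Smin.
Proof.
move=> be0 hb hx.
have qX u : qf (ptr 1%:M X) u <= l2norm u ^+ 2 by rewrite X1 qf_id.
pose c := r + m%:R ^+ 2 * beta.
have c0 : 0 <= c by rewrite addr_ge0 ?mulr_ge0 ?sqr_ge0 ?(ltW r0).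
have hz j : opbd c (z j).
  move=> u v; rewrite inner_opB; apply: le_trans (ler_normB _ _) _.
  rewrite !mulrDl rmorphD; apply: lerD; first exact: hx.
  exact: (opbd_ptr pX qX (hb j)).
move=> u v; rewrite inner_opD !mulrDl rmorphD; apply: le_trans (ler_normD _ _) _.
apply: lerD; first by rewrite inner_opN normrN; exact: (opbd_ptr1 pX qX).
rewrite bop_sumE inner_suml !mulr_suml rmorph_sum/=.
apply: le_trans (ler_norm_sum _ _ _) _; apply: ler_sum => j _.
rewrite -[inner _ v]/(inner ((amp P (z j))^\dag (amp P (z j) u)) v) -adjPr.
apply: le_trans (inner_CS _ _) _; rewrite lecR.
rewrite (_ : _ * _ * _ = (c * l2norm u) * (c * l2norm v)); last by rewrite -/c; ring.
by apply: ler_pM; rewrite ?l2norm_ge0//; exact: amp_norm_le.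
Qed.

End Minimal.

(** The nc majorization function attached to the tuple b: S lies above x when,
for some unital completely positive Theta on m x m matrices with Choi matrix X,
S >= - X + 1 (x) \sum_j z_j^* z_j with z_j = x_j - Theta(b_j). *)
Definition Fmaj : multifun R k (Fin hm) := fun n x =>
  [set S | exists X, wgraph b r (bop_id R (idx n)) x S X].

Lemma Fmaj_nonempty n (x : 'I_k -> opM R n) : in_nc_ball r x -> Fmaj x !=set0.
Proof.
move=> /in_nc_ball_wball hx.
(* The Choi matrix of the normalized trace, seen as a map to the scalars. *)
pose X : bop R (P * idx n)%type (P * idx n)%type := (m%:R^-1 : C) *: bop_id R _.
have XE u v : inner (X u) v = m%:R^-1 * inner u v by rewrite innerZl.
exists (Smin x X), X; apply: wgraph_Smin => //.
  by move=> u; rewrite XE mulr_ge0 ?inner_ge0// invr_ge0 ler0n.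
apply: bop_inner_ext => u v; rewrite inner_ptr1.
under eq_bigr do rewrite XE inner_fiber_in l2_fiber_in eqxx.
rewrite sumr_const card_ord -mulrnAl -[_ *+ m]mulr_natr mulVf ?mul1r//.
by rewrite pnatr_eq0 -lt0n.
Qed.

Lemma Fmaj_unitary_sub n (x : 'I_k -> opM R n) (V : opM R n) : unitary V ->
  forall S, Fmaj x S ->
  Fmaj (fun i => V^\dag \cdot x i \cdot V) (amp P V^\dag \cdot S \cdot amp P V).
Proof.
move=> [VV _] S [X hX]; exists (pull (amp P V) X).
have := wgraph_pull V hX; rewrite /pull adj_amp.
suff -> : V^\dag \cdot bop_id R (idx n) \cdot V = bop_id R (idx n) by [].
by rewrite -[RHS]VV; apply: bop_ext.
Qed.

Lemma bop_compA (J I L M : choiceType) (S : bop R L M) (T : bop R I L) (W : bop R J I) :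
  S \cdot (T \cdot W) = S \cdot T \cdot W.
Proof. exact: bop_ext. Qed.

Lemma bop_comp1 (J I : choiceType) (S : bop R J I) : S \cdot bop_id R J = S.
Proof. exact: bop_ext. Qed.

Lemma bop_1comp (J I : choiceType) (S : bop R J I) : bop_id R I \cdot S = S.
Proof. exact: bop_ext. Qed.

Lemma Fmaj_multivalued : is_multivalued_nc r Fmaj.
Proof.
move=> n x hx; split.
- exact: Fmaj_nonempty.
- by move=> S [X []].
- move=> V uV; have [VV VV'] := uV; apply/seteqP; split; last first.
    by move=> _ [S hS <-]; exact: Fmaj_unitary_sub.
  (* Conjugating back by V^*. *)
  move=> S hS; have uV' : unitary V^\dag by split; rewrite adjK.
  have := Fmaj_unitary_sub uV' hS; rewrite adjK => hT.
  exists (amp P V \cdot S \cdot amp P V^\dag); last first.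
    rewrite !bop_compA -amp_comp VV amp_id bop_1comp.
    by rewrite -bop_compA -amp_comp VV amp_id bop_comp1.
  move: hT; congr (Fmaj _ _); apply/funext => i.
  rewrite !bop_compA VV' bop_1comp.
  by rewrite -bop_compA VV' bop_comp1.
- apply/seteqP; split=> [S hS|_ [S [X [h1 h2 h3 h4 h5]] [T pT <-]]].
    exists S => //; exists 0; last by rewrite addr0.
    by move=> u; rewrite inner0l.
  have [sT qT] := proj1 (positiveP T) pT.
  exists X; split => //; first by rewrite adjD h2 sT.
  move=> u v; apply: le_trans (h5 u v) _.
  by rewrite qfD lerD2r lerDl.
Qed.

Lemma Fmaj_bounded : is_bounded r Fmaj.
Proof.
have [beta be0 hb] : exists2 beta : R, 0 <= beta & forall j p q, `|b j p q| <= beta%:C.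
  have h (z : C) : `|z| = (Re `|z|)%:C /\ 0 <= Re `|z|.
    have := normr_ge0 z; rewrite ge0C => /andP[/eqP i0 h0].
    by split => //; apply: complex_ext; rewrite ?i0.
  exists (\sum_j \sum_p \sum_q Re `|b j p q|).
    by do 3![apply: sumr_ge0 => ? _]; exact: (h _).2.
  move=> j p q; rewrite (h (b j p q)).1 lecR.
  rewrite (bigD1 j)//= (bigD1 p)//= (bigD1 q)//= -!addrA lerDl.
  rewrite !addr_ge0//.
  - by apply: sumr_ge0 => *; exact: (h _).2.
  - by apply: sumr_ge0 => *; apply: sumr_ge0 => *; exact: (h _).2.
  - by apply: sumr_ge0 => *; apply: sumr_ge0 => *; apply: sumr_ge0 => *; exact: (h _).2.
pose lam := m%:R ^+ 2 + \sum_(j < k) (r + m%:R ^+ 2 * beta) ^+ 2 : R.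
have lam0 : 0 <= lam by rewrite addr_ge0 ?sqr_ge0// sumr_ge0// => *; exact: sqr_ge0.
exists (lam + 1); first by rewrite ltr_wpDl.
move=> n x hx S [X hX]; exists (Smin x X); have [h1 h2 h3 h4 h5] := hX; split.
- by exists X; apply: wgraph_Smin.
- exact: Smin_le.
- apply: le_trans (_ : lam <= _); last by rewrite lerDl.
  apply: opbd_opnorm => //; apply: opbd_Smin => // j.
  move=> u v; rewrite adjP.
  have /(_ v) hn : forall v, l2norm ((x j)^\dag v) <= r * l2norm v.
    move=> w; rewrite -(@ler_pXn2r _ 2)// ?nnegrE ?mulr_ge0 ?l2norm_ge0 ?(ltW r0)//.
    rewrite exprMn; apply: le_trans (proj1 (in_nc_ballE x) hx w).
    by rewrite (bigD1 j)//= lerDl sumr_ge0// => *; exact: sqr_ge0.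
  apply: le_trans (inner_CS _ _) _; rewrite lecR.
  by rewrite (mulrC r) -mulrA ler_wpM2l ?l2norm_ge0.
Qed.

Lemma Fmaj_graph n (x : 'I_k -> opM R n) S :
  @graph R k r (Fin hm) Fmaj n (x, S) <-> exists X, wgraph b r (bop_id R (idx n)) x S X.
Proof.
split=> [[_ //]|[X hX]]; split; last by exists X.
by apply/in_nc_ball_wball; have [] := hX.
Qed.

Lemma Fmaj_lsc : is_lsc r Fmaj.
Proof.
move=> n; rewrite /closed closureEcvg.
move=> [x S] [G PG [Gz EG]].
have [U [UU GU]] := ultraFilterLemma PG.
have Uz : U --> (x, S) by move=> A /Gz /GU.
apply/Fmaj_graph.
apply: (@wgraph_lim R _ U UU m k b r (idx n) (fun=> bop_id R (idx n)) (fun z => z.1) (fun z => z.2)).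
- apply: GU; apply: EG => -[y T] /Fmaj_graph h; split => // u.
  by rewrite qf_id.
- by move=> u v; exact: ccvg_cst.
- move=> j; apply: weakstar_wcvg.
  have h1 : (fun z : prod_topology (fun _ : 'I_k => opM R n) * opMM R (Fin hm) n => z.1) @ U --> x.
    by apply: cvg_comp Uz _; exact: cvg_fst.
  exact: (cvg_comp _ _ h1 (@proj_continuous _ (fun=> opM R n) j _)).
- apply: weakstar_wcvg; apply: (cvg_comp _ _ Uz); exact: cvg_snd.
Qed.

Lemma Fmaj_convex : is_nc_convex r Fmaj.
Proof.
move=> n d x T al hx _ al1 y S hy hS; apply/Fmaj_graph.
have [U [UU ooU]] := ultraFilterLemma (@eventually_filter).
have cvgU (V : topologicalType) (f : nat -> V) (l : V) : f @ \oo --> l -> f @ U --> l.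
  by move=> h A /h hA; apply: ooU.
have hX' i : exists X, wgraph b r (bop_id R (idx (d i))) (x i) (T i) X.
  by apply/Fmaj_graph.
pose X i := sval (cid (hX' i)).
have hX i : wgraph b r (bop_id R (idx (d i))) (x i) (T i) (X i) := svalP (cid (hX' i)).
have wE i : pull (al i) (bop_id R (idx (d i))) = (al i)^\dag \cdot al i by exact: bop_ext.
have w0 := weakstar_wcvg (cvgU _ _ _ al1).
(* The partial sums of \sum_i al_i^* al_i increase to 1, so they are at most 1. *)
have wmono u : (fun N => qf (\sum_(i < N) (al i)^\dag \cdot al i) u) @ \oo --> l2norm u ^+ 2.
  by rewrite -qf_id; exact: (weakstar_wcvg al1 u u).1.
apply: (@wgraph_lim R _ U UU m k b r (idx n)
   (fun N => \sum_(i < N) (al i)^\dag \cdot al i)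
   (fun N j => \sum_(i < N) (al i)^\dag \cdot x i j \cdot al i)
   (fun N => \sum_(i < N) amp P (al i)^\dag \cdot T i \cdot amp P (al i))).
- apply: filterE => N; split.
    exists (\sum_(i < N) pull (amp P (al i)) (X i)).
    have := wgraph_sum N (fun i => wgraph_pull (al i) (hX i)).
    rewrite (eq_bigr (fun i : 'I_N => (al i)^\dag \cdot al i)) => [|i _]; last exact: wE.
    rewrite [X in wgraph _ _ _ _ X _](eq_bigr (fun i : 'I_N =>
      amp P (al i)^\dag \cdot T i \cdot amp P (al i))) => [//|i _].
    by rewrite /pull adj_amp.
  move=> u; apply: (cvgr_le_near (cvg_cst _) (wmono u)).
  near=> M; have NM : (N <= M)%N by near: M; exact: nbhs_infty_ge.
  rewrite !qf_sum -(big_mkord xpredT (fun i => qf ((al i)^\dag \cdot al i) u)).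
  rewrite -(big_mkord xpredT (fun i => qf ((al i)^\dag \cdot al i) u)).
  rewrite (big_cat_nat (leq0n N) NM)//= lerDl sumr_ge0// => i _.
  by rewrite qf_dag sqr_ge0.
- exact: w0.
- by move=> j; apply: weakstar_wcvg; apply: cvgU; exact: hy.
- by apply: weakstar_wcvg; apply: cvgU; exact: hS.
Unshelve. all: by end_near. Qed.

Lemma Fmaj_majorization : nc_majorization_function r Fmaj.
Proof.
split; [exact: Fmaj_multivalued|exact: Fmaj_bounded|exact: Fmaj_lsc|exact: Fmaj_convex].
Qed.

End Majorization.

(** * Matrices as operators, and Gram kernels *)

Section Coordinates.
Variable R : realType.
Local Notation C := R[i].

Lemma sum_delta (T : finType) (F : T -> C) i : \sum_j F j * (j == i)%:R = F i.
Proof.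
rewrite (bigD1 i)//= eqxx mulr1 big1 ?addr0// => j /negbTE ->.
by rewrite mulr0.
Qed.

Lemma ebasis_sum n (u : l2 R 'I_n) : u = \sum_i u i *: ebasis R i.
Proof.
apply/val_inj/funext => i; symmetry.
by apply: linE; [exact: index_enum_uniq|exact: mem_index_enum].
Qed.

Lemma inner_ord n (u v : l2 R 'I_n) : inner u v = \sum_i u i * (v i)^*.
Proof. by rewrite {1}[u]ebasis_sum inner_lin. Qed.

Lemma bop_ebasis_ext n (I : choiceType) (S T : bop R 'I_n I) :
  (forall i, S (ebasis R i) = T (ebasis R i)) -> S = T.
Proof.
move=> h; apply: bop_ext => u; rewrite [u]ebasis_sum !linear_sum.
by apply: eq_bigr => i _; rewrite !linearZ; congr (_ *: _); exact: h.
Qed.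

Lemma mx_opE n (A : 'M[C]_n) u i : mx_op A u i = \sum_j A i j * u j.
Proof. by []. Qed.

Lemma inner_mx_op n (A : 'M[C]_n) u v :
  inner (mx_op A u) v = \sum_i \sum_j A i j * (u j * (v i)^*).
Proof.
rewrite inner_ord; apply: eq_bigr => i _; rewrite mx_opE mulr_suml.
by apply: eq_bigr => j _; rewrite mulrA.
Qed.

Lemma ebasisE (I : choiceType) (i j : I) : ebasis R i j = (j == i)%:R.
Proof. by []. Qed.

Lemma mx_op_entry n (A : 'M[C]_n) i j :
  inner (mx_op A (ebasis R j)) (ebasis R i) = A i j.
Proof.
by rewrite inner_ebasis mx_opE; under eq_bigr do rewrite ebasisE; exact: sum_delta.
Qed.

(** The operator u |-> <u, eta> xi. *)
Lemma rank1_ex (J I : choiceType) (xi : l2 R I) (eta : l2 R J) :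
  exists T : bop R J I, forall u v, inner (T u) v = inner u eta * inner xi v.
Proof.
apply: (@riesz _ _ _ (fun u v => inner u eta * inner xi v) (l2norm eta * l2norm xi)).
- by move=> a u v w; rewrite innerPl mulrDl mulrA.
- by move=> a u v w; rewrite innerDr innerZr mulrDr mulrCA.
- by rewrite mulr_ge0 ?l2norm_ge0.
- move=> u v; rewrite normrM.
  have -> : l2norm eta * l2norm xi * l2norm u * l2norm v =
      (l2norm u * l2norm eta) * (l2norm xi * l2norm v) by ring.
  by rewrite rmorphM; apply: ler_pM => //; exact: inner_CS.
Qed.

Definition rank1 (J I : choiceType) (xi : l2 R I) (eta : l2 R J) : bop R J I :=
  sval (cid (rank1_ex xi eta)).

Lemma inner_rank1 (J I : choiceType) (xi : l2 R I) (eta : l2 R J) u v :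
  inner (rank1 xi eta u) v = inner u eta * inner xi v.
Proof. exact: (svalP (cid (rank1_ex xi eta))). Qed.

(** The operator of a rectangular matrix. *)
Definition rect_op m n (K : 'M[C]_(m, n)) : bop R 'I_n 'I_m :=
  \sum_p \sum_i K p i *: rank1 (ebasis R p) (ebasis R i).

Lemma rect_opE m n (K : 'M[C]_(m, n)) u p : rect_op K u p = \sum_i K p i * u i.
Proof.
rewrite -inner_ebasis /rect_op bop_sumE inner_suml.
transitivity (\sum_q (\sum_i K q i * u i) * (q == p)%:R); last exact: sum_delta.
apply: eq_bigr => q _; rewrite bop_sumE inner_suml mulr_suml; apply: eq_bigr => i _.
by rewrite [LHS]innerZl inner_rank1 !inner_ebasis ebasisE eq_sym mulrA.
Qed.

Lemma rect_op_adjE m n (K : 'M[C]_(m, n)) u i :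
  (rect_op K)^\dag u i = \sum_p (K p i)^* * u p.
Proof.
rewrite -inner_ebasis -adjPr inner_ord; apply: eq_bigr => p _.
rewrite rect_opE; under eq_bigr do rewrite ebasisE.
by rewrite sum_delta mulrC.
Qed.

End Coordinates.

Section Gram.
Variable R : realType.
Local Notation C := R[i].

(** Positive semidefinite kernels on a finite type. *)
Definition psdfun (T : finType) (A : T -> T -> C) : Prop :=
  forall y : T -> C, 0 <= \sum_s \sum_t (y s)^* * A s t * y t.

(* Positive matrices are Hermitian, as positive operators are. *)
Let herm_of_psd n (A : 'M[C]_n) : psdfun (fun i j => A i j) -> forall i j, A i j = (A j i)^*.
Proof.
move=> hA i j; have pA : positive (mx_op A).
  move=> u; rewrite inner_mx_op; have := hA u; congr (0 <= _).
  by apply: eq_bigr => s _; apply: eq_bigr => t _; ring.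
rewrite -(mx_op_entry A i) -(mx_op_entry A j) adjP (positive_sa pA).
exact: innerJ.
Qed.

(** Every positive semidefinite kernel is a Gram kernel. *)
Lemma gram (T : finType) (A : T -> T -> C) : psdfun A ->
  exists (N : nat) (K : 'I_N -> T -> C), forall s t, A s t = \sum_l K l s * (K l t)^*.
Proof.
move=> hA; pose n := #|T|.
pose M : 'M[C]_n := \matrix_(i, j) A (enum_val i) (enum_val j).
have hM : psdfun (fun i j => M i j).
  move=> y; have := hA (fun s => y (enum_rank s)); congr (0 <= _).
  rewrite (reindex _ (onW_bij _ (enum_val_bij T))); apply: eq_bigr => i _.
  rewrite (reindex _ (onW_bij _ (enum_val_bij T))); apply: eq_bigr => j _ /=.
  by rewrite !enum_valK mxE.
have MH : M \is hermsymmx.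
  apply/is_hermitianmxP; rewrite expr0 scale1r; apply/matrixP => i j.
  by rewrite [LHS](herm_of_psd hM) !mxE.
have /orthomx_spectralP := hermitian_normalmx MH.
set P := spectralmx M; set d := spectral_diag M => Meq.
have PU : P \is unitarymx := spectral_unitarymx M.
rewrite (invmx_unitary PU) in Meq.
have ME i j : M i j = \sum_l (P l i)^* * d 0 l * P l j.
  rewrite Meq mxE; apply: eq_bigr => l _; rewrite mxE (bigD1 l)//= big1 ?addr0 => [|q /negbTE ql].
    by rewrite !mxE eqxx mulr1n.
  by rewrite !mxE ql mulr0n mulr0.
have d0 l : 0 <= d 0 l.
  have := hM (fun i => (P l i)^*); congr (0 <= _).
  have PP a c : \sum_i P a i * (P c i)^* = (a == c)%:R.
    have /unitarymxP/matrixP/(_ a c) := PU; rewrite !mxE => <-.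
    by apply: eq_bigr => i _; rewrite !mxE.
  transitivity (\sum_i \sum_j \sum_q (P l i * (P q i)^*) * d 0 q * (P q j * (P l j)^*)).
    apply: eq_bigr => i _; apply: eq_bigr => j _; rewrite conjCK ME mulr_sumr mulr_suml.
    by apply: eq_bigr => q _; ring.
  transitivity (\sum_q (\sum_i P l i * (P q i)^*) * d 0 q * (\sum_j P q j * (P l j)^*)).
    rewrite [RHS](_ : _ = \sum_q \sum_i \sum_j (P l i * (P q i)^*) * d 0 q * (P q j * (P l j)^*)).
      rewrite [RHS]exchange_big; apply: eq_bigr => i _; exact: exchange_big.
    apply: eq_bigr => q _; rewrite !mulr_suml; apply: eq_bigr => i _.
    by rewrite mulr_sumr.
  rewrite (bigD1 l)//= !PP eqxx mul1r mulr1 big1 ?addr0// => q /negbTE ql.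
  by rewrite !PP eq_sym ql !mul0r.
(* M = P^* diag(d) P with d >= 0; the rows of P are rescaled by sqrt d. *)
exists n, (fun l s => sqrtC (d 0 l) * (P l (enum_rank s))^*) => s t.
have := ME (enum_rank s) (enum_rank t); rewrite mxE !enum_rankK => ->.
apply: eq_bigr => l _; rewrite [(_ * _)^*]rmorphM /= conjCK.
have -> : (sqrtC (d 0 l))^* = sqrtC (d 0 l) by apply/CrealP; rewrite ger0_real ?sqrtC_ge0.
by rewrite -{1}[d 0 l]sqrtCK expr2; ring.
Qed.

(** Positivity of a block matrix, as positivity of a kernel indexed by pairs. *)
Lemma psd_block q n (A : 'I_q -> 'I_q -> 'M[C]_n) :
  psdmx (\mxblock_(i < q, j < q) A i j) <->
  psdfun (fun s t : 'I_q * 'I_n => A s.1 t.1 s.2 t.2).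
Proof.
have E (c : 'I_q -> 'cV[C]_n) :
    ((map_mx conjc (\mxcol_i c i))^T *m (\mxblock_(i < q, j < q) A i j) *m \mxcol_i c i) 0 0
    = \sum_(s : 'I_q * 'I_n) \sum_(t : 'I_q * 'I_n)
        (c s.1 s.2 0)^* * A s.1 t.1 s.2 t.2 * c t.1 t.2 0.
  have -> : (map_mx conjc (\mxcol_i c i))^T = \mxrow_i (map_mx conjc (c i))^T.
    by apply/matrixP => i j; rewrite !mxE.
  rewrite mul_mxrow_mxblock mul_mxrow_mxcol summxE.
  transitivity (\sum_t \sum_s \sum_j \sum_i (c s i 0)^* * A s t i j * c t j 0).
    apply: eq_bigr => t _; rewrite mulmx_suml summxE; apply: eq_bigr => s _.
    rewrite mxE; apply: eq_bigr => j _; rewrite mxE mulr_suml; apply: eq_bigr => i _.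
    by rewrite !mxE.
  rewrite exchange_big -(pair_bigA _ (fun s i => \sum_(t : 'I_q * 'I_n)
        (c s i 0)^* * A s t.1 i t.2 * c t.1 t.2 0)); apply: eq_bigr => s _ /=.
  rewrite [LHS](_ : _ = \sum_t \sum_i \sum_j (c s i 0)^* * A s t i j * c t j 0).
    rewrite exchange_big; apply: eq_bigr => i _.
    by rewrite -(pair_bigA _ (fun t j => (c s i 0)^* * A s t i j * c t j 0)).
  by apply: eq_bigr => t _; rewrite exchange_big.
split=> [h y|h v].
  have := h (\mxcol_s (\col_i y (s, i))); rewrite E; congr (0 <= _).
  apply: eq_bigr => -[s i] _; apply: eq_bigr => -[t j] _.
  by rewrite !mxE.
rewrite -[v](@submxcolK _ _ (fun=> n)) E.
exact: (h (fun s => submxcol v s.1 s.2 0)).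
Qed.

End Gram.

(** * Kraus families and the state omega *)

Section Weights.
Variables (R : realType) (n1 n2 : nat).
Hypothesis (hn1 : (0 < n1)%N) (hn2 : (0 < n2)%N).
Local Notation C := R[i].

(** The weights of the diagonal state omega. *)
Definition wt (p : 'I_(n2 + 1)) : C :=
  match fintype.split p with inl _ => n1%:R^-1 * n2%:R^-1 | inr _ => (n1%:R - 1) / n1%:R end.

Lemma split_lshift (p : 'I_n2) : fintype.split (lshift 1 p) = inl p.
Proof. exact: (@unsplitK n2 1 (inl p)). Qed.

Lemma split_rshift (p : 'I_1) : fintype.split (rshift n2 p) = inr p.
Proof. exact: (@unsplitK n2 1 (inr p)). Qed.

Lemma omega_delta p q : @omega R n1 n2 (delta_mx p q) = (p == q)%:R * wt p.
Proof.
rewrite /omega /wt; under eq_bigr do rewrite mxE; rewrite mxE.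
case: (split_ordP p) => [i ->|i ->]; case: (split_ordP q) => [j ->|j ->].
- rewrite eq_rlshift mulr0 addr0 eq_lshift.
  under eq_bigr => l _ do rewrite !eq_lshift -mulnb natrM mulrC.
  by rewrite (sum_delta (fun l => (l == j)%:R)) mulrA [RHS]mulrC.
- rewrite eq_lrshift eq_rlshift mul0r mulr0 addr0 big1 ?mulr0// => l _.
  by rewrite eq_lrshift andbF.
- rewrite [rshift n2 i == _]eq_rlshift mul0r.
  rewrite [rshift n2 0 == lshift 1 j]eq_rlshift andbF mulr0 addr0.
  by rewrite big1 ?mulr0// => l _; rewrite eq_lrshift.
- rewrite !eq_rshift !ord1 eqxx mul1r mulr1.
  by rewrite big1 ?mulr0 ?add0r// => l _; rewrite eq_lrshift.
Qed.

End Weights.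

Section L2Sums.
Variable R : realType.
Local Notation C := R[i].

Lemma ntr_delta n (i j : 'I_n) : ntr (delta_mx i j : 'M[C]_n) = n%:R^-1 * (i == j)%:R.
Proof.
rewrite /ntr /mxtrace; under eq_bigr do rewrite mxE -mulnb natrM mulrC.
by rewrite (sum_delta (fun l => (l == j)%:R)).
Qed.

Lemma l2_sumE (I : choiceType) K (s : seq K) (Q : pred K) (f : K -> l2 R I) i :
  (\sum_(k <- s | Q k) f k) i = \sum_(k <- s | Q k) f k i.
Proof.
rewrite -inner_ebasis inner_suml; apply: eq_bigr => k _; exact: inner_ebasis.
Qed.

Lemma id_tensorE (P : choiceType) n (phi : 'M[C]_n -> C) T (w : l2 R P) p :
  id_tensor phi T w p =
  \sum_i \sum_j phi (delta_mx i j) * T (slice_in R P j w) (p, i).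
Proof.
rewrite /id_tensor bop_sumE l2_sumE; apply: eq_bigr => i _.
by rewrite bop_sumE l2_sumE; apply: eq_bigr => j _.
Qed.

Lemma amp_rect_slice (P : choiceType) m n (K : 'M[C]_(m, n)) j (w : l2 R P) :
  amp P (rect_op K) (slice_in R P j w) = \sum_q K q j *: slice_in R P q w.
Proof.
apply/val_inj/funext => -[p i].
rewrite -[RHS]/((\sum_q K q j *: slice_in R P q w) (p, i)) l2_sumE.
rewrite -[LHS]/(rect_op K (l2_fiber (slice_in R P j w) p) i) rect_opE.
transitivity (\sum_l (K i l * w p) * (l == j)%:R).
  apply: eq_bigr => l _; rewrite -[l2_fiber _ _ _]/(if l == j then w p else 0).
  by case: eqP; rewrite ?mulr1 ?mulr0.
rewrite sum_delta; transitivity (\sum_q (K q j * w p) * (q == i)%:R); first by rewrite sum_delta.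
apply: eq_bigr => q _; rewrite -[RHS]/(K q j * (if i == q then w p else 0)).
by rewrite eq_sym; case: eqP; rewrite ?mulr1 ?mulr0.
Qed.

Lemma amp_rect_adj (P : choiceType) m n (K : 'M[C]_(m, n)) (x : l2 R (P * 'I_m)%type) p i :
  amp P (rect_op K)^\dag x (p, i) = \sum_q (K q i)^* * x (p, q).
Proof. exact: (rect_op_adjE K (l2_fiber x p) i). Qed.

Lemma mx_op1 n : mx_op (1%:M : 'M[C]_n) = bop_id R 'I_n.
Proof.
apply: bop_ext => u; apply/val_inj/funext => i.
rewrite -[LHS]/(mx_op 1%:M u i) mx_opE -[RHS](sum_delta (fun j => u j) i).
by apply: eq_bigr => j _; rewrite mxE mulrC eq_sym.
Qed.

(** The map X |-> \sum_l K_l^* X K_l has the blocks M_pq as the images of the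
matrix units E_pq. *)
Lemma kraus_mx N m n (K : 'I_N -> 'M[C]_(m, n)) (M : 'I_m -> 'I_m -> 'M[C]_n) :
  (forall p q i j, M p q i j = \sum_l (K l p i)^* * K l q j) ->
  forall B : 'M[C]_m,
  \sum_l (rect_op (K l))^\dag \cdot mx_op B \cdot rect_op (K l) =
  mx_op (\sum_p \sum_q B p q *: M p q).
Proof.
move=> hM B; apply: bop_ext => u; apply/val_inj/funext => i.
rewrite bop_sumE -[LHS]/((\sum_l ((rect_op (K l))^\dag \cdot mx_op B \cdot rect_op (K l)) u) i).
rewrite l2_sumE -[RHS]/(mx_op (\sum_p \sum_q B p q *: M p q) u i) mx_opE.
transitivity (\sum_l \sum_p \sum_q \sum_j (K l p i)^* * (B p q * (K l q j * u j))).
  apply: eq_bigr => l _.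
  rewrite -[LHS]/((rect_op (K l))^\dag (mx_op B (rect_op (K l) u)) i) rect_op_adjE.
  apply: eq_bigr => p _; rewrite mx_opE mulr_sumr; apply: eq_bigr => q _.
  by rewrite rect_opE !mulr_sumr.
transitivity (\sum_j \sum_p \sum_q \sum_l (K l p i)^* * (B p q * (K l q j * u j))).
  rewrite exchange_big [RHS]exchange_big; apply: eq_bigr => p _.
  rewrite exchange_big [RHS]exchange_big; apply: eq_bigr => q _.
  exact: exchange_big.
apply: eq_bigr => j _; rewrite summxE mulr_suml; apply: eq_bigr => p _.
rewrite summxE mulr_suml; apply: eq_bigr => q _.
by rewrite mxE hM mulr_sumr mulr_suml; apply: eq_bigr => l _; ring.
Qed.

(** If phi(M_pq) = om(E_pq), slicing the image under 1 (x) K by phi amounts to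
slicing by om. *)
Lemma kraus_id_tensor (P : choiceType) N m n (K : 'I_N -> 'M[C]_(m, n))
    (M : 'I_m -> 'I_m -> 'M[C]_n) (phi : 'M[C]_n -> C) (om : 'M[C]_m -> C) :
  (forall p q i j, M p q i j = \sum_l (K l p i)^* * K l q j) ->
  (forall p q, \sum_i \sum_j phi (delta_mx i j) * M p q i j = om (delta_mx p q)) ->
  forall T : bop R (P * 'I_m)%type (P * 'I_m)%type,
  id_tensor phi (\sum_l amp P (rect_op (K l))^\dag \cdot T \cdot amp P (rect_op (K l))) =
  id_tensor om T.
Proof.
move=> hM hphi T; apply: bop_ext => w; apply/val_inj/funext => s.
rewrite -[LHS]/(id_tensor _ _ w s) -[RHS]/(id_tensor _ _ w s) !id_tensorE.
transitivity (\sum_i \sum_j \sum_l \sum_p \sum_q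
   phi (delta_mx i j) * ((K l p i)^* * (K l q j * T (slice_in R P q w) (s, p)))).
  apply: eq_bigr => i _; apply: eq_bigr => j _.
  rewrite bop_sumE l2_sumE mulr_sumr; apply: eq_bigr => l _.
  rewrite -[X in _ * X]/(amp P (rect_op (K l))^\dag (T (amp P (rect_op (K l)) (slice_in R P j w))) (s, i)).
  rewrite amp_rect_adj mulr_sumr; apply: eq_bigr => p _.
  rewrite amp_rect_slice linear_sum l2_sumE !mulr_sumr; apply: eq_bigr => q _.
  by rewrite linearZ.
transitivity (\sum_p \sum_q \sum_i \sum_j \sum_l
   phi (delta_mx i j) * ((K l p i)^* * (K l q j * T (slice_in R P q w) (s, p)))).
  rewrite [RHS](_ : _ = \sum_i \sum_p \sum_q \sum_j \sum_l
     phi (delta_mx i j) * ((K l p i)^* * (K l q j * T (slice_in R P q w) (s, p)))); last first.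
    by rewrite [RHS]exchange_big; apply: eq_bigr => p _; exact: exchange_big.
  apply: eq_bigr => i _.
  rewrite [RHS](_ : _ = \sum_j \sum_p \sum_q \sum_l
     phi (delta_mx i j) * ((K l p i)^* * (K l q j * T (slice_in R P q w) (s, p)))); last first.
    by rewrite [RHS]exchange_big; apply: eq_bigr => p _; exact: exchange_big.
  apply: eq_bigr => j _; rewrite exchange_big; apply: eq_bigr => p _; exact: exchange_big.
apply: eq_bigr => p _; apply: eq_bigr => q _; rewrite -hphi mulr_suml.
apply: eq_bigr => i _; rewrite mulr_suml; apply: eq_bigr => j _.
by rewrite hM mulr_sumr mulr_suml; apply: eq_bigr => l _; ring.
Qed.

End L2Sums.

(** * From a completely positive map to majorization *)

Section PairSums.
Variable R : realType.
Local Notation C := R[i].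

Lemma psdfun_pair (I J : finType) (A : I -> I -> J -> J -> C) :
  psdfun (fun s t : I * J => A s.1 t.1 s.2 t.2) <->
  forall y : I -> J -> C,
    0 <= \sum_p \sum_q \sum_i \sum_j (y p i)^* * A p q i j * y q j.
Proof.
have E (y : I -> J -> C) :
    \sum_(s : I * J) \sum_(t : I * J) (y s.1 s.2)^* * A s.1 t.1 s.2 t.2 * y t.1 t.2 =
    \sum_p \sum_q \sum_i \sum_j (y p i)^* * A p q i j * y q j.
  rewrite -(pair_bigA _ (fun p i => \sum_(t : I * J)
    (y p i)^* * A p t.1 i t.2 * y t.1 t.2)); apply: eq_bigr => p _.
  rewrite [RHS]exchange_big; apply: eq_bigr => i _ /=.
  by rewrite -(pair_bigA _ (fun q j => (y p i)^* * A p q i j * y q j)).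
split=> h y; first by have := h (fun s => y s.1 s.2); rewrite E.
have := h (fun p i => y (p, i)); rewrite -E; congr (0 <= _).
by apply: eq_bigr => -[p i] _; apply: eq_bigr => -[q j] _.
Qed.

(** A positive semidefinite matrix is at most its trace. *)
Lemma psd_le_trace n (H : 'M[C]_n) : psdfun (fun i j => H i j) ->
  forall y : 'I_n -> C,
  \sum_i \sum_j (y i)^* * H i j * y j <= \tr H * \sum_i (y i)^* * y i.
Proof.
move=> /gram[N [K hK]] y.
have -> : \sum_i \sum_j (y i)^* * H i j * y j =
    \sum_l `|\sum_i K l i * (y i)^*| ^+ 2.
  transitivity (\sum_l \sum_i \sum_j (K l i * (y i)^*) * (K l j * (y j)^*)^*).
    rewrite [RHS]exchange_big; apply: eq_bigr => i _.
    rewrite [RHS]exchange_big; apply: eq_bigr => j _.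
    rewrite hK mulr_sumr mulr_suml; apply: eq_bigr => l _.
    by rewrite [(_ * _)^*]rmorphM /= conjCK; ring.
  apply: eq_bigr => l _; rewrite normCK rmorph_sum mulr_suml.
  by apply: eq_bigr => i _; rewrite mulr_sumr.
have -> : \tr H = \sum_l \sum_i K l i * (K l i)^*.
  by rewrite [RHS]exchange_big; apply: eq_bigr => i _; rewrite hK.
rewrite mulr_suml; apply: ler_sum => l _.
pose B (u v : 'rV[C]_n) : C := \sum_i u 0 i * (v 0 i)^*.
have := @form_CS R 'rV[C]_n B _ _ _ (\row_i K l i) (\row_i y i).
rewrite /B; under eq_bigr => i _ do rewrite !mxE.
under [X in _ <= X * _]eq_bigr => i _ do rewrite !mxE.
under [X in _ <= _ * X]eq_bigr => i _ do rewrite !mxE mulrC.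
apply.
- move=> c u v w; rewrite mulr_sumr -big_split; apply: eq_bigr => i _.
  by rewrite !mxE /=; ring.
- move=> u v; rewrite rmorph_sum; apply: eq_bigr => i _ /=.
  by rewrite [(_ * _)^*]rmorphM /= conjCK mulrC.
- by move=> u; apply: sumr_ge0 => i _; exact: mul_conjC_ge0.
Qed.

End PairSums.

Section Sufficiency.
Variables (R : realType) (n1 n2 : nat).
Hypothesis (hn1 : (0 < n1)%N) (hn2 : (0 < n2)%N).
Local Notation C := R[i].
Variable Phi : {linear 'M[C]_n2 -> 'M[C]_n1}.
Hypothesis PhiCP : completely_positive Phi.
Hypothesis Phitr : forall X, ntr (Phi X) = ntr X.

Let n1C : (n1%:R : C) != 0. Proof. by rewrite pnatr_eq0 -lt0n. Qed.
Let n2C : (n2%:R : C) != 0. Proof. by rewrite pnatr_eq0 -lt0n. Qed.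

(** The images of the matrix units under the unital completely positive map
X |-> Phi(X_11) / n1 + X_22 (1 - Phi(1) / n1), where X_11 is the upper left
n2 x n2 block of X and X_22 its last diagonal entry. *)
Definition theta (p q : 'I_(n2 + 1)) : 'M[C]_n1 :=
  match fintype.split p, fintype.split q with
  | inl p', inl q' => n1%:R^-1 *: Phi (delta_mx p' q')
  | inr _, inr _ => 1%:M - n1%:R^-1 *: Phi 1%:M
  | _, _ => 0
  end.

Lemma theta_ll p q : theta (lshift 1 p) (lshift 1 q) = n1%:R^-1 *: Phi (delta_mx p q).
Proof. by rewrite /theta !split_lshift. Qed.
Lemma theta_lr p q : theta (lshift 1 p) (rshift n2 q) = 0.
Proof. by rewrite /theta split_lshift split_rshift. Qed.
Lemma theta_rl p q : theta (rshift n2 q) (lshift 1 p) = 0.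
Proof. by rewrite /theta split_lshift split_rshift. Qed.
Lemma theta_rr p q : theta (rshift n2 q) (rshift n2 p) = 1%:M - n1%:R^-1 *: Phi 1%:M.
Proof. by rewrite /theta !split_rshift. Qed.

Lemma sum_theta (B : 'M[C]_(n2 + 1)) :
  \sum_p \sum_q B p q *: theta p q =
  n1%:R^-1 *: Phi (ulsubmx B) + B (rshift n2 0) (rshift n2 0) *: (1%:M - n1%:R^-1 *: Phi 1%:M).
Proof.
rewrite big_split_ord /=; congr (_ + _).
  rewrite [in RHS](matrix_sum_delta (ulsubmx B)) linear_sum scaler_sumr.
  apply: eq_bigr => p _; rewrite big_split_ord /= [X in _ + X]big1 => [|q _].
    rewrite addr0 linear_sum scaler_sumr; apply: eq_bigr => q _.
    rewrite theta_ll !mxE [Phi (_ *: _)]linearZ /= !scalerA.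
    by congr (_ *: _); exact: mulrC.
  by rewrite theta_lr scaler0.
rewrite big_ord1 big_split_ord /= big1 => [|q _].
  by rewrite add0r big_ord1 theta_rr.
by rewrite theta_rl scaler0.
Qed.

Lemma Phi1_psd : psdfun (fun i j => Phi 1%:M i j).
Proof.
have h : psdmx (\mxblock_(i < 1, j < 1) (1%:M : 'M[C]_n2)).
  apply/psd_block; apply/(psdfun_pair (fun p q i j => (1%:M : 'M[C]_n2) i j)) => y.
  rewrite !big_ord1; apply: sumr_ge0 => i _; rewrite (bigD1 i)//= big1 ?addr0.
    by rewrite mxE eqxx mulr1 mulrC; exact: mul_conjC_ge0.
  by move=> j /negbTE ji; rewrite mxE eq_sym ji mulr0 mul0r.
have := PhiCP h; move/psd_block/(psdfun_pair (fun p q i j => Phi 1%:M i j)) => h' y.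
by have := h' (fun=> y); rewrite !big_ord1.
Qed.

(** The Choi matrix of Phi is positive. *)
Lemma Phi_choi_psd (y : 'I_n2 -> 'I_n1 -> C) :
  0 <= \sum_p \sum_q \sum_i \sum_j (y p i)^* * Phi (delta_mx p q) i j * y q j.
Proof.
have h : psdmx (\mxblock_(p < n2, q < n2) (delta_mx p q : 'M[C]_n2)).
  apply/psd_block; apply/(psdfun_pair (fun p q i j => (delta_mx p q : 'M[C]_n2) i j)) => z.
  have -> : \sum_p \sum_q \sum_i \sum_j (z p i)^* * (delta_mx p q : 'M[C]_n2) i j * z q j =
      (\sum_q z q q) * (\sum_p z p p)^*.
    rewrite mulrC rmorph_sum mulr_suml; apply: eq_bigr => p _.
    rewrite mulr_sumr; apply: eq_bigr => q _.
    transitivity (\sum_i (\sum_j ((z p i)^* * z q j) * (j == q)%:R) * (i == p)%:R).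
      apply: eq_bigr => i _; rewrite mulr_suml; apply: eq_bigr => j _.
      by rewrite mxE -mulnb natrM; ring.
    by rewrite sum_delta sum_delta.
  exact: mul_conjC_ge0.
by have := PhiCP h; move/psd_block/(psdfun_pair (fun p q i j => Phi (delta_mx p q) i j)).
Qed.

Lemma theta_psd : psdfun (fun s t : 'I_(n2 + 1) * 'I_n1 => theta s.1 t.1 s.2 t.2).
Proof.
apply/(psdfun_pair (fun p q i j => theta p q i j)) => y; rewrite big_split_ord /=; apply: addr_ge0.
  have -> : \sum_p \sum_q \sum_i \sum_j
       (y (lshift 1 p) i)^* * theta (lshift 1 p) q i j * y q j =
     n1%:R^-1 * \sum_p \sum_q \sum_i \sum_j
       (y (lshift 1 p) i)^* * Phi (delta_mx p q) i j * y (lshift 1 q) j.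
    rewrite mulr_sumr; apply: eq_bigr => p _; rewrite big_split_ord /= [X in _ + X]big1 => [|q _].
      rewrite addr0 mulr_sumr; apply: eq_bigr => q _; rewrite mulr_sumr; apply: eq_bigr => i _.
      rewrite mulr_sumr; apply: eq_bigr => j _; rewrite theta_ll mxE; ring.
    by rewrite theta_lr big1// => i _; rewrite big1// => j _; rewrite mxE mulr0 mul0r.
  by apply: mulr_ge0; [rewrite invr_ge0 ler0n|exact: Phi_choi_psd].
rewrite big_ord1 big_split_ord /= big1 => [|q _]; last first.
  by rewrite big1// => i _; rewrite big1// => j _; rewrite theta_rl mxE mulr0 mul0r.
rewrite add0r big_ord1; set z := y _.
have -> : \sum_i \sum_j (z i)^* * theta (rshift n2 0) (rshift n2 0) i j * z j =
   \sum_i (z i)^* * z i - n1%:R^-1 * \sum_i \sum_j (z i)^* * Phi 1%:M i j * z j.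
  rewrite mulr_sumr -sumrB; apply: eq_bigr => i _.
  rewrite -[X in X - _](sum_delta (fun j => (z i)^* * z j)) mulr_sumr -sumrB.
  by apply: eq_bigr => j _; rewrite theta_rr !mxE eq_sym; ring.
rewrite subr_ge0; apply: le_trans (_ : n1%:R^-1 * (n1%:R * \sum_i (z i)^* * z i) <= _).
  rewrite ler_wpM2l ?invr_ge0 ?ler0n//; apply: le_trans (psd_le_trace Phi1_psd z) _.
  suff -> : \tr (Phi 1%:M) = n1%:R by [].
  by have := Phitr 1%:M; rewrite /ntr mxtrace1 mulVf// => /(canRL (mulKf (invr_neq0 n1C)));
    rewrite invrK mulr1.
by rewrite mulrA mulVf// mul1r.
Qed.

Lemma ntr_theta p q : ntr (theta p q) = @omega R n1 n2 (delta_mx p q).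
Proof.
rewrite omega_delta /wt.
case: (split_ordP p) => [i ->|i ->]; case: (split_ordP q) => [j ->|j ->].
- rewrite theta_ll /ntr mxtraceZ -[n1%:R^-1 * \tr _]/(ntr (Phi (delta_mx i j))) Phitr.
  by rewrite ntr_delta eq_lshift mulrA mulrC.
- by rewrite theta_lr /ntr mxtrace0 mulr0 eq_lrshift mul0r.
- by rewrite theta_rl /ntr mxtrace0 mulr0 eq_rlshift mul0r.
rewrite theta_rr /ntr raddfB /= mxtrace1 mxtraceZ -[n1%:R^-1 * \tr (Phi _)]/(ntr (Phi 1%:M)) Phitr.
rewrite /ntr mxtrace1 mulVf// !ord1 eqxx mul1r mulrC.
by [].
Qed.

Lemma sum_theta1 : \sum_p \sum_q (1%:M : 'M[C]_(n2 + 1)) p q *: theta p q = 1%:M.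
Proof.
rewrite sum_theta (_ : ulsubmx 1%:M = 1%:M); last first.
  by apply/matrixP => i j; rewrite !mxE eq_lshift.
by rewrite mxE eqxx scale1r addrC subrK.
Qed.

Variables (k : nat) (a : 'I_k -> 'M[C]_n1) (b : 'I_k -> 'M[C]_n2).
Hypothesis Phib : forall i, Phi (b i) = a i.

Let a' : 'I_k -> opM R (Fin hn1) := fun i => mx_op (n1%:R^-1 *: a i).
Let b' : 'I_k -> opM R (Fin (addn1_gt0 n2)) := fun i => mx_op (block_mx (b i) 0 0 0).

(** A trace-preserving completely positive map from b to a gives majorization by
every nc majorization function. *)
Lemma majorize_of_cp (p : edim) (r : R) (F : multifun R k p) :
  in_nc_ball r b' -> nc_majorization_function r F ->
  set_le [set id_tensor (@ntr R n1) T | T in F (Fin hn1) a']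
         [set id_tensor (@omega R n1 n2) T | T in F (Fin (addn1_gt0 n2)) b'].
Proof.
move=> hb [_ _ _ Fconv] _ [T FT <-].
have [N [K0 hK0]] := gram theta_psd.
pose K l : 'M[C]_(n2 + 1, n1) := \matrix_(p, i) (K0 l (p, i))^*.
have hK p0 q i j : theta p0 q i j = \sum_l (K l p0 i)^* * K l q j.
  rewrite (hK0 (p0, i) (q, j)); apply: eq_bigr => l _.
  by rewrite !mxE conjCK.
pose al (i : nat) : opMN R (Fin (addn1_gt0 n2)) (Fin hn1) :=
  if insub i is Some l then rect_op (K l) else 0.
(* The Kraus family is padded with zeros, so the partial sums are eventually
constant. *)
have sumE (V : zmodType) (f : bop R 'I_n1 'I_(n2 + 1) -> V) : f 0 = 0 ->
    forall M, (N <= M)%N -> \sum_(i < M) f (al i) = \sum_(l < N) f (rect_op (K l)).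
  move=> f0 M NM; rewrite -(big_mkord xpredT (fun i => f (al i))).
  rewrite (big_cat_nat (leq0n N) NM) /= [X in _ + X]big_nat_cond.
  rewrite [X in _ + X]big1 ?addr0 => [|i /andP[/andP[Ni _] _]].
    rewrite big_mkord; apply: eq_bigr => l _; rewrite /al.
    by case: insubP => [l' _ /val_inj -> //|]; rewrite ltn_ord.
  by rewrite /al insubF ?f0// ltnNge Ni.
have cvgE (V : topologicalType) (g : nat -> V) l : (forall M, (N <= M)%N -> g M = l) ->
    g @ \oo --> l.
  by move=> gl; apply: cvg_near_cst; exists N.
exists (id_tensor (@omega R n1 n2) T); last first.
  by move=> u; rewrite subrr inner0l.
exists (\sum_l amp (idx p) (rect_op (K l))^\dag \cdot T \cdot amp (idx p) (rect_op (K l))); last first.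
  apply: (kraus_id_tensor hK) => p0 q; rewrite -ntr_theta.
  rewrite [RHS]mulr_sumr; apply: eq_bigr => i _.
  rewrite -[RHS](sum_delta (fun j => n1%:R^-1 * theta p0 q i j) i); apply: eq_bigr => j _.
  by rewrite ntr_delta eq_sym mulrAC.
have zl (J I : choiceType) (X : bop R J I) (L : choiceType) : X \cdot (0 : bop R L J) = 0.
  by apply: bop_ext => u; rewrite -[LHS]/(X 0) linear0.
have C0 (i : nat) : graph r F (b', T) by split.
have C1 : exists c : R, forall i : nat,
    (forall j, opnorm (b' j) <= c) /\ opnorm T <= c.
  exists (`|opnorm T| + \sum_j `|opnorm (b' j)|) => _; split=> [j|].
    apply: le_trans (ler_norm _) _; rewrite (bigD1 j)//= addrCA lerDl.
    by rewrite addr_ge0// sumr_ge0.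
  by apply: le_trans (ler_norm _) _; rewrite lerDl sumr_ge0.
have C2 : (fun M => \sum_(i < M) (al i)^\dag \cdot al i) @ \oo --> bop_id R 'I_n1.
  apply: cvgE => M NM; rewrite (sumE _ (fun A => A^\dag \cdot A) (zl _ _ _ _) M NM).
  rewrite -mx_op1 -sum_theta1 -(kraus_mx hK); apply: eq_bigr => l _.
  by rewrite mx_op1 bop_comp1.
have C3 j : (fun M => \sum_(i < M) (al i)^\dag \cdot b' j \cdot al i) @ \oo --> a' j.
  apply: cvgE => M NM; rewrite (sumE _ (fun A => A^\dag \cdot b' j \cdot A) (zl _ _ _ _) M NM).
  rewrite (kraus_mx hK) sum_theta block_mxKul Phib block_mxEdr mxE scale0r addr0.
  by [].
have C4 : (fun M => \sum_(i < M) amp (idx p) (al i)^\dag \cdot T \cdot amp (idx p) (al i))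
   @ \oo --> \sum_l amp (idx p) (rect_op (K l))^\dag \cdot T \cdot amp (idx p) (rect_op (K l)).
  apply: cvgE => M NM.
  rewrite (sumE _ (fun A => amp (idx p) A^\dag \cdot T \cdot amp (idx p) A) _ M NM)//.
  by rewrite amp0 zl.
by have [_] := Fconv _ _ _ _ al C0 C1 C2 _ _ C3 C4.
Qed.

End Sufficiency.

(** * From majorization to a completely positive map *)

Section Exchange.
Variable V : nmodType.

Lemma exchange_sum12 (A B D : finType) (F : A -> B -> D -> V) :
  \sum_a \sum_b \sum_d F a b d = \sum_d \sum_a \sum_b F a b d.
Proof.
by rewrite [RHS]exchange_big; apply: eq_bigr => a _; exact: exchange_big.
Qed.

Lemma exchange_sum22 (A B D E : finType) (F : A -> B -> D -> E -> V) :
  \sum_a \sum_b \sum_d \sum_e F a b d e = \sum_d \sum_e \sum_a \sum_b F a b d e.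
Proof. by rewrite exchange_sum12; apply: eq_bigr => d _; exact: exchange_sum12. Qed.

End Exchange.

Section BlockMap.
Variables (R : realType) (m n : nat).
Local Notation C := R[i].

(** The linear map that sends the matrix unit E_pq to c M_pq. *)
Definition block_map (c : C) (M : 'I_m -> 'I_m -> 'M[C]_n) (Y : 'M[C]_m) : 'M[C]_n :=
  c *: \sum_p \sum_q Y p q *: M p q.

Lemma block_map_linear c M : linear (block_map c M).
Proof.
move=> a Y Z; rewrite /block_map scalerA mulrC -scalerA -scalerDr; congr (_ *: _).
rewrite scaler_sumr -big_split; apply: eq_bigr => p _ /=.
rewrite scaler_sumr -big_split; apply: eq_bigr => q _ /=.
by rewrite !mxE scalerDl scalerA.
Qed.

HB.instance Definition _ c M :=
  GRing.isLinear.Build C 'M[C]_m 'M[C]_n _ (block_map c M) (block_map_linear c M).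

Lemma block_mapE c M Y i j :
  block_map c M Y i j = c * \sum_p \sum_q Y p q * M p q i j.
Proof.
rewrite mxE summxE; congr (_ * _); apply: eq_bigr => p _; rewrite summxE.
by apply: eq_bigr => q _; rewrite mxE.
Qed.

(** Choi: a map with positive Choi matrix is completely positive. *)
Lemma block_map_cp (c : C) (M : 'I_m -> 'I_m -> 'M[C]_n) : 0 <= c ->
  (forall g : 'I_m -> 'I_n -> C,
     0 <= \sum_p \sum_q \sum_i \sum_j (g p i)^* * M p q i j * g q j) ->
  completely_positive (block_map c M).
Proof.
move=> c0 hM q A /psd_block/gram[N [K hK]]; apply/psd_block.
apply/(psdfun_pair (fun s t i j => block_map c M (A s t) i j)) => y.
pose g l p j := \sum_t (K l (t, p))^* * y t j.
have -> : \sum_s \sum_t \sum_i \sum_j (y s i)^* * block_map c M (A s t) i j * y t j =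
    c * \sum_l \sum_p \sum_p' \sum_i \sum_j (g l p i)^* * M p p' i j * g l p' j.
  transitivity (c * \sum_s \sum_t \sum_i \sum_j \sum_p \sum_p' \sum_l
     (y s i)^* * (K l (s, p) * (K l (t, p'))^*) * M p p' i j * y t j).
    rewrite mulr_sumr; apply: eq_bigr => s _; rewrite mulr_sumr; apply: eq_bigr => t _.
    rewrite mulr_sumr; apply: eq_bigr => i _; rewrite mulr_sumr; apply: eq_bigr => j _.
    rewrite block_mapE [_ * (c * _)]mulrCA -mulrA; congr (_ * _).
    rewrite mulr_sumr mulr_suml; apply: eq_bigr => p _.
    rewrite mulr_sumr mulr_suml; apply: eq_bigr => p' _.
    rewrite (hK (s, p) (t, p')) mulr_suml mulr_sumr mulr_suml; apply: eq_bigr => l _ /=.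
    by ring.
  congr (_ * _).
  under eq_bigr => s _ do under eq_bigr => t _ do under eq_bigr => i _ do
    under eq_bigr => j _ do rewrite exchange_sum12.
  rewrite exchange_sum22.
  under eq_bigr => i _ do under eq_bigr => j _ do rewrite exchange_sum12.
  rewrite exchange_sum12; apply: eq_bigr => l _.
  under eq_bigr => i _ do under eq_bigr => j _ do rewrite exchange_sum22.
  rewrite exchange_sum22; apply: eq_bigr => p _; apply: eq_bigr => p' _.
  apply: eq_bigr => i _; apply: eq_bigr => j _.
  rewrite /g rmorph_sum !mulr_suml; apply: eq_bigr => s _.
  rewrite mulr_sumr; apply: eq_bigr => t _.
  by rewrite /= rmorphM /= conjCK; ring.
apply: mulr_ge0 => //; apply: sumr_ge0 => l _; exact: hM.
Qed.

End BlockMap.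

Section Necessity.
Variables (R : realType) (k n1 n2 : nat).
Hypothesis (hn1 : (0 < n1)%N) (hn2 : (0 < n2)%N).
Local Notation C := R[i].
Local Notation m := (n2 + 1)%N.
Local Notation P := 'I_m.

Let n1C : (n1%:R : C) != 0. Proof. by rewrite pnatr_eq0 -lt0n. Qed.
Let n2C : (n2%:R : C) != 0. Proof. by rewrite pnatr_eq0 -lt0n. Qed.

(** Every tuple lies in the balls of large radius. *)
Lemma ball_exists n (x : 'I_k -> opM R n) :
  exists2 M : R, 0 <= M & forall r, M <= r ^+ 2 -> in_nc_ball r x.
Proof.
have h j : exists c : R, 0 <= c /\ forall u, l2norm ((x j)^\dag u) <= c * l2norm u.
  have [c c0 hc] := opbd_exists (x j)^\dag.
  by exists c; split => // u; exact: opbd_norm.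
have /choice[c hc] := h.
exists (\sum_j c j ^+ 2); first by apply: sumr_ge0 => j _; exact: sqr_ge0.
move=> r hr; apply/in_nc_ballE => u; apply: le_trans (ler_wpM2r (sqr_ge0 _) hr).
rewrite mulr_suml; apply: ler_sum => j _; have [c0 hj] := hc j.
by rewrite -exprMn ler_pXn2r ?nnegrE ?mulr_ge0 ?l2norm_ge0.
Qed.

(** The unnormalized maximally entangled vector \sum_p e_p (x) e_p. *)
Definition maxent : l2 R (P * P)%type := \sum_p fiber_in P p (ebasis R p).

(** The Choi matrix of the identity map. *)
Definition choi_id : bop R (P * P)%type (P * P)%type := rank1 maxent maxent.

Lemma inner_maxent x : inner x maxent = \sum_p x (p, p).
Proof.
rewrite /maxent inner_sumr; apply: eq_bigr => p _.
by rewrite innerJ inner_fiber_in -innerJ inner_ebasis.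
Qed.

Lemma fiber_in_maxent p u : inner (fiber_in P p u) maxent = u p.
Proof.
rewrite inner_fiber_in -inner_ebasis; congr inner; rewrite /maxent.
have fD (s t : l2 R (P * P)%type) : l2_fiber (s + t) p = l2_fiber s p + l2_fiber t p.
  exact/val_inj.
have f0 : l2_fiber (0 : l2 R (P * P)%type) p = 0 by exact/val_inj.
rewrite (big_morph (fun z => l2_fiber z p) fD f0) (bigD1 p isT) l2_fiber_in eqxx.
rewrite big1 => [|q /negbTE qp]; first exact: addr0.
by rewrite l2_fiber_in eq_sym qp.
Qed.

Lemma choi_id_positive : positive choi_id.
Proof. by move=> u; rewrite inner_rank1 (innerJ u); exact: mul_conjC_ge0. Qed.

Lemma ptr_choi_id B : ptr B choi_id = mx_op B.
Proof.
apply: bop_inner_ext => u v; rewrite inner_ptr inner_mx_op.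
apply: eq_bigr => p _; apply: eq_bigr => q _.
by rewrite inner_rank1 (innerJ _ maxent) !fiber_in_maxent.
Qed.

Lemma inner_slice_in n (x : l2 R (P * 'I_n)%type) i w :
  inner x (slice_in R P i w) = \sum_p x (p, i) * (w p)^*.
Proof.
rewrite inner_fibers; apply: eq_bigr => p _; rewrite inner_ord.
rewrite -[RHS](sum_delta (fun l => x (p, l) * (w p)^*) i); apply: eq_bigr => l _.
rewrite -[l2_fiber (slice_in R P i w) p l]/(if l == i then w p else 0).
by case: eqP => _; rewrite ?mulr1 ?conjC0 ?mulr0.
Qed.

Lemma inner_id_tensor n (phi : 'M[C]_n -> C) T (w w' : l2 R P) :
  inner (id_tensor phi T w) w' =
  \sum_i \sum_j phi (delta_mx i j) * inner (T (slice_in R P j w)) (slice_in R P i w').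
Proof.
rewrite inner_ord; under eq_bigr do rewrite id_tensorE mulr_suml.
rewrite exchange_big; apply: eq_bigr => i _; under eq_bigr do rewrite mulr_suml.
rewrite exchange_big; apply: eq_bigr => j _; rewrite inner_slice_in mulr_sumr.
by apply: eq_bigr => p _; rewrite mulrA.
Qed.

Lemma slice_in_fiber n (i : 'I_n) (w : l2 R P) :
  slice_in R P i w = \sum_p w p *: fiber_in 'I_n p (ebasis R i).
Proof.
rewrite [LHS]fiber_decomp; apply: eq_bigr => p _.
rewrite -linearZ; congr (fiber_in _ _ _); apply/val_inj/funext => l.
rewrite -[LHS]/(if l == i then w p else 0) -[RHS]/(w p * ebasis R i l) ebasisE.
by case: eqP; rewrite ?mulr1 ?mulr0.
Qed.

Lemma sum_wt : \sum_(p < n2 + 1) wt R n1 p = 1.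
Proof.
rewrite big_split_ord /= big_ord1 /wt split_rshift.
under eq_bigr do rewrite split_lshift.
rewrite sumr_const card_ord -[_ *+ n2]mulr_natr.
by field; rewrite n1C n2C.
Qed.

Variables (a : 'I_k -> 'M[C]_n1) (b : 'I_k -> 'M[C]_n2).

Let a' : 'I_k -> opM R (Fin hn1) := fun i => mx_op (n1%:R^-1 *: a i).
Let bb (i : 'I_k) : 'M[C]_m := block_mx (b i) 0 0 0.
Let b' : 'I_k -> opM R (Fin (addn1_gt0 n2)) := fun i => mx_op (bb i).

Hypothesis H : forall (p : edim) (r : R), 0 < r -> in_nc_ball r a' -> in_nc_ball r b' ->
  forall F : multifun R k p, nc_majorization_function r F ->
    set_le [set id_tensor (@ntr R n1) T | T in F (Fin hn1) a']
           [set id_tensor (@omega R n1 n2) T | T in F (Fin (addn1_gt0 n2)) b'].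

(* Testing [Fmaj] on the identity map, whose Choi matrix is [choi_id]. *)
Let extremal : exists (r : R) S X, [/\ wgraph bb r (bop_id R 'I_n1) a' S X &
  op_le (id_tensor (@ntr R n1) S) (id_tensor (@omega R n1 n2) (- choi_id))].
Proof.
have [Ma Ma0 ha] := ball_exists a'; have [Mb Mb0 hb] := ball_exists b'.
pose r := 1 + Ma + Mb.
have r1 : 1 <= r by rewrite /r -addrA lerDl addr_ge0.
have r0 : 0 < r by apply: lt_le_trans r1.
have rr : r <= r ^+ 2 by rewrite expr2 ler_peMr// ltW.
have ra : in_nc_ball r a'.
  by apply: ha; apply: le_trans rr; rewrite /r addrAC lerDr addr_ge0.
have rb : in_nc_ball r b'.
  by apply: hb; apply: le_trans rr; rewrite /r lerDr addr_ge0.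
have := H r0 ra rb (@Fmaj_majorization R _ k (addn1_gt0 n2) bb r r0).
have X1 : ptr 1%:M choi_id = bop_id R P by rewrite ptr_choi_id mx_op1.
have Fb : @Fmaj R _ k (addn1_gt0 n2) bb r _ b' (Smin bb b' choi_id).
  exists choi_id; apply: wgraph_Smin => //; first exact: choi_id_positive.
  exact/in_nc_ball_wball.
have SE : Smin bb b' choi_id = - choi_id.
  rewrite /Smin big1 ?addr0// => j _; rewrite ptr_choi_id subrr amp0.
  by apply: bop_ext => u; rewrite -[LHS]/(0^\dag 0) linear0.
rewrite SE in Fb => /(_ _ (ex_intro2 _ _ _ Fb erefl))[_ [S [X hX] <-] hS].
by exists r, S, X.
Qed.

(** Majorization by every nc majorization function gives a trace-preserving
completely positive map from b to a. *)
Lemma cp_of_majorize : exists Phi : {linear 'M[C]_n2 -> 'M[C]_n1},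
   [/\ completely_positive Phi, forall X, ntr (Phi X) = ntr X & forall i, Phi (b i) = a i].
Proof.
have [r [S [X [[_ sS pX X1 hX] hS]]]] := extremal.
pose M (p q : P) : 'M[C]_n1 := \matrix_(i, j)
  inner (X (fiber_in 'I_n1 q (ebasis R j))) (fiber_in 'I_n1 p (ebasis R i)).
pose z j := a' j - ptr (bb j) X.
pose u i w : l2 R (P * 'I_n1)%type := slice_in R P i w.
pose D w : R := \sum_i \sum_j l2norm (amp P (z j) (u i w)) ^+ 2.
pose G p q : C := ntr (M p q) - @omega R n1 n2 (delta_mx p q).
pose Q (w : l2 R P) : C := \sum_p \sum_q (w p)^* * G p q * w q.
have D0 w : 0 <= D w by do 2![apply: sumr_ge0 => ? _]; exact: sqr_ge0.
have sX := positive_sa pX.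
(* The defining inequality of the graph, averaged over the basis and compared
with the majorization inequality. *)
have QD w : n1%:R^-1 * (D w)%:C <= Q w.
  have S1 : inner (id_tensor (@ntr R n1) S w) w = n1%:R^-1 * (\sum_i qf S (u i w))%:C.
    rewrite inner_id_tensor rmorph_sum mulr_sumr; apply: eq_bigr => i _.
    transitivity (\sum_j (n1%:R^-1 * inner (S (u j w)) (u i w)) * (j == i)%:R).
      by apply: eq_bigr => j _; rewrite ntr_delta eq_sym mulrAC.
    by rewrite sum_delta sa_real.
  have S2 : inner (id_tensor (@omega R n1 n2) (- choi_id) w) w =
      - \sum_p \sum_q (w p)^* * @omega R n1 n2 (delta_mx p q) * w q.
    have ux q : inner (slice_in R P q w) maxent = w q.
      rewrite inner_maxent -[RHS](sum_delta (fun j => w j) q); apply: eq_bigr => j _.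
      rewrite -[slice_in R P q w (j, j)]/(if j == q then w j else 0).
      by case: eqP; rewrite ?mulr1 ?mulr0.
    rewrite inner_id_tensor -sumrN; apply: eq_bigr => p _.
    rewrite -sumrN; apply: eq_bigr => q _.
    by rewrite inner_opN inner_rank1 (innerJ _ maxent) !ux; ring.
  have S3 : n1%:R^-1 * (\sum_i qf X (u i w))%:C =
      \sum_p \sum_q (w p)^* * ntr (M p q) * w q.
    transitivity (n1%:R^-1 * \sum_i \sum_p \sum_q (w p)^* * M p q i i * w q).
      congr (_ * _); rewrite rmorph_sum; apply: eq_bigr => i _ /=.
      rewrite -(sa_real _ sX) /u slice_in_fiber inner_sumr; apply: eq_bigr => p _.
      rewrite linear_sum inner_suml; apply: eq_bigr => q _.
      by rewrite linearZ innerZl innerZr mxE; ring.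
    rewrite -exchange_sum12 mulr_sumr; apply: eq_bigr => p _.
    rewrite mulr_sumr; apply: eq_bigr => q _.
    by rewrite /ntr /mxtrace !mulr_sumr mulr_suml; apply: eq_bigr => i _; ring.
  have QE : Q w = n1%:R^-1 * (\sum_i qf X (u i w))%:C +
      inner (id_tensor (@omega R n1 n2) (- choi_id) w) w.
    rewrite S3 S2 -sumrN -big_split; apply: eq_bigr => p _ /=.
    rewrite -sumrN -big_split; apply: eq_bigr => q _ /=.
    by rewrite /G; ring.
  have := hS w; rewrite inner_opB subr_ge0 S1 => hle.
  rewrite QE; apply: le_trans (lerD (lexx _) hle).
  rewrite -mulrDr ler_wpM2l ?invr_ge0 ?ler0n// -rmorphD lecR -big_split /=.
  apply: ler_sum => i _; rewrite addrC.
  have := hX (u i w) (fun j => amp P (z j) (u i w)); apply: le_trans.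
  rewrite le_eqVlt; apply/orP; left; apply/eqP; apply: eq_bigr => j _.
  by rewrite amp_id qf_id square_bound_eq.
have Gpsd : psdfun G.
  move=> y; pose w := lin (index_enum 'I_m) y.
  have wE p : w p = y p by apply: linE; [exact: index_enum_uniq|exact: mem_index_enum].
  have <- : Q w = \sum_s \sum_t (y s)^* * G s t * y t.
    by apply: eq_bigr => p _; apply: eq_bigr => q _; rewrite !wE.
  by apply: le_trans (QD w); rewrite mulr_ge0 ?invr_ge0 ?ler0n// ge0c.
have Gtr : \sum_p G p p = 0.
  rewrite sumrB; apply/eqP; rewrite subr_eq0; apply/eqP.
  transitivity (1 : C).
    rewrite -mulr_sumr exchange_big -[RHS](mulVf n1C); congr (_ * _).
    transitivity (\sum_(i < n1) (1 : C)); last by rewrite sumr_const card_ord.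
    apply: eq_bigr => i _; have := inner_ptr1 X (ebasis R i) (ebasis R i).
    rewrite X1 inner_ebasis -[bop_id R _ _ _]/(ebasis R i i) ebasisE eqxx => h.
    rewrite -[RHS]/(true%:R : C) h.
    by apply: eq_bigr => p _; rewrite mxE.
  by rewrite -sum_wt; apply: eq_bigr => p _; rewrite omega_delta eqxx mul1r.
(* A positive matrix of trace zero vanishes. *)
have G0 p q : G p q = 0.
  have [N [K hK]] := gram Gpsd.
  have Kp s l : K l s = 0.
    have K0 t : 0 <= \sum_l K l t * (K l t)^* by apply: sumr_ge0 => ? _; exact: mul_conjC_ge0.
    have h1 : \sum_s \sum_l K l s * (K l s)^* = 0.
      by rewrite -[RHS]Gtr; apply: eq_bigr => t _; rewrite hK.
    have h2 := psumr_eq0P (fun t _ => K0 t) h1.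
    have h3 := psumr_eq0P (fun l _ => mul_conjC_ge0 (K l s)) (h2 s isT).
    by apply/eqP; rewrite -mul_conjC_eq0; apply/eqP; exact: h3.
  by rewrite hK big1// => l _; rewrite Kp mul0r.
have z0 j : z j = 0.
  pose p0 : P := rshift n2 0; pose w : l2 R P := ebasis R p0.
  have Dw : D w = 0.
    apply/eqP; rewrite eq_le D0 andbT; have := QD w.
    rewrite /Q big1 => [|p _]; last by rewrite big1// => q _; rewrite G0 mulr0 mul0r.
    by rewrite pmulr_rle0 ?invr_gt0 ?ltr0n// lecR.
  apply: bop_ebasis_ext => i.
  have h1 := psumr_eq0P (fun i _ => sumr_ge0 _ (fun j _ => sqr_ge0 _)) Dw.
  have h2 := psumr_eq0P (fun j _ => sqr_ge0 _) (h1 i isT).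
  have /eqP := h2 j isT; rewrite sqrf_eq0 => /eqP/l2norm_eq0 h3.
  have := l2_fiber_amp (z j) (u i w) p0; rewrite h3.
  have -> : l2_fiber (u i w) p0 = ebasis R i.
    apply/val_inj/funext => l.
    rewrite -[LHS]/(if l == i then w p0 else 0) -[RHS]/((l == i)%:R) /w ebasisE eqxx.
    by case: eqP.
  by move=> <-; exact/val_inj.
exists (block_map n1%:R (fun p q : 'I_n2 => M (lshift 1 p) (lshift 1 q))); split.
- apply: block_map_cp; first exact: ler0n.
  move=> g; pose x := \sum_p \sum_i g p i *: fiber_in 'I_n1 (lshift 1 p) (ebasis R i).
  have := pX x; congr (0 <= _).
  rewrite {2}/x inner_sumr; apply: eq_bigr => p _.
  transitivity (\sum_q \sum_i \sum_j (g p i)^* * M (lshift 1 p) (lshift 1 q) i j * g q j)=> //.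
  rewrite [RHS]exchange_big inner_sumr; apply: eq_bigr => i _.
  rewrite innerZr /x linear_sum inner_suml mulr_sumr; apply: eq_bigr => q _.
  rewrite linear_sum inner_suml mulr_sumr; apply: eq_bigr => j _.
  by rewrite linearZ innerZl mxE; ring.
- move=> Y.
  transitivity (\sum_p \sum_q Y p q * (n1%:R * ntr (M (lshift 1 p) (lshift 1 q)))).
    rewrite /ntr /mxtrace; under eq_bigr do rewrite block_mapE.
    rewrite -mulr_sumr mulKf// -exchange_sum12.
    apply: eq_bigr => p _; apply: eq_bigr => q _.
    by rewrite mulVKf// mulr_sumr.
  rewrite [ntr Y]/ntr [\tr Y]/mxtrace mulr_sumr; apply: eq_bigr => p _.
  rewrite -[RHS](sum_delta (fun q => n2%:R^-1 * Y p q) p); apply: eq_bigr => q _.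
  have := G0 (lshift 1 p) (lshift 1 q); rewrite /G => /eqP; rewrite subr_eq0 => /eqP ->.
  rewrite omega_delta eq_lshift /wt split_lshift eq_sym.
  by field; rewrite n1C n2C.
- move=> l; apply/matrixP => i j; rewrite block_mapE.
  have /eqP := z0 l; rewrite subr_eq0 => /eqP hl.
  have h : \sum_p \sum_q bb l p q * M p q i j = n1%:R^-1 * a l i j.
    transitivity (inner (a' l (ebasis R j)) (ebasis R i)).
      rewrite hl inner_ptr; apply: eq_bigr => p _; apply: eq_bigr => q _.
      by rewrite [M p q i j]mxE.
    by rewrite mx_op_entry mxE.
  rewrite -[RHS](mulVKf n1C) -h; congr (_ * _); rewrite [RHS]big_split_ord /= [X in _ = _ + X]big1 => [|p _].
    rewrite addr0; apply: eq_bigr => p _; rewrite [RHS]big_split_ord /= [X in _ = _ + X]big1 => [|q _].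
      by rewrite addr0; apply: eq_bigr => q _; rewrite block_mxEul mxE.
    by rewrite block_mxEur mxE mul0r.
  rewrite big_split_ord /= big1 => [|q _]; last by rewrite block_mxEdl mxE mul0r.
  by rewrite add0r big1// => q _; rewrite block_mxEdr mxE mul0r.
Qed.

End Necessity.

Unset Implicit Arguments.
Local Open Scope complex_scope.

Theorem theorem1p7 (R : realType) (k n1 n2 : nat)
    (hk : (0 < k)%N) (hn1 : (0 < n1)%N) (hn2 : (0 < n2)%N)
    (a : 'I_k -> 'M[R[i]]_n1) (b : 'I_k -> 'M[R[i]]_n2)
    (ha : forall i, a i \is hermsymmx) (hb : forall i, b i \is hermsymmx) :
  let a' : 'I_k -> opM R (Fin hn1) := fun i => mx_op (n1%:R^-1 *: a i) in
  let b' : 'I_k -> opM R (Fin (addn1_gt0 n2)) :=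
    fun i => mx_op (block_mx (b i) 0 0 0) in
  (forall (p : edim) (r : R), 0 < r -> in_nc_ball r a' -> in_nc_ball r b' ->
     forall F : multifun R k p, nc_majorization_function r F ->
       set_le [set id_tensor (@ntr R n1) T | T in F (Fin hn1) a']
              [set id_tensor (@omega R n1 n2) T | T in F (Fin (addn1_gt0 n2)) b'])
  <->
  (exists Phi : {linear 'M[R[i]]_n2 -> 'M[R[i]]_n1},
     [/\ completely_positive Phi,
         forall X, ntr (Phi X) = ntr X
       & forall i, Phi (b i) = a i]).
Proof.
move=> a' b'; split=> [H|[Phi [PhiCP Phitr Phib]] p r _ _ rb F hF].
  exact: (cp_of_majorize (hn1 := hn1) hn2 H).
exact: (majorize_of_cp hn1 hn2 PhiCP Phitr Phib rb hF).
Qed.
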